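(* Let $(M^{2n},J)$ be a compact complex manifold. Suppose $g_t$ is a solution to the pluriclosed flow on $[0,\tau)$, with $\alpha_t$ a solution to the $(\hat g_t,h,\mu)$-reduced flow. Assume there is a constant $\lambda>0$ such that for all $t\in[0,\tau)$, $\lambda g_0\le g_t$. Then there exists a constant $\Lambda=\Lambda(n,g_0,\hat g,h,\mu,\lambda)$ such that for all $t\in[0,\tau)$, $$g_t\le\Lambda(1+t)g_0,\qquad |\partial\alpha_t|^2_{g_t}\le\Lambda .$$
   Context: For a Hermitian metric $g$ with coefficients $g_{i\bar j}$ in holomorphic coordinates, $\omega=\sqrt{-1}\,g_{i\bar j}dz^i\wedge d\bar z^j$; $g$ is pluriclosed if $\partial\bar\partial\omega=0$. With Chern connection $\Gamma_{ij}^k=g^{\bar lk}g_{j\bar l,i}$, torsion $T_{ij\bar k}=g_{j\bar k,i}-g_{i\bar k,j}$, curvature $\Omega_{i\bar jk}{}^l=-\partial_{\bar j}\Gamma_{ik}^l$, $S_{i\bar j}=g^{\bar qp}\Omega_{p\bar qi\bar j}$ and $Q_{i\bar j}=g^{\bar lk}g^{\bar nm}T_{ik\bar n}T_{\bar j\bar lm}$, pluriclosed flow is $\frac{\partial}{\partial t}g=-S+Q$, equivalently $\frac{\partial}{\partial t}\omega=\partial\partial^*_g\omega+\bar\partial\bar\partial_g^*\omega+\sqrt{-1}\partial\bar\partial\log\det g$, with pluriclosed initial metric. Reduced flow: $h$ is a Hermitian metric, $\rho(h)=-\sqrt{-1}\,\partial\bar\partial\log\det h$, and $\mu\in\Lambda^{1,0}$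 is such that $\hat\omega_\tau:=\omega_0-\tau\rho(h)+\bar\partial\mu+\partial\bar\mu>0$. Set $\hat\omega_t=\frac t\tau\hat\omega_\tau+\frac{\tau-t}{\tau}\omega_0$, with associated metrics $\hat g_t$. For a family $\alpha_t\in\Lambda^{1,0}$ put $\omega_\alpha=\hat\omega_t+\bar\partial\alpha_t+\partial\bar\alpha_t$, with metric $g_\alpha$. Then $\alpha_t$ solves the $(\hat g_t,h,\mu)$-reduced flow if $$\frac{\partial}{\partial t}\alpha=\bar\partial^*_{g_\alpha}\omega_\alpha-\frac{\sqrt{-1}}2\partial\log\frac{\det g_\alpha}{\det h}-\frac\mu\tau,\qquad \alpha_0=0,$$ where $(\bar\partial^*_g\omega)_i=\sqrt{-1}\,g^{\bar qp}(g_{p\bar q,i}-g_{i\bar q,p})$; here $\omega_{\alpha_t}=\omega_t$. *)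

(* Defs.v *)
From HB Require Import structures.
From mathcomp Require Import all_boot all_order all_algebra.
From mathcomp Require Import all_classical all_reals all_analysis.
From mathcomp Require Import complex.
Set Implicit Arguments.
Unset Strict Implicit.
Unset Printing Implicit Defensive.
Import Order.TTheory GRing.Theory Num.Theory.
Import numFieldNormedType.Exports.
Local Open Scope classical_set_scope.
Local Open Scope ring_scope.
Local Open Scope complex_scope.

(* The complex coordinate space C^n, as pairs (x, y) standing for z = x + i y;
   in this form it is a normed module over R. *)
Notation Cn R n := ('rV[R]_n * 'rV[R]_n)%type.

(** ** Smoothness and the Wirtinger operators *)

(* f is C^k on the open set U *)
Fixpoint Ck (R : realType) (V : normedModType R) (k : nat) (U : set V)
    (f : V -> R) : Prop :=
  (forall x, U x -> {for x, continuous f}) /\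
  if k is k'.+1 then
    forall v, (forall x, U x -> derivable f x v) /\ Ck k' U ('D_v f)
  else True.

Definition smooth_on (R : realType) (V : normedModType R) (U : set V)
    (f : V -> R[i]) : Prop :=
  forall k,
    Ck k U (fun x => complex.Re (f x)) /\ Ck k U (fun x => complex.Im (f x)).

(* Smoothness of (t, z) |-> f t z on [0, tau) x U.  This set is not open at
   t = 0, so smoothness there means, as usual, the existence of a smooth
   extension to an open neighbourhood. *)
Definition smooth_family (R : realType) (V : normedModType R) (tau : R)
    (U : set V) (f : R -> V -> R[i]) : Prop :=
  exists (W : set (R * V)%type) (F : R * V -> R[i]),
    [/\ open W, smooth_on W F &
        forall t z, 0 <= t < tau -> U z -> W (t, z) /\ F (t, z) = f t z].

(* u'(t) = l, for u defined on [0, tau): the derivative is one-sided at t = 0 *)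
Definition is_dt (R : realType) (tau : R) (u : R -> R[i]) (t : R) (l : R[i])
    : Prop :=
  ((s - t)^-1 * (complex.Re (u s) - complex.Re (u t))
     @[s --> within `[0, tau[ t^'] --> complex.Re l) /\
  ((s - t)^-1 * (complex.Im (u s) - complex.Im (u t))
     @[s --> within `[0, tau[ t^'] --> complex.Im l).

Section Local.
Context {R : realType} {n : nat}.
Implicit Types (f : Cn R n -> R[i]) (z : Cn R n) (i j k l : 'I_n).

Definition zcoord k z : R[i] := z.1 0 k +i* z.2 0 k.

Definition dirD (v : Cn R n) f z : R[i] :=
  'D_v (fun w => complex.Re (f w)) z +i* 'D_v (fun w => complex.Im (f w)) z.

(* d/dz^j = (d/dx^j - i d/dy^j) / 2 and d/dzbar^j = (d/dx^j + i d/dy^j) / 2 *)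
Definition dz j f z : R[i] :=
  2^-1 * (dirD (delta_mx 0 j, 0) f z - 'i * dirD (0, delta_mx 0 j) f z).
Definition dzb j f z : R[i] :=
  2^-1 * (dirD (delta_mx 0 j, 0) f z + 'i * dirD (0, delta_mx 0 j) f z).

Definition holomorphic_on (U : set (Cn R n)) (F : Cn R n -> Cn R n) : Prop :=
  forall k, smooth_on U (fun z => zcoord k (F z)) /\
    forall j z, U z -> dzb j (fun w => zcoord k (F w)) z = 0.

(** ** Pointwise Hermitian algebra *)

(* A(v, vbar) = A_{i jbar} v^i vbar^j *)
Definition hform (A : 'M[R[i]]_n) (v : 'rV[R[i]]_n) : R[i] :=
  \sum_i \sum_j A i j * v 0 i * (v 0 j)^*.

Definition hermitian_mx (A : 'M[R[i]]_n) : Prop :=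
  forall i j, A i j = (A j i)^*.

Definition posdef (A : 'M[R[i]]_n) : Prop :=
  hermitian_mx A /\ forall v, v != 0 -> 0 < hform A v.

Definition herm_le (A B : 'M[R[i]]_n) : Prop :=
  forall v, hform A v <= hform B v.

(** ** Chern geometry of a metric G_{i jbar} in a coordinate patch *)

Implicit Types (G h : Cn R n -> 'M[R[i]]_n) (a : Cn R n -> 'rV[R[i]]_n).

(* ginv G z l k is g^{lbar k}, where g_{j lbar} g^{lbar k} = delta_j^k *)
Definition ginv G z : 'M[R[i]]_n := invmx (G z).

Definition christoffel G z i j k : R[i] :=
  \sum_l ginv G z l k * dz i (fun w => G w j l) z.

Definition torsion G z i j k : R[i] :=
  dz i (fun w => G w j k) z - dz j (fun w => G w i k) z.

Definition curvature G z i j k l : R[i] :=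
  - dzb j (fun w => christoffel G w i k l) z.

(* the upper index of the curvature is lowered with the metric *)
Definition curvS G z : 'M[R[i]]_n := \matrix_(i, j)
  \sum_p \sum_q ginv G z q p * \sum_m curvature G z p q i m * G z m j.

Definition torsQ G z : 'M[R[i]]_n := \matrix_(i, j)
  \sum_k \sum_l \sum_m \sum_r ginv G z l k * ginv G z r m *
    torsion G z i k r * (torsion G z j l m)^*.

(* Each summand of del delbar omega, antisymmetrised in the dz indices i, k and
   in the dzbar indices j, l: these are the components of the (2,2)-form. *)
Definition pluriclosed_at G z : Prop :=
  forall i j k l,
    dz i (dzb j (fun w => G w k l)) z - dz k (dzb j (fun w => G w i l)) z
    - dz i (dzb l (fun w => G w k j)) z + dz k (dzb l (fun w => G w i j)) z
    = 0.

(** ** Forms; the matrix of a (1,1)-form psi collects its coefficients in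
       psi = psi_{i jbar} dz^i /\ dzbar^j *)

Definition omega_of G z : 'M[R[i]]_n := 'i *: G z.
Definition metric_of (psi : Cn R n -> 'M[R[i]]_n) z : 'M[R[i]]_n :=
  - 'i *: psi z.

Definition log_det G z : R[i] := (ln (complex.Re (\det (G z))))%:C.

Definition rho G z : 'M[R[i]]_n :=
  \matrix_(i, j) (- 'i * dz i (dzb j (log_det G)) z).

(* delbar a, for the (1,0)-form a = a_i dz^i; the sign is that of
   dzbar^j /\ dz^i = - dz^i /\ dzbar^j *)
Definition delbar a z : 'M[R[i]]_n :=
  \matrix_(i, j) (- dzb j (fun w => a w 0 i) z).

(* del abar, for the (0,1)-form conjugate to a *)
Definition del_conj a z : 'M[R[i]]_n :=
  \matrix_(i, j) dz i (fun w => (a w 0 j)^*) z.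

Definition delbar_star G z : 'rV[R[i]]_n := \row_i
  ('i * \sum_p \sum_q ginv G z q p *
     (dz i (fun w => G w p q) z - dz p (fun w => G w i q) z)).

(* the tensor components of del a = (del a)_{ij} dz^i (x) dz^j *)
Definition del a z : 'M[R[i]]_n :=
  \matrix_(i, j) (dz i (fun w => a w 0 j) z - dz j (fun w => a w 0 i) z).

Definition norm2_20 G z (phi : 'M[R[i]]_n) : R[i] :=
  \sum_i \sum_j \sum_k \sum_l
    ginv G z k i * ginv G z l j * phi i j * (phi k l)^*.

Definition omega_hat_end (tau : R) (g0 h : Cn R n -> 'M[R[i]]_n)
    (mu : Cn R n -> 'rV[R[i]]_n) z : 'M[R[i]]_n :=
  omega_of g0 z - tau%:C *: rho h z + delbar mu z + del_conj mu z.

Definition omega_hat (tau : R) g0 h mu (t : R) z : 'M[R[i]]_n :=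
  (t / tau)%:C *: omega_hat_end tau g0 h mu z
  + ((tau - t) / tau)%:C *: omega_of g0 z.

(* g_alpha, for a reference family omhat of (1,1)-forms *)
Definition metric_alpha (omhat : R -> Cn R n -> 'M[R[i]]_n)
    (alpha : R -> Cn R n -> 'rV[R[i]]_n) (t : R) : Cn R n -> 'M[R[i]]_n :=
  metric_of (fun z => omhat t z + delbar (alpha t) z + del_conj (alpha t) z).

Definition reduced_rhs (tau : R) G h mu z : 'rV[R[i]]_n :=
  delbar_star G z
  - \row_i ('i / 2 *
      dz i (fun w => (ln (complex.Re (\det (G w) / \det (h w))))%:C) z)
  - (tau^-1)%:C *: mu z.

End Local.

(** ** Compact complex manifolds *)

(* [inv_chart a] inverts [chart a] on the image of [chart_dom a]; its values
   elsewhere, like those of [chart a] outside [chart_dom a], are irrelevant.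
   Second countability follows from compactness. *)
Record compact_complex_manifold (R : realType) (n : nat) := {
  carrier :> topologicalType;
  carrier_compact : compact [set: carrier];
  carrier_hausdorff : hausdorff_space carrier;
  atlas : Type;
  chart_dom : atlas -> set carrier;
  chart : atlas -> carrier -> Cn R n;
  inv_chart : atlas -> Cn R n -> carrier;
  chart_dom_open : forall a, open (chart_dom a);
  chart_dom_cover : forall x, exists a, chart_dom a x;
  chartK : forall a x, chart_dom a x -> inv_chart a (chart a x) = x;
  chart_image_open : forall a, open (chart a @` chart_dom a);
  chart_continuous : forall a, {within chart_dom a, continuous (chart a)};
  inv_chart_continuous :
    forall a, {within chart a @` chart_dom a, continuous (inv_chart a)};
  transition_holomorphic : forall a b,
    holomorphic_on (chart a @` (chart_dom a `&` chart_dom b))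
      (chart b \o inv_chart a)
}.

Section Global.
Context {R : realType} {n : nat} (M : compact_complex_manifold R n).

Definition coord_patch (a : atlas M) : set (Cn R n) := chart a @` chart_dom a.
Definition overlap (a b : atlas M) : set (Cn R n) :=
  chart a @` (chart_dom a `&` chart_dom b).
Definition transition (a b : atlas M) : Cn R n -> Cn R n :=
  chart b \o inv_chart a.

(* d w^k / d z^i for w = transition a b z *)
Definition jac (a b : atlas M) (z : Cn R n) (i k : 'I_n) : R[i] :=
  dz i (fun w => zcoord k (transition a b w)) z.

(* Tensor fields are given by their components in the charts; only the values
   of the components of chart a on [coord_patch a] are meaningful. *)
Definition field10 := atlas M -> Cn R n -> 'rV[R[i]]_n.
Definition field11 := atlas M -> Cn R n -> 'M[R[i]]_n.

Definition tensorial10 (alpha : field10) : Prop :=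
  forall a b z i, overlap a b z ->
    alpha a z 0 i =
      \sum_k jac a b z i k * alpha b (transition a b z) 0 k.

Definition tensorial11 (g : field11) : Prop :=
  forall a b z i j, overlap a b z ->
    g a z i j = \sum_k \sum_l
      jac a b z i k * (jac a b z j l)^* * g b (transition a b z) k l.

Definition form10 (alpha : field10) : Prop :=
  tensorial10 alpha /\
  forall a i, smooth_on (coord_patch a) (fun z => alpha a z 0 i).

Definition positive11 (g : field11) : Prop :=
  forall a z, coord_patch a z -> posdef (g a z).

Definition hermitian_metric (g : field11) : Prop :=
  [/\ tensorial11 g,
      forall a i j, smooth_on (coord_patch a) (fun z => g a z i j) &
      positive11 g].

Definition pluriclosed (g : field11) : Prop :=
  forall a z, coord_patch a z -> pluriclosed_at (g a) z.

Definition pluriclosed_flow (tau : R) (g0 : field11) (g : R -> field11)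
    : Prop :=
  [/\ forall t, 0 <= t < tau -> hermitian_metric (g t),
      forall a i j, smooth_family tau (coord_patch a) (fun t z => g t a z i j),
      forall a z, coord_patch a z -> g 0 a z = g0 a z &
      forall t a z i j, 0 <= t < tau -> coord_patch a z ->
        is_dt tau (fun s => g s a z i j) t
          ((- curvS (g t a) z + torsQ (g t a) z) i j)].

(* alpha solves the (ghat_t, h, mu)-reduced flow, ghat_t being given through
   its (1,1)-forms omhat_t *)
Definition reduced_flow (tau : R) (omhat : R -> field11) (h : field11)
    (mu : field10) (alpha : R -> field10) : Prop :=
  let galpha t a := metric_alpha (omhat ^~ a) (alpha ^~ a) t in
  [/\ forall t, 0 <= t < tau -> form10 (alpha t) /\ positive11 (galpha t),
      forall a i,
        smooth_family tau (coord_patch a) (fun t z => alpha t a z 0 i),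
      forall a z, coord_patch a z -> alpha 0 a z = 0 &
      forall t a z i, 0 <= t < tau -> coord_patch a z ->
        is_dt tau (fun s => alpha s a z 0 i) t
          (reduced_rhs tau (galpha t a) (h a) (mu a) z 0 i)].

End Global.

(* Main.v *)
Require Import Defs.
From HB Require Import structures.
From mathcomp Require Import all_boot all_order all_algebra.
From mathcomp Require Import all_classical all_reals all_analysis.
From mathcomp Require Import complex spectral sesquilinear ring lra.
Set Implicit Arguments.
Unset Strict Implicit.
Unset Printing Implicit Defensive.
Import Order.TTheory GRing.Theory Num.Theory.
Import numFieldNormedType.Exports.
Local Open Scope classical_set_scope.
Local Open Scope ring_scope.
Local Open Scope complex_scope.

(* Write G for the evolving metric, T for its torsion and T_0 for that of g_0,
   and put gamma = del alpha + (t/tau) del mu. Since log-determinants drop out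
   of del of a (1,0)-form, G and gamma satisfy a closed parabolic system in
   which T enters through T = T_0 + i delbar gamma. In terms of the generalized
   metric W = [[G + gamma P gamma', gamma P], [P gamma', P]] with P = (G^-1)^T
   and gamma' the adjoint, the system says that W_t is g^{qbar p} times the
   curvature term W_{p qbar} - W_p W^-1 W_qbar of W, up to a zeroth-order twist
   of the derivatives by T_0. Let K be the inverse of the generalized metric of
   g_0 with gamma = 0. A Bochner argument, completing squares, shows that the
   function f = tr(K W) satisfies f_t <= g^{qbar p} f_{p qbar} + C f, where C
   depends on lambda and on the background because g >= lambda g_0. As f = 2n at
   t = 0, the maximum principle bounds f by 2n exp((C+1) tau). Finally f
   dominates both tr(g_0^-1 G) and tr(g_0^-1 gamma P gamma'), hence G and, once
   more by g >= lambda g_0, the norm of gamma; that of del mu is bounded by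
   compactness. *)

(** * Smooth functions and first-order operators *)

(** The obstacle is the sign of Q: it enters the evolution of tr(g_0^-1 G) as a positive quadratic
    term in T, which an upper bound cannot discard. As T is a delbar-derivative of gamma up to
    background terms, the evolution of the norm of gamma supplies a negative term of the same kind;
    W is the arrangement in which the two combine into a single square, together with tr(g^-1 g_0),
    the third summand of f. The twist is due to T_0: the form -i T_0 need not be delbar of a global
    (2,0)-form, so it cannot be absorbed in gamma. It is instead added to the derivatives of W, and
    its dual to those of K, so that the pairing tr(K W) does not notice it. What is left over
    involves only K, T_0 and their derivatives; it meets the solution only through g^-1, bounded by
    means of lambda, and linearly through W, bounded by f. The resulting coefficient C depends on
    the chart while f does not; the maximum principle needs C at one point only, in a chart chosen
    there. The 1 added to C makes the inequality at a positive maximum contradictory. *)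

Section RealCk.
Context {R : realType} {V : normedModType R}.
Implicit Types (f g : V -> R) (U : set V) (k : nat).

Lemma Ck_continuous k U f x : Ck k U f -> U x -> {for x, continuous f}.
Proof. by case: k => [|k] [fc _] /fc. Qed.

Lemma Ck_derivable k U f x v : Ck k.+1 U f -> U x -> derivable f x v.
Proof. by move=> [_ /(_ v)[fd _]] /fd. Qed.

Lemma Ck_derive k U f v : Ck k.+1 U f -> Ck k U ('D_v f).
Proof. by move=> [_ /(_ v)[]]. Qed.

Lemma CkW k U f : Ck k.+1 U f -> Ck k U f.
Proof.
elim: k f => [|k IH] f [fc fd]; split => // v; have [fdv Dv] := fd v.
by split => //; exact: IH.
Qed.

Lemma Ck_subset k U U' f : U' `<=` U -> Ck k U f -> Ck k U' f.
Proof.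
move=> sUU'; elim: k f => [|k IH] f [fc fd]; split => //.
- by move=> x /sUU' /fc.
- by move=> x /sUU' /fc.
- by move=> v; have [fdv Dv] := fd v; split; [move=> x /sUU' /fdv|exact: IH].
Qed.

Lemma open_eq_near U f g x : open U -> U x -> {in U, f =1 g} ->
  \near x, f x = g x.
Proof.
move=> oU Ux fg; near=> y; apply: fg; rewrite inE.
by near: y; exact: open_nbhs_nbhs.
Unshelve. all: by end_near. Qed.

Lemma eq_derive U f g x v : open U -> U x -> {in U, f =1 g} ->
  'D_v f x = 'D_v g x.
Proof. by move=> oU Ux fg; apply: near_eq_derive; exact: open_eq_near fg. Qed.

Lemma near_eq_continuous f g x : (\near x, f x = g x) ->
  {for x, continuous f} -> {for x, continuous g}.
Proof.
move=> nfg; rewrite /prop_for /continuous_at => fx.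
rewrite -(nbhs_singleton nfg); apply: cvg_trans fx; exact: near_eq_cvg.
Qed.

Lemma eq_Ck k U f g : open U -> {in U, f =1 g} -> Ck k U f -> Ck k U g.
Proof.
move=> oU; elim: k f g => [|k IH] f g fg [fc fd]; split => //.
- by move=> x Ux; apply: near_eq_continuous (fc _ Ux); exact: open_eq_near fg.
- by move=> x Ux; apply: near_eq_continuous (fc _ Ux); exact: open_eq_near fg.
move=> v; have [fdv Dv] := fd v; split.
  move=> x Ux; apply: near_eq_derivable (fdv _ Ux).
  exact: open_eq_near fg.
apply: IH Dv => x; rewrite inE => Ux; exact: eq_derive fg.
Qed.

Lemma Ck_cst k U (c : R) : Ck k U (cst c).
Proof.
elim: k c => [|k IH] c; (split; first by move=> x _; exact: cst_continuous) => //.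
move=> v; split=> [x _|]; first exact: derivable_cst.
rewrite (_ : 'D_v _ = cst 0) //.
by apply/funext => x; rewrite derive_cst.
Qed.

(** Openness serves to replace a derivative by a formula known only on [U], so it is asked for
    positive [k] only. *)
Lemma Ck_add k U f g : ((0 < k)%N -> open U) -> Ck k U f -> Ck k U g -> Ck k U (f \+ g).
Proof.
elim: k f g => [|k IH] f g oU fk gk; split => //.
- by move=> x Ux; apply: continuousD; [exact: Ck_continuous fk Ux|exact: Ck_continuous gk Ux].
- by move=> x Ux; apply: continuousD; [exact: Ck_continuous fk Ux|exact: Ck_continuous gk Ux].
move=> v; split=> [x Ux|].
  by apply: derivableD; [exact: Ck_derivable fk Ux|exact: Ck_derivable gk Ux].
apply: (@eq_Ck _ _ ('D_v f \+ 'D_v g)); [exact: oU| |].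
  move=> x; rewrite inE => Ux; rewrite /= -deriveD //.
    exact: Ck_derivable fk Ux.
  exact: Ck_derivable gk Ux.
by apply: IH; [move=> _; exact: oU|exact: Ck_derive|exact: Ck_derive].
Qed.

Lemma Ck0_mul U f g : Ck 0 U f -> Ck 0 U g -> Ck 0 U (f \* g).
Proof.
by move=> [fk _] [gk _]; split => // x Ux; apply: continuousM; [exact: fk|exact: gk].
Qed.

Lemma Ck_mul k U f g : ((0 < k)%N -> open U) -> Ck k U f -> Ck k U g -> Ck k U (f \* g).
Proof.
elim: k f g => [|k IH] f g oU fk gk; first exact: Ck0_mul.
split.
  by move=> x Ux; apply: continuousM; [exact: Ck_continuous fk Ux|exact: Ck_continuous gk Ux].
move=> v; split=> [x Ux|].
  by apply: derivableM; [exact: Ck_derivable fk Ux|exact: Ck_derivable gk Ux].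
apply: (@eq_Ck _ _ ((f \* 'D_v g) \+ (g \* 'D_v f))); [exact: oU| |].
  move=> x; rewrite inE => Ux.
  by rewrite /= deriveM //; [exact: Ck_derivable fk Ux|exact: Ck_derivable gk Ux].
have oU' : (0 < k)%N -> open U by move=> _; exact: oU.
by apply: Ck_add => //; apply: IH => //; (exact: CkW || exact: Ck_derive).
Qed.

Lemma Ck_opp k U f : ((0 < k)%N -> open U) -> Ck k U f -> Ck k U (\- f).
Proof.
move=> oU fk; rewrite (_ : \- f = cst (-1) \* f); last first.
  by apply/funext => x /=; rewrite mulN1r.
by apply: Ck_mul => //; exact: Ck_cst.
Qed.

Lemma Ck0_inv U f : (forall x, U x -> f x != 0) -> Ck 0 U f ->
  Ck 0 U (fun x => (f x)^-1).
Proof.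
by move=> f0 [fk _]; split => // x Ux; apply: continuousV; [exact: f0|exact: fk].
Qed.

Lemma Ck_inv k U f : ((0 < k)%N -> open U) -> (forall x, U x -> f x != 0) -> Ck k U f ->
  Ck k U (fun x => (f x)^-1).
Proof.
move=> + f0; elim: k => [|k IH] oU fk; first exact: Ck0_inv.
have fVk := IH (fun=> oU isT) (CkW fk).
split; first by move=> x Ux; exact: Ck_continuous fVk Ux.
move=> v; split=> [x Ux|].
  by apply: derivableV; [exact: f0|exact: Ck_derivable fk Ux].
apply: (@eq_Ck _ _ (\- (((fun x => (f x)^-1) \* (fun x => (f x)^-1)) \* 'D_v f))); [exact: oU| |].
  move=> x; rewrite inE => Ux; rewrite deriveV //; last 2 first.
  - exact: f0.
  - exact: Ck_derivable fk Ux.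
  by rewrite /= scaleNr expr2 invfM.
have oU' : (0 < k)%N -> open U by move=> _; exact: oU.
by apply: Ck_opp => //; apply: Ck_mul => //; [exact: Ck_mul|exact: Ck_derive].
Qed.

Lemma derive_line (W : normedModType R) (F : V -> W) x v :
  'D_1 (fun h : R => F (h *: v + x)) 0 = 'D_v F x.
Proof.
rewrite /derive; set g1 := fun h => _ *: _; set g2 := fun h => _ *: _.
suff -> : g1 = g2 by [].
by rewrite funeqE /g1 /g2 => h /=; rewrite addr0 scale0r add0r [_%:A]mulr1.
Qed.

(** A directional derivative at [x] is a derivative at 0 along the line through [x], where the chain
    rule in one real variable applies. *)
Lemma is_derive_ln_comp f x v : 0 < f x -> derivable f x v ->
  is_derive x v (fun y => ln (f y)) ((f x)^-1 * 'D_v f x).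
Proof.
move=> fx0 fd.
pose phi (h : R) := f (h *: v + x).
have phi0 : phi 0 = f x by rewrite /phi scale0r add0r.
have dphi : derivable phi 0 1.
  exact: (derivable1P _ _ _).1 fd.
have Dphi : 'D_1 phi 0 = 'D_v f x.
  exact: derive_line.
have dln : is_derive (phi 0) 1 (@ln R) (phi 0)^-1.
  by apply: is_derive1_ln; rewrite phi0.
have dphi' : is_derive (0 : R) (1 : R) phi ('D_v f x) by rewrite -Dphi; split.
have [H1 H2] := is_derive1_comp dln dphi'.
split; first exact: (derivable1P _ _ _).2 H1.
by rewrite -phi0 -H2 -derive_line.
Qed.

Lemma Ck_ln k U f : ((0 < k)%N -> open U) -> (forall x, U x -> 0 < f x) -> Ck k U f ->
  Ck k U (fun x => ln (f x)).
Proof.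
move=> + f0; case: k => [_ [fk _]|k oU fk].
  split => // x Ux; apply: (@continuous_comp _ _ _ f (@ln R)); first exact: fk.
  by apply: continuous_ln; exact: f0.
split.
  move=> x Ux; apply: (@continuous_comp _ _ _ f (@ln R)); first exact: Ck_continuous fk Ux.
  by apply: continuous_ln; exact: f0.
move=> v; split=> [x Ux|].
  by have [] := is_derive_ln_comp (f0 _ Ux) (Ck_derivable (v:=v) fk Ux).
apply: (@eq_Ck _ _ ((fun x => (f x)^-1) \* 'D_v f)); [exact: oU| |].
  move=> x; rewrite inE => Ux.
  by have [_ ->] := is_derive_ln_comp (f0 _ Ux) (Ck_derivable (v:=v) fk Ux).
have oU' : (0 < k)%N -> open U by move=> _; exact: oU.
apply: Ck_mul => //; last exact: Ck_derive.
by apply: Ck_inv => //; [move=> x Ux; rewrite gt_eqF// f0|exact: CkW].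
Qed.

End RealCk.

Lemma cvg_sum_ord {R : realType} (T : Type) (F : set_system T) {FF : Filter F}
  m (f : 'I_m -> T -> R) (a : 'I_m -> R) :
  (forall k, f k x @[x --> F] --> a k) ->
  (\sum_k f k x) @[x --> F] --> \sum_k a k.
Proof. by move=> fa; apply: cvg_big => //; exact: add_continuous. Qed.

(** * Strict differentiability, the chain rule and second differences *)

Section LineDerivatives.
Context {R : realType} {V : normedModType R}.
Implicit Types (f g : V -> R) (U : set V).

Lemma is_derive_line f x v (s : R) : derivable f (x + s *: v) v ->
  is_derive s (1 : R) (fun h : R => f (x + h *: v)) ('D_v f (x + s *: v)).
Proof.
move=> fd.
have [H1 H2] : is_derive (0 : R) (1 : R)
    (fun h : R => f (h *: v + (x + s *: v))) ('D_v f (x + s *: v)).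
  by split; [exact: (derivable1P _ _ _).1|exact: derive_line].
have E : (fun h : R => f (x + h *: v)) =
    (fun h : R => f (h *: v + (x + s *: v))) \o (fun h : R => h - s).
  by apply/funext => h /=; rewrite scalerBl addrCA subrK.
rewrite E -[X in is_derive _ _ _ X]mulr1; apply: is_derive1_comp.
  by rewrite subrr; split.
by apply: is_derive_eq; rewrite subr0.
Qed.

Lemma MVT_line f x v (h : R) :
  (forall s : R, `|s| <= `|h| -> derivable f (x + s *: v) v) ->
  exists2 c, `|c| <= `|h| & f (x + h *: v) - f x = h * 'D_v f (x + c *: v).
Proof.
move=> fd.
(* Parametrising the segment by [[0, 1]] treats both signs of [h] at once. *)
have D (s : R) : 0 <= s <= 1 -> is_derive s (1 : R) (fun s => f (x + (s * h) *: v))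
    ('D_v f (x + (s * h) *: v) * h).
  move=> /andP[s0 s1].
  apply: (@is_derive1_comp _ (fun r => f (x + r *: v)) (fun r => r * h)).
    apply: is_derive_line; apply: fd.
    by rewrite normrM ger0_norm // ler_piMl.
  rewrite (_ : (fun r => r * h) = h \*: (@idfun R : R -> R)); last first.
    by apply/funext => r /=; rewrite mulrC.
  by apply: is_derive_eq; exact: mulr1.
have [c c01] : exists2 c, c \in `]0, 1[%R &
    f (x + (1 * h) *: v) - f (x + (0 * h) *: v) =
    'D_v f (x + (c * h) *: v) * h * (1 - 0).
  apply: (@MVT _ (fun s => f (x + (s * h) *: v))
     (fun s => 'D_v f (x + (s * h) *: v) * h)) => //.
    move=> s; rewrite in_itv /= => /andP[s0 s1]; apply: D.
    by rewrite !ltW.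
  apply: derivable_within_continuous => s; rewrite in_itv /= => sI.
  by have [] := D _ sI.
rewrite mul1r mul0r scale0r addr0 subr0 mulr1 => E.
exists (c * h); last by rewrite E mulrC.
move: c01; rewrite in_itv /= => /andP[c0 c1].
by rewrite normrM (ger0_norm (ltW c0)) ler_piMl // ltW.
Qed.

Lemma open_ball_near U (P : V -> Prop) x : open U -> U x ->
  (\forall y \near x, P y) ->
  exists2 d : R, 0 < d & forall y, `|y - x| < d -> U y /\ P y.
Proof.
move=> oU Ux nP.
have : \forall y \near x, U y /\ P y.
  near=> y; split; last by near: y.
  by near: y; exact: open_nbhs_nbhs.
move=> /nbhs_ballP[d /= d0 dP]; exists d => // y yd.
by apply: dP; rewrite -ball_normE /= distrC.
Unshelve. all: by end_near. Qed.

(** Mean value theorem and continuity of the derivative. The estimate is uniform in the base point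
    [y]; this strict form is what survives when increments in several directions are made in
    succession. *)
Lemma C1_strict U f x v : open U -> Ck 1 U f -> U x ->
  forall e : R, 0 < e -> exists2 d : R, 0 < d & forall y (h : R), `|y - x| < d -> `|h| < d ->
    `|f (y + h *: v) - f y - h * 'D_v f x| <= e * `|h|.
Proof.
move=> oU fC Ux e e0.
have Dc : {for x, continuous ('D_v f)}.
  exact: Ck_continuous (Ck_derive _ fC) Ux.
have /(open_ball_near oU Ux)[d d0 dP] :
    \forall y \near x, `|'D_v f x - 'D_v f y| <= e.
  exact: (cvgrPdist_le _ _).1 Dc _ e0.
pose m := `|v| + 1.
have m0 : 0 < m by rewrite ltr_wpDl.
exists (Num.min (d / 2) (d / 2 / m)).
  by rewrite lt_min !divr_gt0.
move=> y h; rewrite !lt_min => /andP[yd _] /andP[_ hd].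
have near_seg (s : R) : `|s| <= `|h| -> `|y + s *: v - x| < d.
  move=> sh; rewrite addrAC (le_lt_trans (ler_normD _ _)) // (splitr d).
  apply: ltrD => //; rewrite normrZ.
  have : `|s| * `|v| <= `|h| * m.
    by apply: ler_pM => //; rewrite lerDl.
  by move=> /le_lt_trans; apply; rewrite -ltr_pdivlMr.
have [|c ch ->] := @MVT_line f y v h.
  by move=> s /near_seg/dP[Us _]; exact: Ck_derivable fC Us.
rewrite -mulrBr normrM mulrC ler_wpM2r //.
by rewrite distrC; have [] := dP _ (near_seg _ ch).
Qed.

(** Induction on the number of directions: the last increment starts from the displaced point
    [y + S], which is allowed because [C1_strict] does not fix its base point. *)
Lemma C1_strict_sum m (e : 'I_m -> V) U f x : open U -> Ck 1 U f -> U x ->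
  forall eps : R, 0 < eps -> exists2 d : R, 0 < d & forall y (h : 'I_m -> R),
    `|y - x| < d -> (forall k, `|h k| < d) ->
    `|f (y + \sum_k h k *: e k) - f y - \sum_k h k * 'D_(e k) f x|
      <= eps * \sum_k `|h k|.
Proof.
move=> oU fC Ux; elim: m e => [|m IH] e eps eps0.
  exists 1 => // y h _ _; rewrite !big_ord0 addr0 !subrr normr0.
  by rewrite mulr0.
have [d d0 dP] := IH (fun k => e (widen_ord (leqnSn m) k)) _ eps0.
have [d' d'0 d'P] := C1_strict (e ord_max) oU fC Ux eps0.
pose N := \sum_(k < m) `|e (widen_ord (leqnSn m) k)| + 1.
have N0 : 0 < N by rewrite ltr_wpDl // sumr_ge0.
exists (Num.min d (Num.min (d' / 2) (d' / 2 / N))).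
  by rewrite !lt_min d0 !divr_gt0.
move=> y h; rewrite !lt_min => /and3P[yd yd' yd''] hk.
have hd k : `|h k| < d by have := hk k; rewrite !lt_min => /and3P[].
have hd' k : `|h k| < d'.
  have := hk k; rewrite !lt_min => /and3P[_ /lt_le_trans + _]; apply.
  by rewrite ler_pdivrMr // mulr_natr mulr2n lerDl ltW.
rewrite !big_ord_recr /= addrA.
set S := \sum_(i < m) _; set T := \sum_(i < m) _ * _.
have SN : `|y + S - x| < d'.
  rewrite addrAC (le_lt_trans (ler_normD _ _)) // (splitr d').
  apply: ltr_leD => //; rewrite (le_trans (ler_norm_sum _ _ _)) //.
  have : \sum_(i < m) `|h (widen_ord (leqnSn m) i)
      *: e (widen_ord (leqnSn m) i)| <=
      (d' / 2 / N) * \sum_(i < m) `|e (widen_ord (leqnSn m) i)|.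
    rewrite mulr_sumr ler_sum // => i _; rewrite normrZ ler_wpM2r //.
    by have := hk (widen_ord (leqnSn m) i); rewrite !lt_min => /and3P[_ _ /ltW].
  move=> /le_trans; apply; rewrite -mulrA -ler_pdivlMl ?divr_gt0 //.
  rewrite mulVf ?gt_eqF ?divr_gt0 // ler_pdivrMl // mulr1 /N lerDl //.
have H1 := dP y _ yd (fun k => hd (widen_ord (leqnSn m) k)).
have H2 := d'P (y + S) (h ord_max) SN (hd' _).
rewrite mulrDr; apply: le_trans (lerD H1 H2); apply: le_trans (ler_normD _ _).
by rewrite le_eqVlt; apply/orP; left; apply/eqP; congr `|_|; rewrite -/S -/T; ring.
Qed.

(** Strict differentiability absorbs the increments [h k s], so these need only be differentiable at
    0. Linearity of ['D_v] in [v] and the chain rule for coordinate changes are both instances. *)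
Lemma C1_chain m (e : 'I_m -> V) U f x (h : 'I_m -> R -> R) :
  open U -> Ck 1 U f -> U x ->
  (forall k, h k 0 = 0) -> (forall k, derivable (h k) 0 (1 : R)) ->
  is_derive (0 : R) (1 : R) (fun s => f (x + \sum_k h k s *: e k))
    (\sum_k 'D_1 (h k) 0 * 'D_(e k) f x).
Proof.
move=> oU fC Ux h0 hd.
set L := \sum_k _.
suff H : (fun s : R => s^-1 *: (((fun s => f (x + \sum_k h k s *: e k)) \o shift 0)
    (s *: 1) - f (x + \sum_k h k 0 *: e k))) @ 0^' --> L.
  split; first by apply/cvg_ex; exists L.
  exact/cvg_lim.
have E s : (fun s => f (x + \sum_k h k s *: e k) ) (s *: 1 + 0) =
   f (x + \sum_k h k s *: e k) by rewrite addr0 [_%:A]mulr1.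
have dq k : (s^-1 * h k s) @[s --> 0^'] --> 'D_1 (h k) 0.
  have := hd k; rewrite /derivable => /cvg_lim H.
  have : cvg ((s^-1 * h k s) @[s --> 0^']).
    have := hd k; rewrite /derivable.
    set g1 := fun h => _ *: _; set g2 := fun h => _ * _.
    suff -> : g1 = g2 by [].
    by apply/funext => s; rewrite /g1 /g2 /= h0 subr0 addr0 [_%:A]mulr1.
  move=> C; rewrite (_ : 'D_1 (h k) 0 = lim ((s^-1 * h k s) @[s --> 0^'])) //.
  rewrite /derive; set g1 := fun h => _ *: _; set g2 := fun h => _ * _.
  suff -> : g1 = g2 by [].
  by apply/funext => s; rewrite /g1 /g2 /= h0 subr0 addr0 [_%:A]mulr1.
have Lcvg : (\sum_k (s^-1 * h k s) * 'D_(e k) f x) @[s --> 0^'] --> L.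
  apply: cvg_sum_ord => k; apply: cvgM; [exact: dq|exact: cvg_cst].
have Scvg : (\sum_k `|s^-1 * h k s|) @[s --> 0^'] --> \sum_k `|'D_1 (h k) 0|.
  by apply: cvg_sum_ord => k; apply: cvg_norm; exact: dq.
pose B := \sum_k `|'D_1 (h k) 0|.
have B0 : 0 <= B by rewrite sumr_ge0.
apply/cvgrPdist_le => eps eps0.
(* The sum of the [|h k s / s|] tends to [B], hence is eventually at most [B + 1]; with this
   precision the error costs at most [eps / 2]. *)
have eps' : 0 < eps / 2 / (B + 1) by rewrite !divr_gt0 // ltr_wpDl.
have [d d0 dP] := C1_strict_sum e oU fC Ux eps'.
have /(cvgrPdist_le _ _).1 /(_ (eps / 2)) Lnear := Lcvg.
have /(cvgrPdist_le _ _).1 /(_ 1 ltr01) Snear := Scvg.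
have hnear k : \forall s \near (0 : R)^', `|h k s| < d.
  have hc : {for 0, continuous (h k)}.
    exact/differentiable_continuous/derivable1_diffP.
  have H : \forall s \near (0 : R), `|h k 0 - h k s| < d.
    exact: (cvgrPdist_lt _ _).1 hc _ d0.
  apply: nbhs_dnbhs; near=> s.
  have : `|h k 0 - h k s| < d by near: s.
  by rewrite h0 sub0r normrN.
near=> s.
have s0 : s != 0 by near: s; exact: nbhs_dnbhs_neq.
have hs k : `|h k s| < d by move: k; near: s; apply: filter_forall.
have xx : `|x - x| < d by rewrite subrr normr0.
have H1 := dP x (h ^~ s) xx hs.
have H2 : `|L - \sum_k (s^-1 * h k s) * 'D_(e k) f x| <= eps / 2.
  by near: s; apply: Lnear; rewrite divr_gt0.
have H3 : `|B - \sum_k `|s^-1 * h k s| | <= 1 by near: s; exact: Snear.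
rewrite /= E (_ : \sum_k h k 0 *: e k = 0) ?addr0; last first.
  by rewrite big1 // => k _; rewrite h0 scale0r.
set X := f (x + _) - f x.
rewrite (_ : L - s^-1 *: X = (L - \sum_k (s^-1 * h k s) * 'D_(e k) f x) -
  s^-1 * (X - \sum_k h k s * 'D_(e k) f x)); last first.
  rewrite mulrBr mulr_sumr.
  under [in X in _ - (_ - X)]eq_bigr do rewrite mulrA.
  by rewrite opprB addrA subrK.
rewrite (splitr eps) (le_trans (ler_normB _ _)) // lerD // normrM.
have : `|s^-1| * `|X - \sum_k h k s * 'D_(e k) f x| <=
    eps / 2 / (B + 1) * \sum_k `|s^-1 * h k s|.
  have -> : \sum_k `|s^-1 * h k s| = `|s^-1| * \sum_k `|h k s|.
    by rewrite mulr_sumr; apply: eq_bigr => k _; rewrite normrM.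
  by rewrite mulrCA ler_wpM2l.
move=> /le_trans; apply; rewrite -mulrA ler_piMr ?divr_ge0 ?(ltW eps0) //.
rewrite ler_pdivrMl ?ltr_wpDl // mulr1 -lerBlDl.
by apply: le_trans H3; rewrite distrC ler_norm.
Unshelve. all: by end_near. Qed.

Lemma derive_sum_dir m (e : 'I_m -> V) (a : 'I_m -> R) U f x :
  open U -> Ck 1 U f -> U x ->
  'D_(\sum_k a k *: e k) f x = \sum_k a k * 'D_(e k) f x.
Proof.
move=> oU fC Ux.
have ha k : is_derive (0 : R) (1 : R) (fun s : R => s * a k) (a k).
  rewrite (_ : (fun s => _) = a k \*: (@idfun R : R -> R)); last first.
    by apply/funext => r /=; rewrite mulrC.
  by apply: is_derive_eq; exact: mulr1.
have [_ H] := @C1_chain m e U f x (fun k s => s * a k) oU fC Ux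
  (fun k => mul0r _) (fun k => @ex_derive _ _ _ _ _ _ _ (ha k)).
rewrite -derive_line.
under [in RHS]eq_bigr => k _ do rewrite -(@derive_val _ _ _ _ _ _ _ (ha k)).
rewrite -H (_ : (fun h : R => f (h *: _ + x)) =
  (fun s => f (x + \sum_k (s * a k) *: e k))) //.
apply/funext => s; rewrite addrC scaler_sumr; congr (f (_ + _)).
by apply: eq_bigr => k _; rewrite scalerA.
Qed.

(** The mean value theorem in direction [u], applied to the increment of [f] in direction [v],
    leaves an increment of ['D_u f], to which strict differentiability applies. *)
Lemma C2_difference U f x u v : open U -> Ck 2 U f -> U x ->
  forall e : R, 0 < e -> exists2 d : R, 0 < d & forall h : R, `|h| < d ->
    `|f (x + h *: u + h *: v) - f (x + h *: u) - f (x + h *: v) + f x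
      - h ^+ 2 * 'D_v ('D_u f) x| <= e * h ^+ 2.
Proof.
move=> oU fC Ux.
move=> e e0.
have fC1 : Ck 1 U f by exact: CkW.
have [d d0 dP] := C1_strict v oU (Ck_derive u fC) Ux e0.
have [r r0 rP] := open_ball_near oU Ux (nearW _ (fun=> I)).
pose m := `|u| + `|v| + 1.
have m0 : 0 < m by rewrite ltr_wpDl // addr_ge0.
exists (Num.min d (Num.min d r / m)).
  by rewrite lt_min d0 divr_gt0 // lt_min d0.
move=> h; rewrite lt_min => /andP[hd hm].
have nearP (a b : R) : `|a| <= `|h| -> `|b| <= `|h| ->
    `|x + a *: u + b *: v - x| < Num.min d r.
  move=> ah bh; rewrite -[x + _ + _]addrA [x + _]addrC addrK.
  apply: le_lt_trans (_ : `|h| * m < _); last by rewrite -ltr_pdivlMr.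
  rewrite (le_trans (ler_normD _ _)) // !normrZ /m !mulrDr mulr1 -addrA.
  by apply: lerD; [exact: ler_wpM2r|rewrite -[leLHS]addr0 lerD // ler_wpM2r].
have inU (a b : R) : `|a| <= `|h| -> `|b| <= `|h| -> U (x + a *: u + b *: v).
  by move=> ah bh; have := nearP _ _ ah bh; rewrite lt_min => /andP[_ /rP[]].
pose F y := f (y + h *: v) - f y.
have dF (s : R) : `|s| <= `|h| -> is_derive (x + s *: u) u F
    ('D_u f (x + s *: u + h *: v) - 'D_u f (x + s *: u)).
  move=> sh; apply: is_deriveB; last first.
    apply: derivableP; apply: (Ck_derivable fC1).
    by have := inU s 0 sh; rewrite normr0 scale0r addr0 => /(_ (normr_ge0 _)).
  have H : derivable f (x + s *: u + h *: v) u.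
    by apply: (Ck_derivable fC1); exact: inU.
  have Es : (fun k : R => f (k *: u + (x + s *: u) + h *: v)) =
      (fun k : R => f (k *: u + (x + s *: u + h *: v))).
    by apply/funext => k; rewrite -[in LHS]addrA.
  split.
    apply/(derivable1P (fun y => f (y + h *: v))).
    by rewrite /= Es; exact: (derivable1P _ _ _).1.
  by rewrite -derive_line /= Es derive_line.
have [s sh|c ch] := @MVT_line F x u h; first by have [] := dF s sh.
have [_ ->] := dF c ch; rewrite /F => E.
have -> : f (x + h *: u + h *: v) - f (x + h *: u) - f (x + h *: v) + f x =
    h * ('D_u f (x + c *: u + h *: v) - 'D_u f (x + c *: u)).
  by rewrite -E; ring.
have cd : `|x + c *: u - x| < d.
  have := nearP c 0 ch; rewrite normr0 scale0r addr0 lt_min normr_ge0.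
  by move=> /(_ isT) /andP[].
have := dP _ h cd hd; set Z := _ - _ - _ => ZP.
rewrite [in X in `|X|]expr2 -mulrA -mulrBr -/Z normrM.
rewrite -[h ^+ 2]real_normK ?num_real // expr2 mulrCA.
exact: ler_wpM2l.
Qed.

(** The second difference in [C2_difference] is symmetric in [u] and [v], and divided by [h ^+ 2] it
    tends to either mixed derivative. *)
Lemma derive_sym U f x u v : open U -> Ck 2 U f -> U x ->
  'D_u ('D_v f) x = 'D_v ('D_u f) x.
Proof.
move=> oU fC Ux.
apply/eqP; rewrite eq_sym -subr_eq0 -normr_le0; apply/ler_addgt0Pr => e e0; rewrite add0r.
have e2 : 0 < e / 2 by rewrite divr_gt0.
have [d d0 dP] := C2_difference u v oU fC Ux e2.
have [d' d'0 d'P] := C2_difference v u oU fC Ux e2.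
pose h := Num.min d d' / 2.
have m0 : 0 < Num.min d d' by rewrite lt_min d0.
have h0 : 0 < h by rewrite divr_gt0.
have hm : `|h| < Num.min d d'.
  by rewrite gtr0_norm // ltr_pdivrMr // mulr_natr mulr2n ltrDl.
move: hm; rewrite lt_min => /andP[/dP H /d'P H'].
have h20 : 0 < h ^+ 2 by rewrite exprn_gt0.
rewrite -(ler_pM2l h20).
set A := 'D_u _ x; set B := 'D_v _ x.
set X := (X in `|X| <= _) in H; set X' := (X in `|X| <= _) in H'.
have -> : h ^+ 2 * `|B - A| = `|X' - X|.
  rewrite -{1}(gtr0_norm h20) -normrM; congr `|_|.
  by rewrite /X /X' [x + h *: v + h *: u]addrAC -/A -/B; ring.
apply: le_trans (ler_normB _ _) _; apply: le_trans (lerD H' H) _.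
by rewrite -mulrDl -splitr mulrC.
Qed.

(** For the directions [v] and [- v] the second difference is 2 f(x) - f(x + hv) - f(x - hv),
    nonnegative at a maximum, while its leading coefficient is minus the second derivative. *)
Lemma second_derivative_max U f x v : open U -> Ck 2 U f -> U x ->
  (forall y, U y -> f y <= f x) -> 'D_v ('D_v f) x <= 0.
Proof.
move=> oU fC Ux fmax.
have DN : 'D_(- v) ('D_v f) x = - 'D_v ('D_v f) x.
  have := derive_sum_dir (fun _ : 'I_1 => v) (fun=> -1) oU (Ck_derive v fC) Ux.
  by rewrite !big_ord1 scaleN1r mulN1r.
apply/ler_addgt0Pr => e e0; rewrite add0r.
have [d d0 dP] := C2_difference v (- v) oU fC Ux e0.
have [r r0 rP] := open_ball_near oU Ux (nearW _ (fun=> I)).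
pose m := `|v| + 1.
have m0 : 0 < m by rewrite ltr_wpDl.
pose h := Num.min d (r / m) / 2.
have dr0 : 0 < Num.min d (r / m) by rewrite lt_min d0 divr_gt0.
have h0 : 0 < h by rewrite divr_gt0.
have : `|h| < Num.min d (r / m).
  by rewrite gtr0_norm // ltr_pdivrMr // mulr_natr mulr2n ltrDl.
rewrite lt_min => /andP[/dP + hr].
have hv : `|h *: v| < r.
  rewrite normrZ (le_lt_trans (_ : _ <= `|h| * m)) //.
    by rewrite ler_wpM2l // lerDl.
  by rewrite -ltr_pdivlMr.
have Up : U (x + h *: v) by have [] := rP (x + h *: v); rewrite // addrAC subrr add0r.
have Um : U (x + h *: - v).
  by have [] := rP (x + h *: - v); rewrite // addrAC subrr add0r scalerN normrN.
have := fmax _ Up; have := fmax _ Um.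
rewrite DN scalerN addrK => fm fp /ler_normlP[_ H].
have h20 : 0 < h ^+ 2 by rewrite exprn_gt0.
rewrite -(ler_pM2l h20); move: H fm fp; rewrite mulrN opprK [e * _]mulrC.
move: (f (x + _)) (f (x - _)) (f x) ('D_v ('D_v f) x) => A B C D H; lra.
Qed.

End LineDerivatives.

(** * Complex-valued smooth functions and constant-coefficient operators *)

Section ComplexSmooth.
Context {R : realType} {V : normedModType R}.
Local Notation C := R[i].
Implicit Types (f g : V -> C) (U : set V) (k : nat).

Definition Cks k U f :=
  Ck k U (fun x => complex.Re (f x)) /\ Ck k U (fun x => complex.Im (f x)).

Lemma ReM (x y : C) :
  complex.Re (x * y) = complex.Re x * complex.Re y - complex.Im x * complex.Im y.
Proof. by case: x => a b; case: y. Qed.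

Lemma ImM (x y : C) :
  complex.Im (x * y) = complex.Re x * complex.Im y + complex.Im x * complex.Re y.
Proof. by case: x => a b; case: y. Qed.

Lemma ReD (x y : C) : complex.Re (x + y) = complex.Re x + complex.Re y.
Proof. by case: x => a b; case: y. Qed.

Lemma ImD (x y : C) : complex.Im (x + y) = complex.Im x + complex.Im y.
Proof. by case: x => a b; case: y. Qed.

Lemma Re_conj (x : C) : complex.Re x^* = complex.Re x.
Proof. by case: x. Qed.

Lemma Im_conj (x : C) : complex.Im x^* = - complex.Im x.
Proof. by case: x. Qed.

Lemma ReIm_eq (x y : C) :
  complex.Re x = complex.Re y -> complex.Im x = complex.Im y -> x = y.
Proof. by case: x => a b; case: y => c d /= -> ->. Qed.

Lemma derive_ext (F G : V -> R) v x : F =1 G -> 'D_v F x = 'D_v G x.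
Proof. by move=> /funext ->. Qed.

Lemma derive_fun_add (a b : V -> R) v x : derivable a x v -> derivable b x v ->
  'D_v (fun y => a y + b y) x = 'D_v a x + 'D_v b x.
Proof. exact: deriveD. Qed.

Lemma derive_fun_opp (a : V -> R) v x : derivable a x v ->
  'D_v (fun y => - a y) x = - 'D_v a x.
Proof. exact: deriveN. Qed.

Lemma derive_fun_mul (a b : V -> R) v x : derivable a x v -> derivable b x v ->
  'D_v (fun y => a y * b y) x = 'D_v a x * b x + a x * 'D_v b x.
Proof.
by move=> da db; rewrite (deriveM da db) addrC [X in X + _]mulrC.
Qed.

Lemma derivable_fun_mul (a b : V -> R) v x : derivable a x v -> derivable b x v ->
  derivable (fun y => a y * b y) x v.
Proof. exact: derivableM. Qed.

Lemma derivable_fun_opp (a : V -> R) v x : derivable a x v ->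
  derivable (fun y => - a y) x v.
Proof. exact: derivableN. Qed.

Section closure.
Variables (k : nat) (U : set V).
Hypothesis oU : (0 < k)%N -> open U.

Lemma Cks_cst (c : C) : Cks k U (cst c).
Proof. by split; exact: Ck_cst. Qed.

Lemma Cks_add f g : Cks k U f -> Cks k U g -> Cks k U (fun x => f x + g x).
Proof.
move=> [f1 f2] [g1 g2]; split.
  rewrite (_ : (fun x => _) = (fun x => complex.Re (f x)) \+ (fun x => complex.Re (g x))).
    exact: Ck_add.
  by apply/funext => x; rewrite ReD.
rewrite (_ : (fun x => _) = (fun x => complex.Im (f x)) \+ (fun x => complex.Im (g x))).
  exact: Ck_add.
by apply/funext => x; rewrite ImD.
Qed.

Lemma Cks_mul f g : Cks k U f -> Cks k U g -> Cks k U (fun x => f x * g x).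
Proof.
move=> [f1 f2] [g1 g2]; split.
  rewrite (_ : (fun x => _) =
     ((fun x => complex.Re (f x)) \* (fun x => complex.Re (g x))) \+
     (\- ((fun x => complex.Im (f x)) \* (fun x => complex.Im (g x))))).
    by apply: Ck_add => //; [exact: Ck_mul|apply: Ck_opp => //; exact: Ck_mul].
  by apply/funext => x; rewrite ReM.
rewrite (_ : (fun x => _) =
     ((fun x => complex.Re (f x)) \* (fun x => complex.Im (g x))) \+
     ((fun x => complex.Im (f x)) \* (fun x => complex.Re (g x)))).
  by apply: Ck_add => //; exact: Ck_mul.
by apply/funext => x; rewrite ImM.
Qed.

Lemma Cks_opp f : Cks k U f -> Cks k U (fun x => - f x).
Proof.
move=> fk; rewrite (_ : (fun x => _) = (fun x => cst (-1) x * f x)).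
  by apply: Cks_mul => //; exact: Cks_cst.
by apply/funext => x; rewrite mulN1r.
Qed.

Lemma Cks_conj f : Cks k U f -> Cks k U (fun x => (f x)^*).
Proof.
move=> [f1 f2]; split.
  by rewrite (_ : (fun x => _) = (fun x => complex.Re (f x))) //; apply/funext => x; rewrite Re_conj.
rewrite (_ : (fun x => _) = \- (fun x => complex.Im (f x))); first exact: Ck_opp.
by apply/funext => x; rewrite Im_conj.
Qed.

Lemma Cks_inv f : (forall x, U x -> f x != 0) -> Cks k U f ->
  Cks k U (fun x => (f x)^-1).
Proof.
move=> f0 fk.
pose nf x := complex.Re (f x) * complex.Re (f x) + complex.Im (f x) * complex.Im (f x).
have nk : Ck k U (fun x => (nf x)^-1).
  have [f1 f2] := fk.
  apply: Ck_inv => //; last by apply: Ck_add => //; apply: Ck_mul.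
  move=> x /f0; rewrite /nf; case: (f x) => a b /=.
  apply: contraNneq => /eqP; rewrite paddr_eq0 -?expr2 ?sqr_ge0 //.
  by rewrite !sqrf_eq0 => /andP[/eqP -> /eqP ->].
rewrite (_ : (fun x => _) = (fun x => (f x)^* * (nf x)^-1%:C)); last first.
  apply/funext => x; rewrite /nf; case: (f x) => a b; apply: ReIm_eq => /=;
  by rewrite /= ?mulr0 ?subr0 ?add0r -!expr2 ?mulNr.
apply: Cks_mul; first exact: Cks_conj.
by split => //=; exact: Ck_cst.
Qed.

Lemma Cks_sum (I : Type) (r : seq I) (F : I -> V -> C) :
  (forall i, Cks k U (F i)) -> Cks k U (fun x => \sum_(i <- r) F i x).
Proof.
move=> Fk; elim: r => [|i r IH].
  by rewrite (_ : (fun x => _) = cst 0); [exact: Cks_cst|apply/funext => x; rewrite big_nil].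
rewrite (_ : (fun x => _) = (fun x => F i x + \sum_(i <- r) F i x)); first exact: Cks_add.
by apply/funext => x; rewrite big_cons.
Qed.

Lemma Cks_prod (I : Type) (r : seq I) (F : I -> V -> C) :
  (forall i, Cks k U (F i)) -> Cks k U (fun x => \prod_(i <- r) F i x).
Proof.
move=> Fk; elim: r => [|i r IH].
  by rewrite (_ : (fun x => _) = cst 1); [exact: Cks_cst|apply/funext => x; rewrite big_nil].
rewrite (_ : (fun x => _) = (fun x => F i x * \prod_(i <- r) F i x)); first exact: Cks_mul.
by apply/funext => x; rewrite big_cons.
Qed.

End closure.

Section closure_mx.
Variables (k : nat) (U : set V).
Hypothesis oU : (0 < k)%N -> open U.

Definition mxCks m n (A : V -> 'M[C]_(m, n)) :=
  forall i j, Cks k U (fun x => A x i j).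

Lemma mxCks_add m n (A B : V -> 'M[C]_(m, n)) :
  mxCks A -> mxCks B -> mxCks (fun x => A x + B x).
Proof.
move=> Ak Bk i j; under eq_fun do rewrite mxE; exact: Cks_add.
Qed.

Lemma mxCks_mul m n p (A : V -> 'M[C]_(m, n)) (B : V -> 'M[C]_(n, p)) :
  mxCks A -> mxCks B -> mxCks (fun x => A x *m B x).
Proof.
move=> Ak Bk i j; under eq_fun do rewrite mxE.
by apply: Cks_sum => // l; exact: Cks_mul.
Qed.

Lemma mxCks_map m n (A : V -> 'M[C]_(m, n)) : mxCks A ->
  mxCks (fun x => map_mx conjc (A x)).
Proof. by move=> Ak i j; under eq_fun do rewrite mxE; exact: Cks_conj. Qed.

Lemma Cks_det n (A : V -> 'M[C]_n) : mxCks A -> Cks k U (fun x => \det (A x)).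
Proof.
move=> Ak; apply: Cks_sum => // s; apply: Cks_mul => //; first exact: Cks_cst.
by apply: Cks_prod.
Qed.

Lemma Cks_trace n (A : V -> 'M[C]_n) : mxCks A -> Cks k U (fun x => \tr (A x)).
Proof. by move=> Ak; apply: Cks_sum. Qed.

(* Unlike [invmx], a rational expression in the entries on all of 'M_n. *)
Definition adjinv n (A : 'M[C]_n) : 'M[C]_n := (\det A)^-1 *: \adj A.

Lemma adjinvE n (A : 'M[C]_n) : A \in unitmx -> adjinv A = invmx A.
Proof. by rewrite /invmx => ->. Qed.

Lemma mxCks_adjinv n (A : V -> 'M[C]_n) : (forall x, U x -> \det (A x) != 0) ->
  mxCks A -> mxCks (fun x => adjinv (A x)).
Proof.
move=> Au Ak i j; under eq_fun do rewrite !mxE.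
apply: Cks_mul => //; first by apply: Cks_inv => //; exact: Cks_det.
apply: Cks_mul => //; first exact: Cks_cst.
by apply: Cks_det => k' l; under eq_fun do rewrite !mxE.
Qed.

Lemma mxCks_block m1 m2 n1 n2 (A : V -> 'M[C]_(m1, n1)) (B : V -> 'M[C]_(m1, n2))
  (D : V -> 'M[C]_(m2, n1)) (E : V -> 'M[C]_(m2, n2)) :
  mxCks A -> mxCks B -> mxCks D -> mxCks E ->
  mxCks (fun x => block_mx (A x) (B x) (D x) (E x)).
Proof.
move=> Ak Bk Dk Ek i j; case: (split_ordP i) => i' ->; case: (split_ordP j) => j' ->.
- by under eq_fun do rewrite block_mxEul.
- by under eq_fun do rewrite block_mxEur.
- by under eq_fun do rewrite block_mxEdl.
- by under eq_fun do rewrite block_mxEdr.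
Qed.

End closure_mx.

Lemma eq_Cks k U f g : open U -> {in U, f =1 g} -> Cks k U f -> Cks k U g.
Proof.
move=> oU fg [f1 f2]; split.
  by apply: eq_Ck f1 => // x Ux; rewrite fg.
by apply: eq_Ck f2 => // x Ux; rewrite fg.
Qed.

Section smooth.
Variable U : set V.
Hypothesis oU : open U.

Lemma smooth_cst (c : C) : smooth_on U (cst c).
Proof. by move=> k; exact: Cks_cst. Qed.

Lemma smooth_add f g : smooth_on U f -> smooth_on U g ->
  smooth_on U (fun x => f x + g x).
Proof. by move=> fs gs k; apply: Cks_add; [|exact: fs|exact: gs]. Qed.

Lemma smooth_mul f g : smooth_on U f -> smooth_on U g ->
  smooth_on U (fun x => f x * g x).
Proof. by move=> fs gs k; apply: Cks_mul; [|exact: fs|exact: gs]. Qed.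

Lemma smooth_opp f : smooth_on U f -> smooth_on U (fun x => - f x).
Proof. by move=> fs k; apply: Cks_opp; [|exact: fs]. Qed.

Lemma smooth_conj f : smooth_on U f -> smooth_on U (fun x => (f x)^*).
Proof. by move=> fs k; apply: Cks_conj; [|exact: fs]. Qed.

Lemma smooth_inv f : (forall x, U x -> f x != 0) -> smooth_on U f ->
  smooth_on U (fun x => (f x)^-1).
Proof. by move=> f0 fs k; apply: Cks_inv; [| |exact: fs]. Qed.

Lemma smooth_sum (I : Type) (r : seq I) (F : I -> V -> C) :
  (forall i, smooth_on U (F i)) -> smooth_on U (fun x => \sum_(i <- r) F i x).
Proof. by move=> Fs k; apply: Cks_sum => // i; exact: Fs. Qed.

Lemma smooth_eq f g : {in U, f =1 g} -> smooth_on U f -> smooth_on U g.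
Proof. by move=> fg fs k; apply: eq_Cks fg (fs k). Qed.

Lemma smooth_subset U' f : U' `<=` U -> smooth_on U f -> smooth_on U' f.
Proof. by move=> sU fs k; have [f1 f2] := fs k; split; exact: Ck_subset sU _. Qed.

Definition mx_smooth m n (A : V -> 'M[C]_(m, n)) :=
  forall i j, smooth_on U (fun x => A x i j).

Lemma mx_smoothP m n (A : V -> 'M[C]_(m, n)) :
  mx_smooth A <-> forall k, mxCks k U A.
Proof. by split=> [As k i j|Ak i j k]; [exact: As|exact: Ak]. Qed.

Lemma mx_smooth_cst m n (A : 'M[C]_(m, n)) : mx_smooth (fun=> A).
Proof. by move=> i j; exact: smooth_cst. Qed.

Lemma mx_smooth_add m n (A B : V -> 'M[C]_(m, n)) :
  mx_smooth A -> mx_smooth B -> mx_smooth (fun x => A x + B x).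
Proof.
by move=> /mx_smoothP As /mx_smoothP Bs; apply/mx_smoothP => k; exact: mxCks_add.
Qed.

Lemma mx_smooth_mul m n p (A : V -> 'M[C]_(m, n)) (B : V -> 'M[C]_(n, p)) :
  mx_smooth A -> mx_smooth B -> mx_smooth (fun x => A x *m B x).
Proof.
by move=> /mx_smoothP As /mx_smoothP Bs; apply/mx_smoothP => k; exact: mxCks_mul.
Qed.

Lemma mx_smooth_tr m n (A : V -> 'M[C]_(m, n)) :
  mx_smooth A -> mx_smooth (fun x => (A x)^T).
Proof. by move=> As i j; under eq_fun do rewrite mxE; exact: As. Qed.

Lemma mx_smooth_map m n (A : V -> 'M[C]_(m, n)) :
  mx_smooth A -> mx_smooth (fun x => map_mx conjc (A x)).
Proof. by move=> /mx_smoothP As; apply/mx_smoothP => k; exact: mxCks_map. Qed.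

Lemma mx_smooth_block m1 m2 n1 n2 (A : V -> 'M[C]_(m1, n1))
  (B : V -> 'M[C]_(m1, n2)) (D : V -> 'M[C]_(m2, n1)) (E : V -> 'M[C]_(m2, n2)) :
  mx_smooth A -> mx_smooth B -> mx_smooth D -> mx_smooth E ->
  mx_smooth (fun x => block_mx (A x) (B x) (D x) (E x)).
Proof.
move=> /mx_smoothP As /mx_smoothP Bs /mx_smoothP Ds /mx_smoothP Es.
by apply/mx_smoothP => k; exact: mxCks_block.
Qed.

Lemma smooth_det n (A : V -> 'M[C]_n) :
  mx_smooth A -> smooth_on U (fun x => \det (A x)).
Proof. by move=> /mx_smoothP As k; exact: Cks_det. Qed.

Lemma smooth_trace n (A : V -> 'M[C]_n) :
  mx_smooth A -> smooth_on U (fun x => \tr (A x)).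
Proof. by move=> /mx_smoothP As k; exact: Cks_trace. Qed.

Lemma mx_smooth_inv n (A : V -> 'M[C]_n) :
  (forall x, U x -> A x \in unitmx) ->
  mx_smooth A -> mx_smooth (fun x => invmx (A x)).
Proof.
move=> Au As i j; apply: (@smooth_eq (fun x => adjinv (A x) i j)).
  by move=> x; rewrite inE => Ux; rewrite adjinvE // Au.
move=> k; apply: mxCks_adjinv => //; last by move/mx_smoothP: As.
Qed.

Lemma smooth_ln f : (forall x, U x -> 0 < complex.Re (f x)) -> smooth_on U f ->
  smooth_on U (fun x => (ln (complex.Re (f x)))%:C).
Proof.
by move=> f0 fs k; have [f1 f2] := fs k; split => /=; [exact: Ck_ln|exact: Ck_cst].
Qed.

End smooth.

(* A complex first-order constant-coefficient operator a D_v + b D_w; both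
   Wirtinger operators and d/dt are of this form. *)
Record fop := Fop { fop_a : C; fop_v : V; fop_b : C; fop_w : V }.

Definition cD v f x : C :=
  'D_v (fun y => complex.Re (f y)) x +i* 'D_v (fun y => complex.Im (f y)) x.

Definition fapp (d : fop) f x : C :=
  fop_a d * cD (fop_v d) f x + fop_b d * cD (fop_w d) f x.

Definition fconj (d : fop) : fop :=
  Fop (fop_a d)^* (fop_v d) (fop_b d)^* (fop_w d).

Section fop_theory.
Variable U : set V.
Hypothesis oU : open U.
Implicit Types (d : fop).

Lemma cD_eq v f g x : U x -> {in U, f =1 g} -> cD v f x = cD v g x.
Proof.
move=> Ux fg; rewrite /cD; congr (_ +i* _); apply: (eq_derive v oU Ux).
  by move=> y /fg ->.
by move=> y /fg ->.
Qed.

Lemma smooth_cD v f : smooth_on U f -> smooth_on U (cD v f).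
Proof. by move=> fs k; have [f1 f2] := fs k.+1; split; exact: Ck_derive. Qed.

Lemma cD_cst v (c : C) x : cD v (cst c) x = 0.
Proof. by rewrite /cD !derive_cst. Qed.

Lemma smooth_derivable f x v : smooth_on U f -> U x ->
  derivable (fun y => complex.Re (f y)) x v /\
  derivable (fun y => complex.Im (f y)) x v.
Proof.
by move=> fs Ux; have [f1 f2] := fs 1%N; split;
  [exact: Ck_derivable f1 Ux|exact: Ck_derivable f2 Ux].
Qed.

Lemma cD_add v f g x : U x -> smooth_on U f -> smooth_on U g ->
  cD v (fun y => f y + g y) x = cD v f x + cD v g x.
Proof.
move=> Ux fs gs.
have [f1 f2] := smooth_derivable v fs Ux; have [g1 g2] := smooth_derivable v gs Ux.
apply: ReIm_eq; rewrite ?ReD ?ImD; rewrite [LHS]/= [RHS]/=.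
  rewrite -(derive_fun_add f1 g1); apply: derive_ext => y; exact: ReD.
rewrite -(derive_fun_add f2 g2); apply: derive_ext => y; exact: ImD.
Qed.

Lemma cD_mul v f g x : U x -> smooth_on U f -> smooth_on U g ->
  cD v (fun y => f y * g y) x = cD v f x * g x + f x * cD v g x.
Proof.
move=> Ux fs gs.
have [f1 f2] := smooth_derivable v fs Ux; have [g1 g2] := smooth_derivable v gs Ux.
apply: ReIm_eq.
  rewrite [LHS]/= (derive_ext (G := fun y => complex.Re (f y) * complex.Re (g y) +
     - (complex.Im (f y) * complex.Im (g y)))); last by move=> y; exact: ReM.
  rewrite derive_fun_add; last 2 first.
  - exact: derivable_fun_mul.
  - by apply: derivable_fun_opp; exact: derivable_fun_mul.
  rewrite derive_fun_opp; last exact: derivable_fun_mul.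
  rewrite !derive_fun_mul // ReD !ReM [RHS]/=.
  by rewrite opprD addrACA.
rewrite [LHS]/= (derive_ext (G := fun y => complex.Re (f y) * complex.Im (g y) +
     complex.Im (f y) * complex.Re (g y))); last by move=> y; exact: ImM.
rewrite derive_fun_add; last 2 first.
- exact: derivable_fun_mul.
- exact: derivable_fun_mul.
rewrite !derive_fun_mul // ImD !ImM [RHS]/=.
by rewrite addrACA.
Qed.

Lemma cD_conj v f x : U x -> smooth_on U f ->
  cD v (fun y => (f y)^*) x = (cD v f x)^*.
Proof.
move=> Ux fs; have [f1 f2] := smooth_derivable v fs Ux.
apply: ReIm_eq; rewrite ?Re_conj ?Im_conj; rewrite [LHS]/= [RHS]/=.
  by apply: derive_ext => y; exact: Re_conj.
rewrite -(derive_fun_opp f2); apply: derive_ext => y; exact: Im_conj.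
Qed.

Lemma cD_sym v w f x : U x -> smooth_on U f -> cD v (cD w f) x = cD w (cD v f) x.
Proof.
move=> Ux fs; have [f1 f2] := fs 2%N.
apply: ReIm_eq; first exact: (derive_sym v w oU f1 Ux).
exact: (derive_sym v w oU f2 Ux).
Qed.

Lemma fapp_ext d f g x : f =1 g -> fapp d f x = fapp d g x.
Proof. by move=> /funext ->. Qed.

Lemma fapp_eq d f g x : U x -> {in U, f =1 g} -> fapp d f x = fapp d g x.
Proof. by move=> Ux fg; rewrite /fapp !(cD_eq _ Ux fg). Qed.

Lemma smooth_fapp d f : smooth_on U f -> smooth_on U (fapp d f).
Proof.
move=> fs; apply: smooth_add => //.
  by apply: smooth_mul => //; [exact: smooth_cst|exact: smooth_cD].
by apply: smooth_mul => //; [exact: smooth_cst|exact: smooth_cD].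
Qed.

Lemma fapp_cst d (c : C) x : fapp d (cst c) x = 0.
Proof. by rewrite /fapp !cD_cst !mulr0 addr0. Qed.

Lemma fapp_add d f g x : U x -> smooth_on U f -> smooth_on U g ->
  fapp d (fun y => f y + g y) x = fapp d f x + fapp d g x.
Proof.
move=> Ux fs gs; rewrite /fapp (cD_add _ Ux fs gs) (cD_add _ Ux fs gs).
by rewrite !mulrDr addrACA.
Qed.

Lemma fapp_mul d f g x : U x -> smooth_on U f -> smooth_on U g ->
  fapp d (fun y => f y * g y) x = fapp d f x * g x + f x * fapp d g x.
Proof.
move=> Ux fs gs; rewrite /fapp (cD_mul _ Ux fs gs) (cD_mul _ Ux fs gs).
move: (cD (fop_v d) f x) (cD (fop_w d) f x) (cD (fop_v d) g x) (cD (fop_w d) g x).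
by move: (fop_a d) (fop_b d) (f x) (g x) => *; ring.
Qed.

Lemma fapp_scale d (c : C) f x : U x -> smooth_on U f ->
  fapp d (fun y => c * f y) x = c * fapp d f x.
Proof.
move=> Ux fs; rewrite (fapp_mul d Ux (smooth_cst _ c) fs).
by rewrite (fapp_cst d c x) mul0r add0r.
Qed.

Lemma fapp_opp d f x : U x -> smooth_on U f ->
  fapp d (fun y => - f y) x = - fapp d f x.
Proof.
move=> Ux fs; rewrite -[RHS]mulN1r -(fapp_scale d (-1) Ux fs).
by apply: fapp_ext => y; rewrite mulN1r.
Qed.

Lemma fapp_sub d f g x : U x -> smooth_on U f -> smooth_on U g ->
  fapp d (fun y => f y - g y) x = fapp d f x - fapp d g x.
Proof.
by move=> Ux fs gs; rewrite fapp_add ?fapp_opp //; exact: smooth_opp.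
Qed.

Lemma fapp_sum d (I : Type) (r : seq I) (F : I -> V -> C) x : U x ->
  (forall i, smooth_on U (F i)) ->
  fapp d (fun y => \sum_(i <- r) F i y) x = \sum_(i <- r) fapp d (F i) x.
Proof.
move=> Ux Fs; elim: r => [|i r IH].
  rewrite big_nil -[RHS](fapp_cst d 0 x).
  by apply: fapp_ext => y; rewrite big_nil.
rewrite big_cons -IH -(fapp_add d Ux (Fs i) (smooth_sum oU r Fs)).
by apply: fapp_ext => y; rewrite big_cons.
Qed.

Lemma fapp_conj d f x : U x -> smooth_on U f ->
  fapp d (fun y => (f y)^*) x = (fapp (fconj d) f x)^*.
Proof.
move=> Ux fs; rewrite /fapp (cD_conj _ Ux fs) (cD_conj _ Ux fs).
rewrite -[fop_a d in LHS]conjcK -[fop_b d in LHS]conjcK.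
by rewrite [RHS]rmorphD 2!rmorphM.
Qed.

Lemma fapp_sym d d' f x : U x -> smooth_on U f ->
  fapp d (fapp d' f) x = fapp d' (fapp d f) x.
Proof.
move=> Ux fs.
have cf v : smooth_on U (cD v f) by exact: smooth_cD.
have sc (c : C) v : smooth_on U (fun y => c * cD v f y).
  by apply: smooth_mul => //; exact: smooth_cst.
have E (d1 d2 : fop) : fapp d1 (fapp d2 f) x =
    fop_a d2 * (fop_a d1 * cD (fop_v d1) (cD (fop_v d2) f) x
               + fop_b d1 * cD (fop_w d1) (cD (fop_v d2) f) x) +
    fop_b d2 * (fop_a d1 * cD (fop_v d1) (cD (fop_w d2) f) x
               + fop_b d1 * cD (fop_w d1) (cD (fop_w d2) f) x).
  rewrite (fapp_add d1 Ux (sc (fop_a d2) (fop_v d2)) (sc (fop_b d2) (fop_w d2))).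
  by rewrite (fapp_scale d1 _ Ux (cf _)) (fapp_scale d1 _ Ux (cf _)).
rewrite !E (cD_sym (fop_v d') (fop_v d) Ux fs) (cD_sym (fop_v d') (fop_w d) Ux fs).
rewrite (cD_sym (fop_w d') (fop_v d) Ux fs) (cD_sym (fop_w d') (fop_w d) Ux fs).
move: (cD (fop_v d) (cD (fop_v d') f) x) (cD (fop_w d) (cD (fop_v d') f) x).
move: (cD (fop_v d) (cD (fop_w d') f) x) (cD (fop_w d) (cD (fop_w d') f) x).
by move: (fop_a d) (fop_a d') (fop_b d) (fop_b d') => *; ring.
Qed.

Definition dmx d m n (A : V -> 'M[C]_(m, n)) x : 'M[C]_(m, n) :=
  \matrix_(i, j) fapp d (fun y => A y i j) x.

Lemma mx_smooth_dmx d m n (A : V -> 'M[C]_(m, n)) :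
  mx_smooth U A -> mx_smooth U (dmx d A).
Proof.
by move=> As i j; under eq_fun do rewrite mxE; exact: smooth_fapp.
Qed.

Lemma dmx_eq d m n (A B : V -> 'M[C]_(m, n)) x : U x -> {in U, A =1 B} ->
  dmx d A x = dmx d B x.
Proof.
move=> Ux AB; apply/matrixP => i j; rewrite !mxE; apply: (fapp_eq _ Ux).
by move=> y /AB ->.
Qed.

Lemma dmx_cst d m n (A : 'M[C]_(m, n)) x : dmx d (fun=> A) x = 0.
Proof. by apply/matrixP => i j; rewrite !mxE fapp_cst. Qed.

Lemma dmx_add d m n (A B : V -> 'M[C]_(m, n)) x : U x ->
  mx_smooth U A -> mx_smooth U B ->
  dmx d (fun y => A y + B y) x = dmx d A x + dmx d B x.
Proof.
move=> Ux As Bs; apply/matrixP => i j; rewrite !mxE -(fapp_add d Ux (As i j) (Bs i j)).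
by apply: fapp_ext => y; rewrite mxE.
Qed.

Lemma dmx_mul d m n p (A : V -> 'M[C]_(m, n)) (B : V -> 'M[C]_(n, p)) x : U x ->
  mx_smooth U A -> mx_smooth U B ->
  dmx d (fun y => A y *m B y) x = dmx d A x *m B x + A x *m dmx d B x.
Proof.
move=> Ux As Bs; apply/matrixP => i j; rewrite !mxE -big_split /=.
rewrite (_ : (fun y => _) = (fun y => \sum_l A y i l * B y l j)); last first.
  by apply/funext => y; rewrite mxE.
rewrite fapp_sum //; last by move=> l; exact: smooth_mul.
by apply: eq_bigr => l _; rewrite fapp_mul // !mxE.
Qed.

Lemma dmx_tr d m n (A : V -> 'M[C]_(m, n)) x :
  dmx d (fun y => (A y)^T) x = (dmx d A x)^T.
Proof.
apply/matrixP => i j; rewrite !mxE.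
by apply: fapp_ext => y; rewrite mxE.
Qed.

Lemma dmx_conj d m n (A : V -> 'M[C]_(m, n)) x : U x -> mx_smooth U A ->
  dmx d (fun y => map_mx conjc (A y)) x = map_mx conjc (dmx (fconj d) A x).
Proof.
move=> Ux As; apply/matrixP => i j; rewrite !mxE -(fapp_conj d Ux (As i j)).
by apply: fapp_ext => y; rewrite mxE.
Qed.

Lemma dmx_block d m1 m2 n1 n2 (A : V -> 'M[C]_(m1, n1))
  (B : V -> 'M[C]_(m1, n2)) (D : V -> 'M[C]_(m2, n1)) (E : V -> 'M[C]_(m2, n2)) x :
  dmx d (fun y => block_mx (A y) (B y) (D y) (E y)) x =
  block_mx (dmx d A x) (dmx d B x) (dmx d D x) (dmx d E x).
Proof.
apply/matrixP => i j; rewrite mxE.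
case: (split_ordP i) => i' ->; case: (split_ordP j) => j' ->;
  rewrite ?block_mxEul ?block_mxEur ?block_mxEdl ?block_mxEdr mxE;
  apply: fapp_ext => y;
  by rewrite ?block_mxEul ?block_mxEur ?block_mxEdl ?block_mxEdr.
Qed.

Lemma fapp_trace d n (A : V -> 'M[C]_n) x : U x -> mx_smooth U A ->
  fapp d (fun y => \tr (A y)) x = \tr (dmx d A x).
Proof.
move=> Ux As.
transitivity (\sum_i fapp d (fun y => A y i i) x).
  exact: (fapp_sum d (index_enum _) Ux (fun i => As i i)).
by apply: eq_bigr => i _; rewrite mxE.
Qed.

Lemma dmx_sym d d' m n (A : V -> 'M[C]_(m, n)) x : U x -> mx_smooth U A ->
  dmx d (dmx d' A) x = dmx d' (dmx d A) x.
Proof.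
move=> Ux As; apply/matrixP => i j.
have E (e e' : fop) y : dmx e (dmx e' A) y i j = fapp e (fapp e' (fun y => A y i j)) y.
  by rewrite mxE; apply: fapp_ext => z; rewrite mxE.
apply: etrans (E _ _ _) _; apply: etrans (fapp_sym d d' Ux (As i j)) _.
exact/esym/E.
Qed.

Lemma dmx_inv d n (A : V -> 'M[C]_n) x : U x -> mx_smooth U A ->
  (forall y, U y -> A y \in unitmx) ->
  dmx d (fun y => invmx (A y)) x = - (invmx (A x) *m dmx d A x *m invmx (A x)).
Proof.
move=> Ux As Au.
have Is := mx_smooth_inv oU Au As.
have : dmx d (fun y => A y *m invmx (A y)) x = 0.
  rewrite -(dmx_cst d (1%:M : 'M[C]_n) x); apply: (dmx_eq d Ux) => y.
  rewrite inE => Uy; exact: mulmxV (Au _ Uy).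
rewrite (dmx_mul d Ux As Is) => /eqP; rewrite addrC addr_eq0 => /eqP E.
move: E; move: (dmx d (fun y => invmx (A y)) x) (dmx d A x) => X Y E.
by rewrite -[X](mulKmx (Au _ Ux)) E mulmxN mulmxA.
Qed.

End fop_theory.

End ComplexSmooth.

(** * Positive definite matrices *)

Section PositiveMatrices.
Context {R : realType}.
Local Notation C := R[i].

Definition ctr m n (A : 'M[C]_(m, n)) : 'M[C]_(n, m) := map_mx conjc A^T.

Lemma ctrE m n (A : 'M[C]_(m, n)) i j : ctr A i j = (A j i)^*.
Proof. by rewrite !mxE. Qed.

Lemma ctrK m n (A : 'M[C]_(m, n)) : ctr (ctr A) = A.
Proof. by apply/matrixP => i j; rewrite !ctrE conjcK. Qed.

Lemma ctr_mul m n p (A : 'M[C]_(m, n)) (B : 'M[C]_(n, p)) :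
  ctr (A *m B) = ctr B *m ctr A.
Proof. by rewrite /ctr trmx_mul map_mxM. Qed.

Lemma ctr_add m n (A B : 'M[C]_(m, n)) : ctr (A + B) = ctr A + ctr B.
Proof. by apply/matrixP => i j; rewrite !mxE rmorphD. Qed.

Lemma ctr_opp m n (A : 'M[C]_(m, n)) : ctr (- A) = - ctr A.
Proof. by apply/matrixP => i j; rewrite !mxE rmorphN. Qed.

Lemma ctr_scale m n (c : C) (A : 'M[C]_(m, n)) : ctr (c *: A) = c^* *: ctr A.
Proof. by apply/matrixP => i j; rewrite !mxE rmorphM. Qed.

Lemma ctr0 m n : ctr (0 : 'M[C]_(m, n)) = 0.
Proof. by apply/matrixP => i j; rewrite !mxE conjc0. Qed.

Lemma ctr1 n : ctr (1%:M : 'M[C]_n) = 1%:M.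
Proof. by rewrite /ctr trmx1 map_mx1. Qed.

Lemma ctr_tr m n (A : 'M[C]_(m, n)) : ctr A^T = (ctr A)^T.
Proof. by apply/matrixP => i j; rewrite !mxE. Qed.

Lemma ctr_block m1 m2 n1 n2 (A : 'M[C]_(m1, n1)) (B : 'M[C]_(m1, n2))
  (D : 'M[C]_(m2, n1)) (E : 'M[C]_(m2, n2)) :
  ctr (block_mx A B D E) = block_mx (ctr A) (ctr D) (ctr B) (ctr E).
Proof. by rewrite /ctr tr_block_mx map_block_mx. Qed.

Lemma ctr_unit n (A : 'M[C]_n) : (ctr A \in unitmx) = (A \in unitmx).
Proof. by rewrite /ctr map_unitmx unitmx_tr. Qed.

Lemma ctr_inv n (A : 'M[C]_n) : ctr (invmx A) = invmx (ctr A).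
Proof. by rewrite /ctr trmx_inv map_invmx. Qed.

Lemma hermitianP n (A : 'M[C]_n) : hermitian_mx A <-> ctr A = A.
Proof.
split=> [hA|hA i j]; first by apply/matrixP => i j; rewrite ctrE -hA.
by rewrite -{1}hA ctrE.
Qed.

Lemma hformE n (A : 'M[C]_n) v : hform A v = (v *m A *m ctr v) 0 0.
Proof.
rewrite mxE /hform exchange_big; apply: eq_bigr => j _ /=.
rewrite mxE ctrE mulr_suml; apply: eq_bigr => i _.
by rewrite [v 0 i * _]mulrC.
Qed.

Lemma mul_ctrE m n (A : 'M[C]_(m, n)) i : (A *m ctr A) i i = \sum_j `|A i j| ^+ 2.
Proof. by rewrite mxE; apply: eq_bigr => j _; rewrite ctrE sqr_normc. Qed.

Lemma mul_ctr_ge0 m n (A : 'M[C]_(m, n)) i : 0 <= (A *m ctr A) i i.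
Proof. by rewrite mul_ctrE sumr_ge0 // => j _; rewrite exprn_ge0. Qed.

Lemma trace_mul_ctr_ge0 m n (A : 'M[C]_(m, n)) : 0 <= \tr (A *m ctr A).
Proof. by apply: sumr_ge0 => i _; exact: mul_ctr_ge0. Qed.

Lemma posdef_mul_ctr n (B : 'M[C]_n) : B \in unitmx -> posdef (B *m ctr B).
Proof.
move=> uB; split; first by apply/hermitianP; rewrite ctr_mul ctrK.
move=> v v0; rewrite hformE mulmxA -mulmxA -ctr_mul.
rewrite lt_def mul_ctr_ge0 andbT mul_ctrE; apply: contraNneq v0 => /eqP.
rewrite psumr_eq0 => [/allP vB0|j _]; last by rewrite exprn_ge0.
have vB : v *m B = 0.
  apply/matrixP => i j; rewrite (ord1 i) [RHS]mxE.
  have := vB0 j (mem_index_enum _); rewrite /= sqrf_eq0 normr_eq0.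
  by move=> /eqP.
by rewrite -[v](mulmxK uB) vB mul0mx.
Qed.

Lemma conjc_numE (x : C) : Num.conj x = x^*.
Proof. by []. Qed.

Lemma hermitian_spectral n (A : 'M[C]_n) : ctr A = A ->
  exists U : 'M[C]_n, exists d : 'rV[C]_n,
    [/\ U *m ctr U = 1%:M, ctr U *m U = 1%:M & A = ctr U *m diag_mx d *m U].
Proof.
move=> hA.
have An : A \is normalmx.
  apply/normalmxP; have -> : (A ^t* = A)%sesqui by exact: hA.
  by [].
have /orthomx_spectralP E := An.
have uP := spectral_unitarymx A.
have /unitarymxP P1 := uP.
have P2 : ctr (spectralmx A) *m spectralmx A = 1%:M.
  exact: (mulmx1C P1).
exists (spectralmx A), (spectral_diag A); split; [exact: P1|exact: P2|].
apply: etrans E _; congr (_ *m _ *m _); exact: invmx_unitary.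
Qed.

(** The eigenvalues are values of the form on the rows of [U], hence positive, and [B] is the
    adjoint of [U] times their square roots. Through this factorisation inverses, transposes,
    congruences and traces of positive matrices all become squares. *)
Lemma posdef_decomp n (A : 'M[C]_n) : posdef A ->
  exists2 B : 'M[C]_n, B \in unitmx & A = B *m ctr B.
Proof.
move=> [/hermitianP hA pA].
have [U [d [U1 U2 E]]] := hermitian_spectral hA.
have d0 i : 0 < d 0 i.
  have -> : d 0 i = hform A (row i U).
    have UA : U *m A = diag_mx d *m U by rewrite {1}E !mulmxA U1 mul1mx.
    rewrite hformE -row_mul UA.
    have -> : row i (diag_mx d *m U) = d 0 i *: row i U.
      by rewrite row_mul row_diag_mx -scalemxAl -rowE.
    rewrite -scalemxAl mxE.
    have -> : (row i U *m ctr (row i U)) 0 0 = (U *m ctr U) i i.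
      by rewrite !mxE; apply: eq_bigr => j _; rewrite !mxE.
    by rewrite U1 mxE eqxx mulr1.
  apply: pA; apply/eqP => r0.
  have := congr1 (fun M => M *m ctr U) r0.
  rewrite -row_mul U1 mul0mx => /(congr1 (fun M : 'rV_n => M 0 i)).
  by rewrite !mxE eqxx => /eqP; rewrite oner_eq0.
exists (ctr U *m diag_mx (\row_i sqrtc (d 0 i))).
  rewrite unitmx_mul ctr_unit; apply/andP; split.
    by have [] := mulmx1_unit U1.
  rewrite unitmxE det_diag unitfE; apply/prodf_neq0 => i _.
  by rewrite mxE sqrtc_eq0 gt_eqF.
rewrite ctr_mul ctrK mulmxA -[X in _ = X *m _]mulmxA {1}E.
congr (_ *m _ *m _); apply/matrixP => i j.
rewrite mul_diag_mx !mxE.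
have [->|ij] := eqVneq i j; last first.
  by rewrite ?[j == i]eq_sym ?(negbTE ij) !mulr0n ?conjc0 ?mulr0.
rewrite ?eqxx !mulr1n -[(sqrtc _)^*]conjc_numE.
have /CrealP -> : sqrtc (d 0 j) \is Num.real by rewrite ger0_real // sqrtc_ge0 ltW.
by rewrite -expr2 sqr_sqrtc.
Qed.

Lemma posdef_unit n (A : 'M[C]_n) : posdef A -> A \in unitmx.
Proof.
by move=> /posdef_decomp[B uB ->]; rewrite unitmx_mul ctr_unit uB.
Qed.

Lemma posdef_congr n (A M : 'M[C]_n) : M \in unitmx -> posdef A ->
  posdef (M *m A *m ctr M).
Proof.
move=> uM /posdef_decomp[B uB ->].
rewrite mulmxA -mulmxA -ctr_mul; apply: posdef_mul_ctr.
by rewrite unitmx_mul uM.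
Qed.

Lemma posdef_inv n (A : 'M[C]_n) : posdef A -> posdef (invmx A).
Proof.
move=> /posdef_decomp[B uB ->].
have -> : invmx (B *m ctr B) = ctr (invmx B) *m ctr (ctr (invmx B)).
  apply: (can_inj (mulKmx (_ : B *m ctr B \in unitmx))).
    by rewrite unitmx_mul ctr_unit uB.
  rewrite mulmxV ?unitmx_mul ?ctr_unit ?uB // ctrK ctr_inv -mulmxA.
  by rewrite [ctr B *m _]mulmxA mulmxV ?ctr_unit // mul1mx mulmxV.
by apply: posdef_mul_ctr; rewrite ctr_unit unitmx_inv.
Qed.

Lemma posdef_tr n (A : 'M[C]_n) : posdef A -> posdef A^T.
Proof.
move=> /posdef_decomp[B uB ->].
have -> : (B *m ctr B)^T = map_mx conjc B *m ctr (map_mx conjc B).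
  rewrite trmx_mul; congr (_ *m _); apply/matrixP => i j; rewrite !mxE //.
  by rewrite conjcK.
by apply: posdef_mul_ctr; rewrite map_unitmx.
Qed.

Lemma posdef_block n1 n2 (A : 'M[C]_n1) (B : 'M[C]_n2) : posdef A -> posdef B ->
  posdef (block_mx A 0 0 B).
Proof.
move=> /posdef_decomp[a ua ->] /posdef_decomp[b ub ->].
have -> : block_mx (a *m ctr a) 0 0 (b *m ctr b) =
    block_mx a 0 0 b *m ctr (block_mx a 0 0 b).
  by rewrite ctr_block mulmx_block !ctr0 !mulmx0 !mul0mx !addr0 add0r.
apply: posdef_mul_ctr; rewrite unitmxE det_ublock.
by rewrite unitrM -!unitmxE ua.
Qed.

Lemma posdef_det_gt0 n (A : 'M[C]_n) : posdef A -> 0 < \det A.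
Proof.
move=> /posdef_decomp[B uB ->]; rewrite det_mulmx /ctr det_map_mx det_tr.
rewrite -[X in 0 < X]/(\det B * (\det B)^*) -sqr_normc exprn_gt0 // normr_gt0.
by move: uB; rewrite unitmxE unitfE.
Qed.

Lemma hform_row_inv n (E X : 'M[C]_n) i : E \in unitmx ->
  hform (E *m X *m ctr E) (row i (invmx E)) = X i i.
Proof.
move=> uE.
have H : row i (invmx E) *m E = delta_mx 0 i by rewrite -row_mul mulVmx // row1.
have H2 : ctr E *m ctr (row i (invmx E)) = ctr (delta_mx 0 i) by rewrite -ctr_mul H.
rewrite hformE !mulmxA H -mulmxA H2 -rowE mxE (bigD1 i) //= big1 ?addr0.
  by rewrite !mxE !eqxx conjc1 mulr1.
by move=> j ji; rewrite !mxE eqxx (negbTE ji) conjc0 mulr0.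
Qed.

(** Diagonalise [A] after reducing [A0 = B B^*] to the identity by [B]. The last clause exhibits
    each relative eigenvalue as a value of [A] on a vector of unit [A0]-norm, which is how
    inequalities between forms reach the eigenvalues. *)
Lemma simultaneous_diag n (A0 A : 'M[C]_n) : posdef A0 -> posdef A ->
  exists E : 'M[C]_n, exists d : 'rV[C]_n,
    [/\ E \in unitmx, A0 = E *m ctr E, A = E *m diag_mx d *m ctr E &
        forall i, [/\ 0 < d 0 i, d 0 i = hform A (row i (invmx E)) &
                  hform A0 (row i (invmx E)) = 1]].
Proof.
move=> /posdef_decomp[B uB ->] [/hermitianP hA pA].
pose A' := invmx B *m A *m ctr (invmx B).
have hA' : ctr A' = A' by rewrite /A' !ctr_mul ctrK hA mulmxA.
have [U [d [U1 U2 EA]]] := hermitian_spectral hA'.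
have uU : U \in unitmx by have [] := mulmx1_unit U1.
have iB : invmx B *m B = 1%:M by rewrite mulVmx.
exists (B *m ctr U), d.
have uE : B *m ctr U \in unitmx by rewrite unitmx_mul uB ctr_unit.
have AE : A = B *m ctr U *m diag_mx d *m ctr (B *m ctr U).
  rewrite ctr_mul ctrK mulmxA -[B *m _ *m _]mulmxA -[B *m _ *m U]mulmxA -EA.
  rewrite /A' !mulmxA mulmxV // mul1mx -mulmxA -ctr_mul mulmxV //.
  by rewrite ctr1 mulmx1.
have A0E : B *m ctr B = B *m ctr U *m ctr (B *m ctr U).
  by rewrite ctr_mul ctrK mulmxA -[B *m _ *m U]mulmxA U2 mulmx1.
have hf X i := hform_row_inv X i uE.
have dE i : d 0 i = hform A (row i (invmx (B *m ctr U))).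
  by rewrite {1}AE hf mxE eqxx.
split => // i; split => //.
  rewrite dE; apply: pA; apply/eqP => r0.
  have := congr1 (fun M => M *m (B *m ctr U)) r0.
  rewrite -row_mul mulVmx // mul0mx row1 => /(congr1 (fun M : 'rV_n => M 0 i)).
  by rewrite !mxE !eqxx => /eqP; rewrite oner_eq0.
by have := hf 1%:M i; rewrite mulmx1 -A0E mxE eqxx.
Qed.

End PositiveMatrices.

(** * Trace inequalities for positive definite matrices *)

Section PositiveEstimates.
Context {R : realType}.
Local Notation C := R[i].

Lemma hform_diag n (E : 'M[C]_n) (d : 'rV[C]_n) v :
  hform (E *m diag_mx d *m ctr E) v = \sum_i d 0 i * `|(v *m E) 0 i| ^+ 2.
Proof.
rewrite hformE !mulmxA -mulmxA -ctr_mul mxE; apply: eq_bigr => i _.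
rewrite ctrE mul_mx_diag [X in X * _]mxE sqr_normc mulrA.
by congr (_ * _); exact: mulrC.
Qed.

Lemma posdef_trace_gt0 n (A : 'M[C]_n) : posdef A -> 0 <= \tr A.
Proof. by move=> /posdef_decomp[B _ ->]; exact: trace_mul_ctr_ge0. Qed.

Lemma invmx_mul_ctr n (E : 'M[C]_n) : E \in unitmx ->
  invmx (E *m ctr E) = ctr (invmx E) *m invmx E.
Proof.
move=> uE; apply: (can_inj (mulKmx (_ : E *m ctr E \in unitmx))).
  by rewrite unitmx_mul ctr_unit uE.
rewrite mulmxV ?unitmx_mul ?ctr_unit ?uE // ctr_inv -mulmxA.
by rewrite [ctr E *m _]mulmxA mulmxV ?ctr_unit // mul1mx mulmxV.
Qed.

Lemma invmx_mul_diag_ctr n (E : 'M[C]_n) (d : 'rV[C]_n) : E \in unitmx ->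
  (forall i, d 0 i != 0) ->
  invmx (E *m diag_mx d *m ctr E) =
  ctr (invmx E) *m diag_mx (\row_i (d 0 i)^-1) *m invmx E.
Proof.
move=> uE d0.
have uD : diag_mx d \in unitmx.
  by rewrite unitmxE det_diag unitfE; apply/prodf_neq0 => i _.
apply: (can_inj (mulKmx (_ : E *m diag_mx d *m ctr E \in unitmx))).
  by rewrite !unitmx_mul ctr_unit uE uD.
rewrite mulmxV ?unitmx_mul ?ctr_unit ?uE ?uD // ctr_inv !mulmxA.
rewrite mulmxK ?ctr_unit // -[_ *m diag_mx d *m _]mulmxA.
have -> : diag_mx d *m diag_mx (\row_i (d 0 i)^-1) = 1%:M.
  apply/matrixP => i j; rewrite mul_diag_mx !mxE.
  have [->|ij] := eqVneq i j; last by rewrite !mulr0n mulr0.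
  by rewrite !mulr1n mulfV.
by rewrite mulmx1 mulmxV.
Qed.

(** The trace is the sum of the eigenvalues of [G] relative to [G0], all positive, so it dominates
    each of them. *)
Lemma herm_le_trace n (G0 G : 'M[C]_n) : posdef G0 -> posdef G ->
  herm_le G (\tr (invmx G0 *m G) *: G0).
Proof.
move=> p0 p v; have [E [d [uE -> -> dP]]] := simultaneous_diag p0 p.
have d0 i : 0 < d 0 i by have [] := dP i.
have -> : \tr (invmx (E *m ctr E) *m (E *m diag_mx d *m ctr E)) = \sum_i d 0 i.
  rewrite invmx_mul_ctr // !mulmxA -[_ *m invmx E *m E]mulmxA mulVmx // mulmx1.
  rewrite mxtrace_mulC mulmxA -ctr_mul mulVmx // ctr1 mul1mx.
  by rewrite mxtrace_diag.
have -> : (\sum_i d 0 i) *: (E *m ctr E) = E *m diag_mx (\row__ (\sum_i d 0 i)) *m ctr E.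
  rewrite (_ : diag_mx _ = (\sum_i d 0 i)%:M) ?mul_mx_scalar ?scalemxAl //.
  by apply/matrixP => i j; rewrite !mxE.
rewrite !hform_diag; apply: ler_sum => i _.
apply: ler_wpM2r; first by rewrite exprn_ge0.
by rewrite [leRHS]mxE (bigD1 i) //= lerDl sumr_ge0 // => j _; exact: ltW.
Qed.

(** The eigenvalues of [G] relative to [G0] are at least [lam], and in a common diagonalising frame
    both traces are weighted sums of the same squares. *)
Lemma trace_inv_le n (G0 G : 'M[C]_n) (lam : C) m (X : 'M[C]_(n, m)) :
  0 < lam -> posdef G0 -> posdef G -> herm_le (lam *: G0) G ->
  \tr (invmx G *m (X *m ctr X)) <= lam^-1 * \tr (invmx G0 *m (X *m ctr X)).
Proof.
move=> lam0 p0 p le; have [E [d [uE E0 EG dP]]] := simultaneous_diag p0 p.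
have dlam i : lam <= d 0 i.
  have [_ -> f1] := dP i; apply: le_trans (le _).
  rewrite hformE -scalemxAr -scalemxAl mxE -hformE f1 mulr1 //.
have d0 i : 0 < d 0 i by exact: lt_le_trans (dlam i).
rewrite EG E0 invmx_mul_ctr // invmx_mul_diag_ctr //; last by move=> i; rewrite gt_eqF.
set Y := invmx E *m X.
have tD (e : 'rV[C]_n) : \tr (ctr (invmx E) *m diag_mx e *m invmx E *m (X *m ctr X))
    = \sum_i e 0 i * \sum_j `|Y i j| ^+ 2.
  rewrite -!mulmxA mxtrace_mulC !mulmxA -mulmxA.
  rewrite -!mulmxA -ctr_mul -/Y [invmx E *m (X *m _)]mulmxA -/Y.
  apply: eq_bigr => i _; rewrite mul_diag_mx mxE; congr (_ * _).
  exact: mul_ctrE.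
have t1 : \tr (ctr (invmx E) *m invmx E *m (X *m ctr X)) =
    \sum_i \sum_j `|Y i j| ^+ 2.
  rewrite -[ctr (invmx E) in LHS]mulmx1 -diag_const_mx tD.
  by apply: eq_bigr => i _; rewrite mxE mul1r.
apply: le_trans (_ : _ <= lam^-1 * \sum_i \sum_j `|Y i j| ^+ 2) _; last first.
  by rewrite -t1.
apply: le_trans (_ : \sum_i (\row_i (d 0 i)^-1) 0 i * \sum_j `|Y i j| ^+ 2 <= _).
  by rewrite -tD.
rewrite mulr_sumr.
apply: ler_sum => i _.
rewrite [X in X * _]mxE.
apply: ler_wpM2r; first by apply: sumr_ge0 => j _; rewrite exprn_ge0.
by rewrite lef_pV2 ?posrE.
Qed.

(** Relative to [invmx K], the eigenvalues of [W] sum to the trace of [K *m W]. In the trace of [W]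
    each is weighted by the squared length of a column of [E], and these lengths sum to the trace of
    [invmx K]. *)
Lemma trace_le_mul n (K W : 'M[C]_n) : posdef K -> posdef W ->
  \tr W <= \tr (invmx K) * \tr (K *m W).
Proof.
move=> pK pW; have pKi := posdef_inv pK.
have [E [d [uE EK EW dP]]] := simultaneous_diag pKi pW.
have d0 i : 0 < d 0 i by have [] := dP i.
have -> : \tr (K *m W) = \sum_i d 0 i.
  rewrite -[K]invmxK EK EW invmx_mul_ctr // !mulmxA -[_ *m invmx E *m E]mulmxA.
  rewrite mulVmx // mulmx1 mxtrace_mulC mulmxA -ctr_mul mulVmx // ctr1 mul1mx.
  by rewrite mxtrace_diag.
have tE : \tr (E *m ctr E) = \sum_i (ctr E *m E) i i by rewrite mxtrace_mulC.
have -> : \tr W = \sum_i d 0 i * (ctr E *m E) i i.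
  rewrite EW mxtrace_mulC mulmxA mxtrace_mulC.
  by apply: eq_bigr => i _; rewrite mul_diag_mx mxE.
rewrite EK tE mulrC mulr_suml; apply: ler_sum => i _.
apply: ler_wpM2l; first exact: ltW.
rewrite (bigD1 i) //= lerDl sumr_ge0 // => j _.
by rewrite -{2}[E]ctrK; exact: mul_ctr_ge0.
Qed.

Lemma posdef_entry_le n (A : 'M[C]_n) i j : posdef A -> `|A i j| <= \tr A.
Proof.
move=> /posdef_decomp[B _ ->].
have diag k : 0 <= (B *m ctr B) k k by exact: mul_ctr_ge0.
have [->|ij] := eqVneq i j.
  rewrite ger0_norm // /mxtrace (bigD1 j) //= lerDl; exact: sumr_ge0.
have : `|(B *m ctr B) i j| <= (B *m ctr B) i i + (B *m ctr B) j j.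
  rewrite mxE (le_trans (ler_norm_sum _ _ _)) // !mul_ctrE -big_split /=.
  apply: ler_sum => k _; rewrite ctrE normrM normcJ.
  set a := `|_|; set b := `|_|.
  have ar : a \is Num.real by exact: normr_real.
  have br : b \is Num.real by exact: normr_real.
  have h : 0 <= (a - b) ^+ 2 by rewrite real_exprn_even_ge0 // rpredB.
  have ab : 0 <= a * b := mulr_ge0 (normr_ge0 _) (normr_ge0 _).
  rewrite -subr_ge0 (_ : _ - _ = (a - b) ^+ 2 + a * b); last by ring.
  exact: addr_ge0 h ab.
move=> /le_trans; apply.
rewrite /mxtrace (bigD1 i) //= lerD2l (bigD1 j) //=; last by rewrite eq_sym.
by rewrite lerDl; exact: sumr_ge0.
Qed.

(** A positive [A] is a sum of rank-one forms, one for each column of [B]. *)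
Lemma sum_posdef_ge0 n (A : 'M[C]_n) (L : 'M[C]_n) : posdef A ->
  (forall v : 'I_n -> C, 0 <= \sum_p \sum_q v p * (v q)^*%C * L p q) ->
  0 <= \sum_p \sum_q A q p * L p q.
Proof.
move=> /posdef_decomp[B _ ->] LP.
rewrite (_ : \sum_p _ = \sum_a \sum_p \sum_q (B p a)^*%C * ((B q a)^*%C)^*%C * L p q).
  by apply: sumr_ge0 => a _; exact: (LP (fun p => (B p a)^*%C)).
rewrite [RHS]exchange_big; apply: eq_bigr => p _ /=.
rewrite [RHS]exchange_big; apply: eq_bigr => q _ /=.
rewrite mxE mulr_suml; apply: eq_bigr => a _.
by rewrite ctrE conjcK [(B p a)^*%C%C * _]mulrC.
Qed.

(** Positivity of the good term in the Bochner formula: on a rank-one form the sum is the squared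
    norm of [ctr k *m Y *m w], with [Y] the corresponding combination of the [X p]. *)
Lemma sum_trace_square_ge0 n m (A : 'M[C]_n) (K V : 'M[C]_m) (X : 'I_n -> 'M[C]_m) :
  posdef A -> posdef K -> posdef V ->
  0 <= \sum_p \sum_q A q p * \tr (K *m X p *m V *m ctr (X q)).
Proof.
move=> pA /posdef_decomp[k _ ->] /posdef_decomp[w _ ->].
have := @sum_posdef_ge0 n A
  (\matrix_(p, q) \tr (k *m ctr k *m X p *m (w *m ctr w) *m ctr (X q))) pA.
under eq_bigr => p _ do under eq_bigr => q _ do rewrite mxE.
apply=> v.
pose Y := \sum_p v p *: X p.
have -> : \sum_p \sum_q v p * (v q)^*%C *
  (\matrix_(p, q) \tr (k *m ctr k *m X p *m (w *m ctr w) *m ctr (X q))) p q =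
  \tr ((ctr k *m Y *m w) *m ctr (ctr k *m Y *m w)).
  rewrite !ctr_mul ctrK !mulmxA mxtrace_mulC !mulmxA /Y.
  have -> : ctr (\sum_p v p *: X p) = \sum_q (v q)^*%C *: ctr (X q).
    rewrite /ctr !raddf_sum /=; apply: eq_bigr => q _.
    by rewrite -ctr_scale /ctr linearZ.
  rewrite mulmx_sumr [RHS]raddf_sum [LHS]exchange_big /=; apply: eq_bigr => q _.
  rewrite mulmx_sumr !mulmx_suml raddf_sum /=; apply: eq_bigr => p _.
  rewrite mxE -?scalemxAr -?scalemxAl -?scalemxAr -?scalemxAl !mxtraceZ !mulmxA mulrA.
  by rewrite [(v q)^*%C * _]mulrC.
exact: trace_mul_ctr_ge0.
Qed.

End PositiveEstimates.

(** * The generalized metric and its curvature *)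

Ltac generalize_products :=
  repeat match goal with
  | |- context [@mulmx ?r ?k ?l ?m ?A ?B] => generalize (@mulmx r k l m A B); intro
  end.

Section TraceAlgebra.
Context {R : realType}.
Local Notation C := R[i].

(** The twists of [K] are dual to those of [W], so the Leibniz expansion of tr(K W) is the same with
    primed derivatives. Completing the square in the mixed terms then produces the two terms
    quadratic in first derivatives, which turn the primed second derivatives of [W] and [K] into
    curvature terms. In use [s] and [r] are derivatives of [u] and [v], but the identity is purely
    algebraic. *)
Lemma twisted_trace_second_derivative m
    (K Ki W Wi Kp Kq Kpq Wp Wq Wpq u v s r : 'M[C]_m) :
  K *m Ki = 1%:M -> Ki *m K = 1%:M -> W *m Wi = 1%:M -> Wi *m W = 1%:M ->
  let Wp' := Wp + W *m v in
  let Wq' := Wq + u *m W in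
  let Wpq' := Wpq + u *m Wp + s *m W + Wq *m v + W *m r + u *m W *m v in
  let Kp' := Kp - v *m K in
  let Kq' := Kq - K *m u in
  let Kpq' := Kpq - Kp *m u - K *m s - v *m Kq - r *m K + v *m K *m u in
  \tr (Kpq *m W) + \tr (Kp *m Wq) + \tr (Kq *m Wp) + \tr (K *m Wpq) =
  \tr (K *m (Wpq' - Wp' *m Wi *m Wq')) +
  \tr (K *m (Wp' + Ki *m Kp' *m W) *m Wi *m (Wq' + W *m Kq' *m Ki)) +
  \tr ((Kpq' - Kq' *m Ki *m Kp') *m W).
Proof.
move=> KKi KiK WWi WiW.
have trN (A : 'M[C]_m) : \tr (- A) = - \tr A by exact: raddfN.
move=> Wp' Wq' Wpq' Kp' Kq' Kpq'.
have -> : \tr (K *m (Wp' + Ki *m Kp' *m W) *m Wi *m (Wq' + W *m Kq' *m Ki)) =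
    \tr (K *m Wp' *m Wi *m Wq') + \tr (Kq' *m Wp') + \tr (Kp' *m Wq') +
    \tr (Kq' *m Ki *m Kp' *m W).
  clearbody Wp' Wq' Wpq' Kp' Kq' Kpq'.
  rewrite [K *m (Wp' + _)]mulmxDr !mulmxA KKi mul1mx mulmxDl mulmxDr !mulmxDl.
  rewrite -[Kp' *m W *m Wi]mulmxA WWi mulmx1.
  rewrite !mulmxA -[K *m Wp' *m Wi *m W]mulmxA WiW mulmx1.
  rewrite !mxtraceD.
  have -> : \tr (K *m Wp' *m Kq' *m Ki) = \tr (Kq' *m Wp').
    by rewrite mxtrace_mulC !mulmxA KiK mul1mx mxtrace_mulC.
  have -> : \tr (Kp' *m W *m Kq' *m Ki) = \tr (Kq' *m Ki *m Kp' *m W).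
    by rewrite -mulmxA mxtrace_mulC !mulmxA.
  ring.
have -> : \tr (K *m (Wpq' - Wp' *m Wi *m Wq')) =
    \tr (K *m Wpq') - \tr (K *m Wp' *m Wi *m Wq').
  by rewrite mulmxBr !mulmxA mxtraceD trN.
have -> : \tr ((Kpq' - Kq' *m Ki *m Kp') *m W) =
    \tr (Kpq' *m W) - \tr (Kq' *m Ki *m Kp' *m W).
  by rewrite mulmxBl mxtraceD trN.
suff -> : \tr (Kpq *m W) + \tr (Kp *m Wq) + \tr (Kq *m Wp) + \tr (K *m Wpq) =
    \tr (K *m Wpq') + \tr (Kq' *m Wp') + \tr (Kp' *m Wq') + \tr (Kpq' *m W).
  ring.
rewrite /Wpq' /Kq' /Wp' /Kp' /Wq' /Kpq'.
rewrite ?(mulmxDr, mulmxDl, mulNmx, mulmxN, mulmxA, mxtraceD, trN).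
have cyc (A B : 'M[C]_m) : \tr (A *m B) = \tr (B *m A) := mxtrace_mulC A B.
have -> : \tr (v *m K *m Wq) = \tr (K *m Wq *m v) by rewrite -mulmxA cyc.
have -> : \tr (v *m K *m u *m W) = \tr (K *m u *m W *m v) by rewrite -!mulmxA cyc !mulmxA.
have -> : \tr (v *m Kq *m W) = \tr (Kq *m W *m v) by rewrite -mulmxA cyc.
have -> : \tr (r *m K *m W) = \tr (K *m W *m r) by rewrite -mulmxA cyc.
ring.
Qed.

End TraceAlgebra.

Section BlockAlgebra.
Context {R : realType} {n : nat}.
Local Notation C := R[i].
Implicit Types (G P x y : 'M[C]_n).

(** [nilp x] squares to zero and [unip x] is its exponential, a shear by the (2,0)-form [x]. The
    generalized metric is a block-diagonal one moved by this shear. *)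
Definition unip x : 'M[C]_(n + n) := block_mx 1%:M x 0 1%:M.
Definition nilp x : 'M[C]_(n + n) := block_mx 0 x 0 0.
Definition diag2 G P : 'M[C]_(n + n) := block_mx G 0 0 P.

(** Products of two [nilp] vanish, so shears do not affect a [nilp] factor. This is what lets
    derivatives and twists pass through the conjugation by [unip x]. *)
Lemma mul_unip_nilp x y : unip x *m nilp y = nilp y.
Proof. by rewrite /unip /nilp mulmx_block !mulmx0 !mul0mx !mul1mx !addr0 ?add0r. Qed.

Lemma mul_nilp_unip x y : nilp y *m unip x = nilp y.
Proof. by rewrite /unip /nilp mulmx_block !mulmx0 !mul0mx !mulmx1 ?mul0mx ?addr0 ?add0r. Qed.

Lemma ctr_nilp x : ctr (nilp x) = block_mx 0 0 (ctr x) 0.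
Proof. by rewrite ctr_block !ctr0. Qed.

Lemma unipK x : unip x *m unip (- x) = 1%:M.
Proof.
rewrite /unip mulmx_block !mulmx0 !mul0mx !mulmx1 !mul1mx !addr0 ?add0r addrC subrr.
by rewrite -scalar_mx_block.
Qed.

Lemma unipNK x : unip (- x) *m unip x = 1%:M.
Proof. by rewrite -{2}[x]opprK unipK. Qed.

Lemma diag2_mul G P G' P' : diag2 G P *m diag2 G' P' = diag2 (G *m G') (P *m P').
Proof. by rewrite /diag2 mulmx_block !mulmx0 !mul0mx !addr0 ?add0r. Qed.

(* The coefficient of the generalized metric
   [[G + x P x^*, x P], [P x^*, P]]. *)
Definition gmet G P x : 'M[C]_(n + n) := unip x *m diag2 G P *m ctr (unip x).

(* Conjugated by [unip x], the first and second derivatives of [gmet]; a bar is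
   the derivative along the conjugate operator. *)
Definition gmet1 P dG dP dx dbx : 'M[C]_(n + n) :=
  block_mx dG (dx *m P) (P *m ctr dbx) dP.

Definition gmet2 P deG deP dP eP dx dbx ex ebx dex dbebx : 'M[C]_(n + n) :=
  block_mx (dx *m P *m ctr ebx + deG + ex *m P *m ctr dbx)
           (dx *m eP + dex *m P + ex *m dP)
           (dP *m ctr ebx + P *m ctr dbebx + eP *m ctr dbx) deP.

(** The middle factor of [conj_leibniz] for a second derivative: [gmet1] is differentiated between
    its two shears, and each shear contributes a [nilp]. *)
Lemma gmet2E P eG deG deP dP eP dx dbx ex ebx dex dbebx :
  nilp dx *m gmet1 P eG eP ex ebx +
  block_mx deG (dex *m P + ex *m dP) (dP *m ctr ebx + P *m ctr dbebx) deP +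
  gmet1 P eG eP ex ebx *m ctr (nilp dbx) =
  gmet2 P deG deP dP eP dx dbx ex ebx dex dbebx.
Proof.
rewrite /gmet1 /gmet2 ctr_nilp !mulmx_block !mul0mx !mulmx0.
rewrite !addr0 !add0r !add_block_mx !addr0 !add0r mulmxA.
by congr block_mx; rewrite ?addrA // [_ + (_ + _)]addrA.
Qed.

(* The curvature term of the twisted second derivative, before conjugation by
   [unip x]. *)
Lemma gmet_curvature G Gi P Pi Gp Gq Gpq Pp Pq Ppq
    xp xpb xq xqb xqbp xqpb b b' e e' :
  P *m Pi = 1%:M -> Pi *m P = 1%:M ->
  let Yq := gmet1 P Gq Pq xqb xq in
  let Yp := gmet1 P Gp Pp xp xpb in
  let Ypq := gmet2 P Gpq Ppq Pp Pq xp xpb xqb xq xqbp xqpb in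
  let D := diag2 G P in
  Ypq + nilp b *m Yp + nilp b' *m D + Yq *m ctr (nilp e) + D *m ctr (nilp e')
    + nilp b *m D *m ctr (nilp e)
    - (Yp + D *m ctr (nilp e)) *m diag2 Gi Pi *m (Yq + nilp b *m D) =
  block_mx (Gpq - Gp *m Gi *m Gq + (xqb + b) *m P *m ctr (xpb + e))
    ((xqbp + b') *m P + (xqb + b) *m Pp - Gp *m Gi *m (xqb + b) *m P)
    (P *m ctr (xqpb + e') + Pq *m ctr (xpb + e) - P *m ctr (xpb + e) *m Gi *m Gq)
    (Ppq - Pp *m Pi *m Pq - P *m ctr (xpb + e) *m Gi *m (xqb + b) *m P).
Proof.
move=> PPi PiP Yq Yp Ypq D.
have E1 : nilp b *m Yp = block_mx (b *m P *m ctr xpb) (b *m Pp) 0 0.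
  by rewrite /nilp /Yp /gmet1 mulmx_block ?mul0mx ?add0r mulmxA.
have E2 : nilp b' *m D = block_mx 0 (b' *m P) 0 0.
  by rewrite /nilp /D /diag2 mulmx_block ?mul0mx ?mulmx0 ?add0r.
have E3 : Yq *m ctr (nilp e) = block_mx (xqb *m P *m ctr e) 0 (Pq *m ctr e) 0.
  by rewrite ctr_nilp /Yq /gmet1 mulmx_block ?mulmx0 ?add0r ?addr0.
have E4 y : D *m ctr (nilp y) = block_mx 0 0 (P *m ctr y) 0.
  by rewrite ctr_nilp /D /diag2 mulmx_block ?mul0mx ?mulmx0 ?add0r ?addr0.
have E5 : nilp b *m D *m ctr (nilp e) = block_mx (b *m P *m ctr e) 0 0 0.
  rewrite -mulmxA E4 /nilp mulmx_block ?mul0mx ?mulmx0 ?add0r ?addr0 mulmxA.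
  by [].
have E6 : nilp b *m D = block_mx 0 (b *m P) 0 0.
  by rewrite /nilp /D /diag2 mulmx_block ?mul0mx ?mulmx0 ?add0r.
have PP (A : 'M[C]_n) : A *m P *m Pi = A by rewrite -mulmxA PPi mulmx1.
have PP' (A : 'M[C]_n) : A *m Pi *m P = A by rewrite -mulmxA PiP mulmx1.
have E7 : (Yp + D *m ctr (nilp e)) *m diag2 Gi Pi *m (Yq + nilp b *m D) =
    block_mx (Gp *m Gi *m Gq + xp *m P *m ctr xq)
      (Gp *m Gi *m ((xqb + b) *m P) + xp *m Pq)
      (P *m ctr (xpb + e) *m Gi *m Gq + Pp *m ctr xq)
      (P *m ctr (xpb + e) *m Gi *m ((xqb + b) *m P) + Pp *m Pi *m Pq).
  rewrite E4 E6 /Yp /Yq /gmet1 /diag2 !add_block_mx !addr0 mulmx_block.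
  rewrite !mulmx0 !addr0 !add0r PP mulmx_block -mulmxDr -ctr_add -mulmxDl.
  by rewrite !mulmxA PP'.
rewrite E7 E1 E2 E3 E4 E5 /Ypq /gmet2 !add_block_mx opp_block_mx add_block_mx !ctr_add.
have E (A B : 'M[C]_n) i j : (A + B) i j = A i j + B i j by rewrite mxE.
have EN (A : 'M[C]_n) i j : (- A) i j = - A i j by rewrite mxE.
congr block_mx; rewrite ?(mulmxDr, mulmxDl, mulmxA);
  generalize_products;
  apply/matrixP => i j; rewrite !(E, EN, mxE); ring.
Qed.

End BlockAlgebra.

(** * Derivatives of the generalized metric *)

Section GeneralizedMetricFlow.
Context {R : realType} {V : normedModType R} {n : nat}.
Local Notation C := R[i].
Variable U : set V.
Hypothesis oU : open U.
Implicit Types d e : fop (R := R) (V := V).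

Lemma fconjK d : fconj (fconj d) = d.
Proof. by case: d => a v b w; rewrite /fconj /= !conjcK. Qed.

Lemma dmx_ctr d m k (A : V -> 'M[C]_(m, k)) x : U x -> mx_smooth U A ->
  dmx d (fun y => ctr (A y)) x = ctr (dmx (fconj d) A x).
Proof.
move=> Ux As; have := dmx_conj d Ux (mx_smooth_tr As).
by rewrite dmx_tr => ->.
Qed.

Lemma mx_smooth_ctr m k (A : V -> 'M[C]_(m, k)) : mx_smooth U A ->
  mx_smooth U (fun y => ctr (A y)).
Proof. by move=> As; exact: (mx_smooth_map oU (mx_smooth_tr As)). Qed.

Lemma mx_smooth_opp m k (A : V -> 'M[C]_(m, k)) :
  mx_smooth U A -> mx_smooth U (fun y => - A y).
Proof.
move=> As; rewrite (_ : (fun y => _) = (fun y => (-1)%:M *m A y)).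
  by apply: mx_smooth_mul => //; exact: mx_smooth_cst.
by apply/funext => y; rewrite mul_scalar_mx scaleN1r.
Qed.

Lemma dmx_opp d m k (A : V -> 'M[C]_(m, k)) x : U x -> mx_smooth U A ->
  dmx d (fun y => - A y) x = - dmx d A x.
Proof.
move=> Ux As; rewrite (_ : (fun y => _) = (fun y => (-1)%:M *m A y)); last first.
  by apply/funext => y; rewrite mul_scalar_mx scaleN1r.
apply: etrans (dmx_mul oU d Ux (mx_smooth_cst U (-1)%:M) As) _.
by rewrite dmx_cst mul0mx add0r mul_scalar_mx scaleN1r.
Qed.

Lemma dmx_mul3 d m k l r (A : V -> 'M[C]_(m, k)) (B : V -> 'M[C]_(k, l))
    (D : V -> 'M[C]_(l, r)) x : U x ->
  mx_smooth U A -> mx_smooth U B -> mx_smooth U D ->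
  dmx d (fun y => A y *m B y *m D y) x =
  dmx d A x *m B x *m D x + A x *m dmx d B x *m D x + A x *m B x *m dmx d D x.
Proof.
move=> Ux As Bs Ds; have ABs := mx_smooth_mul oU As Bs.
by rewrite (dmx_mul oU d Ux ABs Ds) (dmx_mul oU d Ux As Bs) mulmxDl.
Qed.

(** In use [a] is a derivative of the shear [N] and [ctr b] one of its adjoint. As [N] fixes both
    [a] and [b], the product rule for [N D N^*] keeps its outer factors, and it can be iterated. *)
Lemma conj_leibniz m (N D D' a b : 'M[C]_m) : N *m a = a -> N *m b = b ->
  a *m D *m ctr N + N *m D' *m ctr N + N *m D *m ctr b =
  N *m (a *m D + D' + D *m ctr b) *m ctr N.
Proof.
move=> Na Nb; rewrite !mulmxDr !mulmxDl !mulmxA Na; congr (_ + _).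
by rewrite -[in RHS]mulmxA -ctr_mul Nb.
Qed.

Variables (G x : V -> 'M[C]_n) (K : V -> 'M[C]_(n + n)).
Hypothesis Gs : mx_smooth U G.
Hypothesis xs : mx_smooth U x.
Hypothesis Ks : mx_smooth U K.
Hypothesis Gpos : forall y, U y -> posdef (G y).
Hypothesis Kpos : forall y, U y -> posdef (K y).
Hypothesis xT : forall y, U y -> (x y)^T = - x y.

Let P y := (invmx (G y))^T.
Let W y := gmet (G y) (P y) (x y).

Let Gu y : U y -> G y \in unitmx. Proof. by move=> /Gpos/posdef_unit. Qed.

Let Ginvs : mx_smooth U (fun y => invmx (G y)). Proof. exact: mx_smooth_inv. Qed.
Let Ps : mx_smooth U P. Proof. exact: mx_smooth_tr. Qed.

Lemma dmx_unip d y : U y -> dmx d (fun z => unip (x z)) y = nilp (dmx d x y).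
Proof.
move=> Uy; apply: etrans (dmx_block _ _ _ _ _ _) _.
by rewrite !dmx_cst.
Qed.

Lemma mx_smooth_unip : mx_smooth U (fun z => unip (x z)).
Proof. by apply: mx_smooth_block => //; exact: mx_smooth_cst. Qed.

Lemma mx_smooth_diag2 : mx_smooth U (fun z => diag2 (G z) (P z)).
Proof. by apply: mx_smooth_block => //; exact: mx_smooth_cst. Qed.

Lemma mx_smooth_gmet : mx_smooth U W.
Proof.
apply: mx_smooth_mul => //; last exact: (mx_smooth_ctr mx_smooth_unip).
by apply: mx_smooth_mul => //; [exact: mx_smooth_unip|exact: mx_smooth_diag2].
Qed.

Let Y d y := gmet1 (P y) (dmx d G y) (dmx d P y) (dmx d x y) (dmx (fconj d) x y).

Let Ys d : mx_smooth U (Y d).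
Proof.
apply: mx_smooth_block => //.
- exact: mx_smooth_dmx.
- by apply: mx_smooth_mul => //; exact: mx_smooth_dmx.
- by apply: mx_smooth_mul => //; apply: mx_smooth_ctr; exact: mx_smooth_dmx.
- exact: mx_smooth_dmx.
Qed.

Lemma dmx_gmet d y : U y ->
  dmx d W y = unip (x y) *m Y d y *m ctr (unip (x y)).
Proof.
move=> Uy; rewrite /W /gmet.
rewrite (dmx_mul3 d Uy mx_smooth_unip mx_smooth_diag2 (mx_smooth_ctr mx_smooth_unip)).
rewrite (dmx_ctr d Uy mx_smooth_unip) !dmx_unip //.
have -> : dmx d (fun z => diag2 (G z) (P z)) y = diag2 (dmx d G y) (dmx d P y).
  by apply: etrans (dmx_block _ _ _ _ _ _) _; rewrite !dmx_cst.
rewrite (conj_leibniz _ _ (mul_unip_nilp _ _) (mul_unip_nilp _ _)).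
congr (_ *m _ *m _); rewrite ctr_nilp /nilp /diag2 !mulmx_block !mul0mx !mulmx0.
by rewrite !add_block_mx !(addr0, add0r).
Qed.

Lemma dmx_dmx_gmet d e y : U y ->
  dmx d (dmx e W) y = unip (x y) *m
    gmet2 (P y) (dmx d (dmx e G) y) (dmx d (dmx e P) y) (dmx d P y) (dmx e P y)
      (dmx d x y) (dmx (fconj d) x y) (dmx e x y) (dmx (fconj e) x y)
      (dmx d (dmx e x) y) (dmx (fconj d) (dmx (fconj e) x) y) *m ctr (unip (x y)).
Proof.
move=> Uy.
have -> : dmx d (dmx e W) y =
    dmx d (fun y => unip (x y) *m Y e y *m ctr (unip (x y))) y.
  by apply: (dmx_eq oU d Uy) => z; rewrite inE; exact: dmx_gmet.
rewrite (dmx_mul3 d Uy mx_smooth_unip (Ys e) (mx_smooth_ctr mx_smooth_unip)).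
rewrite (dmx_ctr d Uy mx_smooth_unip) !dmx_unip //.
rewrite (conj_leibniz _ _ (mul_unip_nilp _ _) (mul_unip_nilp _ _)) -(gmet2E _ (dmx e G y)).
congr (_ *m (_ + _ + _) *m _).
apply: etrans (dmx_block _ _ _ _ _ _) _; congr block_mx.
  exact: (dmx_mul oU d Uy (mx_smooth_dmx oU e xs) Ps).
rewrite (dmx_mul oU d Uy Ps (mx_smooth_ctr (mx_smooth_dmx oU (fconj e) xs))).
by rewrite (dmx_ctr d Uy (mx_smooth_dmx oU (fconj e) xs)).
Qed.

Lemma dmx_P d y : U y -> dmx d P y = - (P y *m (dmx d G y)^T *m P y).
Proof.
by move=> Uy; rewrite dmx_tr (dmx_inv oU d Uy Gs Gu) linearN /= !trmx_mul mulmxA.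
Qed.

Lemma dmx_dmx_P d e y : U y ->
  dmx d (dmx e P) y = - dmx d P y *m (dmx e G y)^T *m P y
     - P y *m (dmx d (dmx e G) y)^T *m P y - P y *m (dmx e G y)^T *m dmx d P y.
Proof.
move=> Uy.
have -> : dmx d (dmx e P) y = dmx d (fun y => - (P y) *m (dmx e G y)^T *m P y) y.
  by apply: (dmx_eq oU d Uy) => z; rewrite inE => Uz; rewrite dmx_P // !mulNmx.
have PNs : mx_smooth U (fun y => - P y) by exact: mx_smooth_opp.
have Gts := mx_smooth_tr (mx_smooth_dmx oU e Gs).
rewrite (dmx_mul3 d Uy PNs Gts Ps) dmx_tr.
by rewrite (dmx_opp d Uy Ps) !mulNmx.
Qed.

End GeneralizedMetricFlow.

Lemma sum_block_mx (R : realType) n (I : finType) (A1 A2 A3 A4 : I -> 'M[R[i]]_n) :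
  \sum_k block_mx (A1 k) (A2 k) (A3 k) (A4 k) =
  block_mx (\sum_k A1 k) (\sum_k A2 k) (\sum_k A3 k) (\sum_k A4 k).
Proof.
elim: (index_enum I) => [|k r IH]; first by rewrite !big_nil block_mx0.
by rewrite !big_cons IH add_block_mx.
Qed.

Lemma ctr_sum (R : realType) m n (I : finType) (A : I -> 'M[R[i]]_(m, n)) :
  ctr (\sum_k A k) = \sum_k ctr (A k).
Proof.
elim: (index_enum I) => [|k r IH]; first by rewrite !big_nil ctr0.
by rewrite !big_cons ctr_add IH.
Qed.

Lemma trmx_sum (R : realType) m n (I : finType) (A : I -> 'M[R[i]]_(m, n)) :
  (\sum_k A k)^T = \sum_k (A k)^T.
Proof. exact: raddf_sum. Qed.

(** The transposed inverse is the induced metric on the dual bundle, whose curvature is minus the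
    transpose; the quadratic torsion term follows the same rule. *)
Lemma curvature_inv_tr (R : realType) n (A B Q H u F w E : 'M[R[i]]_n) :
  Q *m H = 1%:M ->
  - - (Q *m A *m Q) *m B *m Q - Q *m E *m Q - Q *m B *m - (Q *m A *m Q)
    - - (Q *m A *m Q) *m H *m - (Q *m B *m Q) - Q *m u *m F *m w *m Q =
  - (Q *m (E - B *m Q *m A + u *m F *m w) *m Q).
Proof.
move=> QH; have QHX (X : 'M[R[i]]_n) : X *m Q *m H = X by rewrite -mulmxA QH mulmx1.
have -> : Q *m (E - B *m Q *m A + u *m F *m w) *m Q =
    Q *m E *m Q - Q *m B *m Q *m A *m Q + Q *m u *m F *m w *m Q.
  by rewrite !(mulmxDr, mulmxDl, mulmxN, mulNmx) !mulmxA.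
have -> : - - (Q *m A *m Q) *m B *m Q = Q *m A *m Q *m B *m Q.
  by rewrite opprK.
have -> : Q *m B *m - (Q *m A *m Q) = - (Q *m B *m Q *m A *m Q).
  by rewrite mulmxN !mulmxA.
have -> : - (Q *m A *m Q) *m H *m - (Q *m B *m Q) = Q *m A *m Q *m B *m Q.
  by rewrite !mulNmx mulmxN opprK QHX !mulmxA.
move: (Q *m A *m Q *m B *m Q) (Q *m E *m Q) (Q *m B *m Q *m A *m Q).
move: (Q *m u *m F *m w *m Q) => t1 t2 t3 t4.
by apply/matrixP => i j; rewrite !mxE; ring.
Qed.

(** * The twisted curvature equation for the generalized metric *)

Section TwistedFlow.
Local Opaque dmx.
Context {R : realType} {V : normedModType R} {n : nat}.
Local Notation C := R[i].
Variables (U : set V) (oU : open U) (G x : V -> 'M[C]_n).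
Hypothesis Gs : mx_smooth U G.
Hypothesis xs : mx_smooth U x.
Hypothesis Gpos : forall y, U y -> posdef (G y).

Local Notation P := (fun y => (invmx (G y))^T).
Local Notation W := (fun y => gmet (G y) (invmx (G y))^T (x y)).

Variables (Dp : 'I_n -> fop (R := R) (V := V)) (Dt : fop (R := R) (V := V)).
Local Notation Dq q := (fconj (Dp q)).
Variables (y : V) (Uy : U y) (b : 'I_n -> 'M[C]_n) (b' : 'I_n -> 'I_n -> 'M[C]_n).

(* In the application [b q] is -i times the torsion of the reference metric, and
   then [gt q] is -i times the torsion of the evolving one. *)
Let gt q := dmx (Dq q) x y + b q.
Let gt' p q := dmx (Dp p) (dmx (Dq q) x) y + b' p q.
Let Gi := invmx (G y).

(** Formally these three are derivatives of [N W N^*], with [N] the shear by a potential that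
    vanishes at [y], has derivative 0 along [Dp p] and [b q] along [Dq q], and second derivatives
    [b' p q]. They are written out because the twist is not assumed to have a potential. *)
Definition twist_W1 p := dmx (Dp p) W y + W y *m ctr (nilp (b p)).
Definition twist_W1b q := dmx (Dq q) W y + nilp (b q) *m W y.
Definition twist_W2 p q := dmx (Dp p) (dmx (Dq q) W) y + nilp (b q) *m dmx (Dp p) W y
  + nilp (b' p q) *m W y + dmx (Dq q) W y *m ctr (nilp (b p))
  + W y *m ctr (nilp (b' q p)) + nilp (b q) *m W y *m ctr (nilp (b p)).

Let Gy : posdef (G y). Proof. exact: Gpos. Qed.
Let uG : G y \in unitmx. Proof. exact: posdef_unit. Qed.

Lemma hermG z : U z -> ctr (G z) = G z.
Proof. by move=> /Gpos[/hermitianP]. Qed.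

Lemma posdef_P z : U z -> posdef (P z).
Proof. by move=> Uz; apply: posdef_tr; apply: posdef_inv; exact: Gpos. Qed.

Lemma posdef_gmet z : U z -> posdef (W z).
Proof.
move=> Uz; apply: posdef_congr.
  by rewrite unitmxE det_ublock !det1 mulr1 unitr1.
by apply: posdef_block; [exact: Gpos|exact: posdef_P].
Qed.

Let uW : W y \in unitmx. Proof. by apply: posdef_unit; exact: posdef_gmet. Qed.

Let N := unip (x y).

Lemma conj_inv_gmet : ctr N *m invmx (W y) *m N = diag2 Gi (G y)^T.
Proof.
have DDi : diag2 Gi (G y)^T *m diag2 (G y) (P y) = 1%:M.
  rewrite diag2_mul mulVmx // -trmx_mul mulVmx // trmx1.
  by rewrite /diag2 -scalar_mx_block.
have E : diag2 (G y) (P y) *m (ctr N *m invmx (W y) *m N) = 1%:M.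
  have DE : diag2 (G y) (P y) = unip (- x y) *m W y *m ctr (unip (- x y)).
    by rewrite /gmet !mulmxA unipNK mul1mx -mulmxA -ctr_mul unipNK ctr1 mulmx1.
  have cc : ctr (unip (- x y)) *m ctr N = 1%:M by rewrite -ctr_mul unipK ctr1.
  rewrite DE; move: uW (ctr (unip (- x y))) cc; move: (W y) => w uw c cc.
  by rewrite !mulmxA -[_ *m c *m _]mulmxA cc mulmx1 mulmxK // unipNK.
by rewrite -[LHS]mul1mx -DDi -mulmxA E mulmx1.
Qed.

Let Zpq p q := block_mx
  (dmx (Dp p) (dmx (Dq q) G) y - dmx (Dp p) G y *m Gi *m dmx (Dq q) G y
     + gt q *m P y *m ctr (gt p))
  (gt' p q *m P y + gt q *m dmx (Dp p) P y - dmx (Dp p) G y *m Gi *m gt q *m P y)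
  (P y *m ctr (gt' q p) + dmx (Dq q) P y *m ctr (gt p)
     - P y *m ctr (gt p) *m Gi *m dmx (Dq q) G y)
  (dmx (Dp p) (dmx (Dq q) P) y - dmx (Dp p) P y *m (G y)^T *m dmx (Dq q) P y
     - P y *m ctr (gt p) *m Gi *m gt q *m P y).

Let Y1 p := gmet1 (P y) (dmx (Dp p) G y) (dmx (Dp p) P y) (dmx (Dp p) x y)
  (dmx (Dq p) x y).
Let Y1b q := gmet1 (P y) (dmx (Dq q) G y) (dmx (Dq q) P y) (dmx (Dq q) x y)
  (dmx (Dp q) x y).
Let Y2 p q := gmet2 (P y) (dmx (Dp p) (dmx (Dq q) G) y)
   (dmx (Dp p) (dmx (Dq q) P) y) (dmx (Dp p) P y) (dmx (Dq q) P y)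
   (dmx (Dp p) x y) (dmx (Dq p) x y) (dmx (Dq q) x y) (dmx (Dp q) x y)
   (dmx (Dp p) (dmx (Dq q) x) y) (dmx (Dp q) (dmx (Dq p) x) y).
Let D := diag2 (G y) (P y).

Lemma twist_block p q :
  Y2 p q + nilp (b q) *m Y1 p + nilp (b' p q) *m D + Y1b q *m ctr (nilp (b p))
    + D *m ctr (nilp (b' q p)) + nilp (b q) *m D *m ctr (nilp (b p))
    - (Y1 p + D *m ctr (nilp (b p))) *m diag2 Gi (G y)^T *m (Y1b q + nilp (b q) *m D) =
  Zpq p q.
Proof.
have PG : P y *m (G y)^T = 1%:M by rewrite -trmx_mul mulmxV // trmx1.
have GP : (G y)^T *m P y = 1%:M by rewrite -trmx_mul mulVmx // trmx1.
exact: (gmet_curvature (G y) Gi (dmx (Dp p) G y) (dmx (Dq q) G y)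
  (dmx (Dp p) (dmx (Dq q) G) y) (dmx (Dp p) P y) (dmx (Dq q) P y)
  (dmx (Dp p) (dmx (Dq q) P) y) (dmx (Dp p) x y) (dmx (Dq p) x y)
  (dmx (Dp q) x y) (dmx (Dq q) x y) (dmx (Dp p) (dmx (Dq q) x) y)
  (dmx (Dp q) (dmx (Dq p) x) y) (b q) (b' p q) (b p) (b' q p) PG GP).
Qed.

Let W2E p q : dmx (Dp p) (dmx (Dq q) W) y = N *m Y2 p q *m ctr N.
Proof.
apply: etrans (dmx_dmx_gmet oU Gs xs Gpos (Dp p) (Dq q) Uy) _.
by rewrite fconjK (dmx_sym oU (Dq p) (Dp q) Uy xs).
Qed.

Let W1E p : dmx (Dp p) W y = N *m Y1 p *m ctr N.
Proof. exact: (dmx_gmet oU Gs xs Gpos (Dp p) Uy). Qed.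

Let W1bE q : dmx (Dq q) W y = N *m Y1b q *m ctr N.
Proof.
by apply: etrans (dmx_gmet oU Gs xs Gpos (Dq q) Uy) _; rewrite fconjK.
Qed.

(** Twists are absorbed by the shear, so every twisted derivative again has the form [N A N^*], and
    the [N^* W^-1 N] in the middle is the inverse of the block-diagonal [D]. *)
Lemma twist_curvatureE p q :
  twist_W2 p q - twist_W1 p *m invmx (W y) *m twist_W1b q =
  N *m Zpq p q *m ctr N.
Proof.
rewrite -twist_block -conj_inv_gmet /twist_W2 /twist_W1 /twist_W1b W2E W1E W1bE.
have WE : W y = N *m D *m ctr N by [].
move: (Y2 p q) (Y1 p) (Y1b q) => y2 y1 y1b.
move: (invmx (W y)) => Wi; rewrite WE; move: D => d.
have Nn z : N *m nilp z = nilp z := mul_unip_nilp _ _.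
have nN z : nilp z *m N = nilp z := mul_nilp_unip _ _.
have Nnc z : ctr (nilp z) *m ctr N = ctr (nilp z) by rewrite -ctr_mul Nn.
have cNn z : ctr N *m ctr (nilp z) = ctr (nilp z) by rewrite -ctr_mul nN.
have L z (A : 'M[C]_(n + n)) : nilp z *m (N *m A *m ctr N) = N *m (nilp z *m A) *m ctr N.
  by rewrite !mulmxA nN Nn.
have Rr z (A : 'M[C]_(n + n)) :
    N *m A *m ctr N *m ctr (nilp z) = N *m (A *m ctr (nilp z)) *m ctr N.
  by rewrite -!mulmxA cNn Nnc.
have DN (A B : 'M[C]_(n + n)) :
    N *m A *m ctr N + N *m B *m ctr N = N *m (A + B) *m ctr N.
  by rewrite -mulmxDl -mulmxDr.
have BN (A B : 'M[C]_(n + n)) :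
    N *m A *m ctr N - N *m B *m ctr N = N *m (A - B) *m ctr N.
  by rewrite -mulmxBl -mulmxBr.
have MN (A B : 'M[C]_(n + n)) : N *m A *m ctr N *m Wi *m (N *m B *m ctr N) =
    N *m (A *m (ctr N *m Wi *m N) *m B) *m ctr N.
  by rewrite !mulmxA.
by rewrite !(L, Rr, DN) MN BN.
Qed.

Hypothesis Dt_real : fconj Dt = Dt.
Hypothesis gt_skew : forall q, (gt q)^T = - gt q.
Let c p q := Gi q p.
Hypothesis flow_G : dmx Dt G y = \sum_p \sum_q c p q *:
  (dmx (Dp p) (dmx (Dq q) G) y - dmx (Dp p) G y *m Gi *m dmx (Dq q) G y
     + gt q *m P y *m ctr (gt p)).
Hypothesis flow_x : dmx Dt x y = \sum_p \sum_q c p q *: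
  (gt' p q - gt q *m P y *m (dmx (Dp p) G y)^T - dmx (Dp p) G y *m Gi *m gt q).

Let Z11 p q := dmx (Dp p) (dmx (Dq q) G) y - dmx (Dp p) G y *m Gi *m dmx (Dq q) G y
     + gt q *m P y *m ctr (gt p).
Let Z12 p q :=
  gt' p q *m P y + gt q *m dmx (Dp p) P y - dmx (Dp p) G y *m Gi *m gt q *m P y.

Let PG : P y *m (G y)^T = 1%:M.
Proof. by rewrite -trmx_mul mulmxV // trmx1. Qed.

Let ctrGi : ctr Gi = Gi.
Proof. by rewrite ctr_inv (hermG Uy). Qed.

Let ctrP : ctr (P y) = P y.
Proof. by rewrite ctr_tr -/Gi ctrGi. Qed.

Let dG_ctr d : ctr (dmx d G y) = dmx (fconj d) G y.
Proof.
rewrite -{1}[d]fconjK -(dmx_ctr (fconj d) Uy Gs).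
by apply: (dmx_eq oU _ Uy) => z; rewrite inE => /hermG.
Qed.

Let Z21E p q : P y *m ctr (gt' q p) + dmx (Dq q) P y *m ctr (gt p)
     - P y *m ctr (gt p) *m Gi *m dmx (Dq q) G y = ctr (Z12 q p).
Proof.
have dP d := dmx_P oU Gs Gpos d Uy.
have dPc : ctr (dmx (Dp q) P y) = dmx (Dq q) P y.
  by rewrite !dP ctr_opp !ctr_mul ctrP ctr_tr dG_ctr mulmxA.
rewrite /Z12; move: (gt' q p) (gt p) => u w.
rewrite ctr_add ctr_opp ctr_add !ctr_mul ctrP ctrGi dG_ctr dPc.
by rewrite !mulmxA.
Qed.

Let Z22E p q : dmx (Dp p) (dmx (Dq q) P) y - dmx (Dp p) P y *m (G y)^T *m dmx (Dq q) P y
     - P y *m ctr (gt p) *m Gi *m gt q *m P y = - (P y *m (Z11 p q)^T *m P y).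
Proof.
rewrite (dmx_dmx_P oU Gs Gpos _ _ Uy) !(dmx_P oU Gs Gpos _ Uy).
have -> : (Z11 p q)^T = (dmx (Dp p) (dmx (Dq q) G) y)^T
    - (dmx (Dq q) G y)^T *m P y *m (dmx (Dp p) G y)^T + ctr (gt p) *m Gi *m gt q.
  rewrite /Z11; move: (gt_skew p) (gt_skew q); move: (gt p) (gt q) => u w uT wT.
  rewrite linearD linearB /= !trmx_mul trmxK wT -ctr_tr uT ctr_opp.
  by rewrite mulmxN mulNmx mulmxN opprK !mulmxA.
exact: curvature_inv_tr.
Qed.

(** Compare blocks after removing the shear. The upper diagonal block is the flow of [G], the upper
    off-diagonal one is the flow of [x] times [P]. Its mirror is the adjoint because [c] is
    Hermitian, and the lower diagonal block is dual to the upper one because [gt] is skew. *)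
Lemma twisted_flow : dmx Dt W y =
  \sum_p \sum_q c p q *: (twist_W2 p q - twist_W1 p *m invmx (W y) *m twist_W1b q).
Proof.
have -> : \sum_p \sum_q c p q *:
    (twist_W2 p q - twist_W1 p *m invmx (W y) *m twist_W1b q) =
    N *m (\sum_p \sum_q c p q *: Zpq p q) *m ctr N.
  rewrite mulmx_sumr mulmx_suml; apply: eq_bigr => p _.
  rewrite mulmx_sumr mulmx_suml; apply: eq_bigr => q _.
  by rewrite twist_curvatureE -scalemxAr -scalemxAl.
rewrite (dmx_gmet oU Gs xs Gpos Dt Uy) Dt_real; congr (_ *m _ *m _).
have -> : \sum_p \sum_q c p q *: Zpq p q = block_mx
    (\sum_p \sum_q c p q *: Z11 p q) (\sum_p \sum_q c p q *: Z12 p q)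
    (\sum_p \sum_q c p q *: ctr (Z12 q p))
    (\sum_p \sum_q c p q *: - (P y *m (Z11 p q)^T *m P y)).
  rewrite -!sum_block_mx; apply: eq_bigr => p _.
  rewrite -!sum_block_mx; apply: eq_bigr => q _.
  apply: etrans (congr1 (fun X => c p q *: X) (_ : _ = block_mx (Z11 p q) (Z12 p q)
    (ctr (Z12 q p)) (- (P y *m (Z11 p q)^T *m P y)))) (scale_block_mx _ _ _ _ _).
  exact: (congr2 (block_mx (Z11 p q) (Z12 p q)) (Z21E p q) (Z22E p q)).
rewrite -flow_G /gmet1; congr block_mx.
- rewrite flow_x mulmx_suml; apply: eq_bigr => p _.
  rewrite mulmx_suml; apply: eq_bigr => q _; rewrite -scalemxAl; congr (_ *: _).
  rewrite /Z12 (dmx_P oU Gs Gpos _ Uy) !mulmxBl mulmxN !mulmxA.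
  by [].
- rewrite -[P y in LHS]ctrP -ctr_mul flow_x mulmx_suml ctr_sum [RHS]exchange_big.
  apply: eq_bigr => p _ /=; rewrite mulmx_suml ctr_sum; apply: eq_bigr => q _.
  have cc : (c p q)^*%C = c q p by rewrite /c -[in RHS]ctrGi ctrE.
  rewrite -scalemxAl ctr_scale; congr (_ *: ctr _); first exact: cc.
  rewrite /Z12 (dmx_P oU Gs Gpos _ Uy) !mulmxBl mulmxN !mulmxA.
  by [].
- rewrite (dmx_P oU Gs Gpos _ Uy) flow_G trmx_sum mulmx_sumr mulmx_suml -sumrN.
  apply: eq_bigr => p _; rewrite trmx_sum mulmx_sumr mulmx_suml -sumrN.
  apply: eq_bigr => q _; rewrite linearZ /= -scalemxAr -scalemxAl -scalerN.
  by [].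
Qed.

End TwistedFlow.

Lemma mxtraceD2 (R : realType) n (A B D E : 'M[R[i]]_n) :
  \tr (A + B) + \tr (D + E) = \tr A + \tr D + \tr B + \tr E.
Proof. by rewrite !mxtraceD addrACA addrA. Qed.

(** * The Bochner inequality for tr(K W) *)

Section Bochner.
Local Opaque dmx gmet.
Context {R : realType} {V : normedModType R} {n : nat}.
Local Notation C := R[i].
Variables (U : set V) (oU : open U) (G x : V -> 'M[C]_n) (K : V -> 'M[C]_(n + n)).
Hypothesis Gs : mx_smooth U G.
Hypothesis xs : mx_smooth U x.
Hypothesis Ks : mx_smooth U K.
Hypothesis Gpos : forall y, U y -> posdef (G y).
Hypothesis Kpos : forall y, U y -> posdef (K y).

Local Notation P := (fun y => (invmx (G y))^T).
Local Notation W := (fun y => gmet (G y) (invmx (G y))^T (x y)).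
Local Notation f := (fun y => \tr (K y *m gmet (G y) (invmx (G y))^T (x y))).

Variables (Dp : 'I_n -> fop (R := R) (V := V)) (Dt : fop (R := R) (V := V)).
Local Notation Dq q := (fconj (Dp q)).
Variables (y : V) (Uy : U y) (b : 'I_n -> 'M[C]_n) (b' : 'I_n -> 'I_n -> 'M[C]_n).

(** The twist dual to that of [W]: opposite sign and opposite side. Consequently [curv_err] below,
    the twisted curvature term of [K], does not involve [W] at all. *)
Definition twist_K1 p := dmx (Dp p) K y - ctr (nilp (b p)) *m K y.
Definition twist_K1b q := dmx (Dq q) K y - K y *m nilp (b q).
Definition twist_K2 p q := dmx (Dp p) (dmx (Dq q) K) y
  - dmx (Dp p) K y *m nilp (b q) - K y *m nilp (b' p q)
  - ctr (nilp (b p)) *m dmx (Dq q) K y - ctr (nilp (b' q p)) *m K y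
  + ctr (nilp (b p)) *m K y *m nilp (b q).
Definition curv_err p q :=
  twist_K2 p q - twist_K1b q *m invmx (K y) *m twist_K1 p.

Let Ws : mx_smooth U W. Proof. exact: mx_smooth_gmet. Qed.
Let KWs : mx_smooth U (fun z => K z *m W z). Proof. exact: mx_smooth_mul. Qed.
Let Wpos z : U z -> posdef (W z). Proof. exact: (posdef_gmet x Gpos). Qed.

Lemma fapp_fapp_trace d e : fapp d (fapp e f) y =
  \tr (dmx d (dmx e K) y *m W y) + \tr (dmx d K y *m dmx e W y)
  + \tr (dmx e K y *m dmx d W y) + \tr (K y *m dmx d (dmx e W) y).
Proof.
have E1 z : U z -> fapp e f z = \tr (dmx e K z *m W z + K z *m dmx e W z).
  move=> Uz; apply: etrans (fapp_trace oU e Uz KWs) _.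
  by rewrite (dmx_mul oU e Uz Ks Ws).
have Kes := mx_smooth_dmx oU e Ks; have Wes := mx_smooth_dmx oU e Ws.
have s1 : mx_smooth U (fun z => dmx e K z *m W z) by exact: mx_smooth_mul.
have s2 : mx_smooth U (fun z => K z *m dmx e W z) by exact: mx_smooth_mul.
have s3 : mx_smooth U (fun z => dmx e K z *m W z + K z *m dmx e W z).
  exact: mx_smooth_add.
have -> : fapp d (fapp e f) y =
    fapp d (fun z => \tr (dmx e K z *m W z + K z *m dmx e W z)) y.
  by apply: (fapp_eq oU d Uy) => z; rewrite inE => /E1.
apply: etrans (fapp_trace oU d Uy s3) _.
rewrite (dmx_add d Uy s1 s2) mxtraceD.
have e1 := congr1 mxtrace (dmx_mul oU d Uy Kes Ws).
have e2 := congr1 mxtrace (dmx_mul oU d Uy Ks Wes).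
exact: etrans (congr2 +%R e1 e2) (mxtraceD2 _ _ _ _).
Qed.

Let Gi := invmx (G y).
Let Ki := invmx (K y).
Let Wi := invmx (W y).
Let c p q := Gi q p.
Let X p := twist_W1 G x Dp y b p + Ki *m twist_K1 p *m W y.

Hypothesis Dt_real : fconj Dt = Dt.
Hypothesis Kt0 : dmx Dt K y = 0.
Hypothesis flow : dmx Dt W y = \sum_p \sum_q c p q *:
  (twist_W2 G x Dp y b b' p q - twist_W1 G x Dp y b p *m Wi *m twist_W1b G x Dp y b q).

Let ctr_dmx (A : V -> 'M[C]_(n + n)) d : mx_smooth U A ->
  (forall z, U z -> ctr (A z) = A z) -> ctr (dmx d A y) = dmx (fconj d) A y.
Proof.
move=> As Ah; rewrite -{1}[d]fconjK -(dmx_ctr (fconj d) Uy As).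
by apply: (dmx_eq oU _ Uy) => z; rewrite inE => /Ah.
Qed.

Let hermK z : U z -> ctr (K z) = K z. Proof. by move=> /Kpos[/hermitianP]. Qed.
Let hermW z : U z -> ctr (W z) = W z. Proof. by move=> /Wpos[/hermitianP]. Qed.
Let uK : K y \in unitmx. Proof. by apply: posdef_unit; exact: Kpos. Qed.
Let uW : W y \in unitmx. Proof. by apply: posdef_unit; exact: Wpos. Qed.

Let ctrX q : ctr (X q) = twist_W1b G x Dp y b q + W y *m twist_K1b q *m Ki.
Proof.
have cKi : ctr Ki = Ki by rewrite ctr_inv hermK.
have e1 : ctr (twist_W1 G x Dp y b q) = twist_W1b G x Dp y b q.
  apply: etrans (ctr_add _ _) _; apply: (congr2 +%R (ctr_dmx (Dp q) Ws hermW)).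
  apply: etrans (ctr_mul _ _) _.
  exact: (congr2 (@mulmx _ _ _ _) (ctrK (nilp (b q))) (hermW Uy)).
have e2 : ctr (twist_K1 q) = twist_K1b q.
  apply: etrans (ctr_add _ _) _; apply: (congr2 +%R (ctr_dmx (Dp q) Ks hermK)).
  rewrite ctr_opp ctr_mul ctrK; congr (- (_ *m _)); exact: hermK.
apply: etrans (ctr_add _ _) _; rewrite e1; congr (_ + _).
apply: etrans (ctr_mul (Ki *m twist_K1 q) _) _; rewrite -[RHS]mulmxA.
apply: (congr2 (@mulmx _ _ _ _) (hermW Uy)).
by apply: etrans (ctr_mul Ki _) _; rewrite e2 cKi.
Qed.

(** Of the three traces in [twisted_trace_second_derivative], the curvature of [W] becomes the time
    derivative by the flow equation, [K] having no time derivative; the others are the square and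
    the error. *)
Lemma bochner : \sum_p \sum_q c p q * fapp (Dp p) (fapp (Dq q) f) y =
  fapp Dt f y + \sum_p \sum_q c p q * \tr (K y *m X p *m Wi *m ctr (X q))
  + \sum_p \sum_q c p q * \tr (curv_err p q *m W y).
Proof.
have -> : fapp Dt f y = \sum_p \sum_q c p q * \tr (K y *m
   (twist_W2 G x Dp y b b' p q - twist_W1 G x Dp y b p *m Wi *m twist_W1b G x Dp y b q)).
  apply: etrans (fapp_trace oU Dt Uy KWs) _.
  rewrite (dmx_mul oU Dt Uy Ks Ws) Kt0 mul0mx add0r flow mulmx_sumr raddf_sum.
  apply: eq_bigr => p _; rewrite mulmx_sumr raddf_sum; apply: eq_bigr => q _.
  by rewrite -scalemxAr; exact: mxtraceZ.
rewrite -!big_split /=; apply: eq_bigr => p _.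
rewrite -!big_split /=; apply: eq_bigr => q _.
rewrite -!mulrDr; congr (_ * _); rewrite fapp_fapp_trace ctrX.
exact: (twisted_trace_second_derivative _ _ _ _ _ _ (nilp (b q)) (ctr (nilp (b p)))
  (nilp (b' p q)) (ctr (nilp (b' q p))) (mulmxV uK) (mulVmx uK) (mulmxV uW) (mulVmx uW)).
Qed.

(** The square is dropped. In the error, entries of the inverse metric are bounded by its trace, and
    entries of [W] by tr W, hence by tr(K^-1) tr(K W); this keeps the error linear in [f]. *)
Lemma trace_gmet_evolution : complex.Re (fapp Dt f y) <=
  complex.Re (\sum_p \sum_q c p q * fapp (Dp p) (fapp (Dq q) f) y) +
  complex.Re (\tr Gi * (\sum_p \sum_q \sum_i \sum_j `|curv_err p q i j|) *
    (\tr Ki * f y)).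
Proof.
have pGi : posdef Gi by apply: posdef_inv; exact: Gpos.
have pWi : posdef Wi by apply: posdef_inv; exact: Wpos.
have := sum_trace_square_ge0 X pGi (Kpos Uy) pWi.
have := bochner; rewrite -/(fapp Dt f y).
set S := \sum_p \sum_q c p q * \tr (curv_err p q *m W y).
set B := \tr Gi * _ * _ => E S1.
have SB : `|S| <= B.
  rewrite /S /B mulrAC mulr_sumr (le_trans (ler_norm_sum _ _ _)) //.
  apply: ler_sum => p _; rewrite mulr_sumr (le_trans (ler_norm_sum _ _ _)) //.
  apply: ler_sum => q _; rewrite normrM -mulrA.
  apply: ler_pM => //; first exact: (posdef_entry_le q p pGi).
  rewrite mulr_sumr (le_trans (ler_norm_sum _ _ _)) //; apply: ler_sum => i _.
  rewrite mxE mulr_sumr (le_trans (ler_norm_sum _ _ _)) //; apply: ler_sum => j _.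
  rewrite normrM mulrC ler_wpM2r //.
  apply: le_trans (posdef_entry_le j i (Wpos Uy)) _.
  exact: (trace_le_mul (Kpos Uy) (Wpos Uy)).
have ReS : - complex.Re S <= complex.Re B.
  have := le_trans (normc_ge_Re S) SB; rewrite lecE => /andP[_] /=.
  by move=> /(le_trans _); apply; rewrite -normrN ler_norm.
move: S1; rewrite lecE => /andP[_] /=; rewrite E !ReD => S1.
by rewrite -addrA -addrA lerDl addr_ge0 // addrC -[complex.Re S]opprK subr_ge0.
Qed.

End Bochner.

(** * Wirtinger calculus on space-time *)

Lemma Re_real_comb (R : realType) (a b : R) (v w : R[i]) :
  complex.Re (a%:C * v + b%:C * w) = a * complex.Re v + b * complex.Re w.
Proof. by case: v w => v1 v2 [w1 w2] /=; rewrite !mul0r !subr0. Qed.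

Lemma Im_real_comb (R : realType) (a b : R) (v w : R[i]) :
  complex.Im (a%:C * v + b%:C * w) = a * complex.Im v + b * complex.Im w.
Proof. by case: v w => v1 v2 [w1 w2] /=; rewrite !mul0r !addr0. Qed.

Lemma Re_sum (R : realType) (I : Type) (r : seq I) (F : I -> R[i]) :
  complex.Re (\sum_(i <- r) F i) = \sum_(i <- r) complex.Re (F i).
Proof. by elim: r => [|i r IH]; rewrite ?big_nil // !big_cons ReD IH. Qed.

Lemma Im_sum (R : realType) (I : Type) (r : seq I) (F : I -> R[i]) :
  complex.Im (\sum_(i <- r) F i) = \sum_(i <- r) complex.Im (F i).
Proof. by elim: r => [|i r IH]; rewrite ?big_nil // !big_cons ImD IH. Qed.

Section CoordinateSpace.
Context {R : realType} {n : nat}.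
Local Notation C := R[i].
Local Notation Z := (Cn R n).
Implicit Types (U : set Z) (f h : Z -> C) (z : Z).

Definition ex (j : 'I_n) : Z := (delta_mx 0 j, 0).
Definition ey (j : 'I_n) : Z := (0, delta_mx 0 j).
Definition dzop j : fop (R := R) (V := Z) := Fop 2^-1 (ex j) (- (2^-1 * 'i%R)) (ey j).

Lemma dzE j f z : dz j f z = fapp (dzop j) f z.
Proof.
by rewrite /dz mulrBr mulrA -mulNr.
Qed.

Lemma conjc_inv2 : ((2^-1 : C)^*)%C = 2^-1.
Proof. by rewrite conjc_inv conjc_nat. Qed.

Lemma fconj_dzop j : fconj (dzop j) = Fop 2^-1 (ex j) (2^-1 * 'i%R) (ey j).
Proof.
rewrite /fconj /dzop; congr Fop; first exact: conjc_inv2.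
have ci : conjc ('i%R : C) = - 'i%R by exact: conjCi.
apply: (@etrans _ _ (- (conjc 2^-1 * conjc ('i%R : C)))).
  by rewrite rmorphN rmorphM.
by rewrite ci conjc_inv2 mulrN opprK.
Qed.

Lemma dzbE j f z : dzb j f z = fapp (fconj (dzop j)) f z.
Proof. by rewrite fconj_dzop /dzb mulrDr mulrA. Qed.

Lemma dzEf j f : dz j f = fapp (dzop j) f.
Proof. by apply/funext => z; exact: dzE. Qed.

Lemma row_sum_delta (a : 'rV[R]_n) : a = \sum_k a 0 k *: delta_mx 0 k.
Proof. exact: row_sum_delta. Qed.

(** Merges the n directions in x and the n directions in y into one family, the form in which
    [C1_chain] takes its directions. *)
Definition isplit (T : Type) (g h : 'I_n -> T) (k : 'I_(n + n)) : T :=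
  match fintype.split k with inl i => g i | inr i => h i end.

Lemma isplitl (T : Type) (g h : 'I_n -> T) k : isplit g h (lshift n k) = g k.
Proof. by rewrite /isplit -[lshift n k]/(unsplit (inl k)) unsplitK. Qed.

Lemma isplitr (T : Type) (g h : 'I_n -> T) k : isplit g h (rshift n k) = h k.
Proof. by rewrite /isplit -[rshift n k]/(unsplit (inr k)) unsplitK. Qed.

Lemma sum_isplit (T : nmodType) (g : 'I_(n + n) -> T) :
  \sum_k g k = \sum_k g (lshift n k) + \sum_k g (rshift n k).
Proof. exact: big_split_ord. Qed.

Lemma CnE (z : Z) : z = \sum_k z.1 0 k *: ex k + \sum_k z.2 0 k *: ey k.
Proof.
have E1 : \sum_k z.1 0 k *: ex k = (z.1, 0).
  rewrite [in RHS](row_sum_delta z.1).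
  elim: (index_enum _) => [|k r IH]; first by rewrite !big_nil.
  rewrite !big_cons IH; congr (_, _); by rewrite /= scaler0 addr0.
have E2 : \sum_k z.2 0 k *: ey k = (0, z.2).
  rewrite [in RHS](row_sum_delta z.2).
  elim: (index_enum _) => [|k r IH]; first by rewrite !big_nil.
  rewrite !big_cons IH; congr (_, _); by rewrite /= scaler0 addr0.
rewrite E1 E2; case: z {E1 E2} => a b /=; congr (_, _); by rewrite /= ?addr0 ?add0r.
Qed.

Lemma cD_sum_dir U f z (v : Z) : open U -> smooth_on U f -> U z ->
  cD v f z = \sum_k ((v.1 0 k)%:C * cD (ex k) f z + (v.2 0 k)%:C * cD (ey k) f z).
Proof.
move=> oU fs Uz; have [f1 f2] := fs 1%N.
pose a := isplit (fun k => v.1 0 k) (fun k => v.2 0 k).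
pose dir := isplit ex ey.
have vE : v = \sum_k a k *: dir k.
  rewrite sum_isplit [LHS]CnE; congr (_ + _); apply: eq_bigr => k _.
    by rewrite /a /dir !isplitl.
  by rewrite /a /dir !isplitr.
have key (g : Z -> R) : Ck 1 U g -> 'D_v g z =
    \sum_k (v.1 0 k * 'D_(ex k) g z + v.2 0 k * 'D_(ey k) g z).
  move=> gC; rewrite [in LHS]vE (derive_sum_dir dir a oU gC Uz) sum_isplit big_split.
  apply: (congr2 +%R); apply: eq_bigr => k _; rewrite /a /dir.
    by rewrite !isplitl.
  by rewrite !isplitr.
apply: ReIm_eq.
  apply: etrans (key _ f1) _; rewrite Re_sum; apply: eq_bigr => k _.
  exact: (esym (Re_real_comb _ _ (cD (ex k) f z) (cD (ey k) f z))).
apply: etrans (key _ f2) _; rewrite Im_sum; apply: eq_bigr => k _.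
exact: (esym (Im_real_comb _ _ (cD (ex k) f z) (cD (ey k) f z))).
Qed.

Lemma imag_sqr : 'i%R * 'i%R = -1 :> C.
Proof. by rewrite -expr2 sqrCi. Qed.

Lemma complex_parts (w : C) : w = (complex.Re w)%:C + 'i%R * (complex.Im w)%:C.
Proof. by rewrite [LHS]complexE. Qed.

Section direction.
Variables (U : set Z) (oU : open U) (v : 'I_n -> C).
(** [X] is [v] read as a real tangent vector and [Y] is its image under the complex structure. *)
Let X : Z := (\row_k complex.Re (v k), \row_k complex.Im (v k)).
Let Y : Z := (\row_k - complex.Im (v k), \row_k complex.Re (v k)).

Lemma sum_dz_dir f z : smooth_on U f -> U z ->
  \sum_p v p * fapp (dzop p) f z = 2^-1 * (cD X f z - 'i%R * cD Y f z).
Proof.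
move=> fs Uz; rewrite (cD_sum_dir X oU fs Uz) (cD_sum_dir Y oU fs Uz).
rewrite mulr_sumr -sumrB mulr_sumr; apply: eq_bigr => p _.
rewrite /fapp [fop_a _]/= [fop_b _]/= [fop_v _]/= [fop_w _]/= !mxE.
rewrite {1}(complex_parts (v p)).
move: (complex.Re (v p)) (complex.Im (v p)) (cD (ex p) f z) (cD (ey p) f z) => a b s t.
rewrite -[(- b)%:C]/(real_complex R (- b)) rmorphN /=.
move: (a%:C) (b%:C) => {}a {}b.
have -> : (a + 'i%R * b) * (2^-1 * s + - (2^-1 * 'i%R) * t) =
    2^-1 * (a * s - 'i%R * a * t + 'i%R * b * s - ('i%R * 'i%R) * b * t) by ring.
by rewrite imag_sqr; ring.
Qed.

Lemma sum_dzb_dir f z : smooth_on U f -> U z ->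
  \sum_p (v p)^*%C * fapp (fconj (dzop p)) f z = 2^-1 * (cD X f z + 'i%R * cD Y f z).
Proof.
move=> fs Uz; rewrite (cD_sum_dir X oU fs Uz) (cD_sum_dir Y oU fs Uz).
rewrite mulr_sumr -big_split mulr_sumr; apply: eq_bigr => p _.
rewrite fconj_dzop /fapp [fop_a _]/= [fop_b _]/= [fop_v _]/= [fop_w _]/= !mxE.
rewrite (_ : (v p)^*%C = (complex.Re (v p))%:C - 'i%R * (complex.Im (v p))%:C); last first.
  case: (v p) => a b; apply: ReIm_eq => /=; by rewrite ?mul0r ?mul1r ?subr0 ?addr0 ?add0r ?oppr0 ?addr0 ?sub0r.
move: (complex.Re (v p)) (complex.Im (v p)) (cD (ex p) f z) (cD (ey p) f z) => a b s t.
rewrite -[(- b)%:C]/(real_complex R (- b)) rmorphN /=.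
move: (a%:C) (b%:C) => {}a {}b.
have -> : (a - 'i%R * b) * (2^-1 * s + (2^-1 * 'i%R) * t) =
    2^-1 * (a * s + 'i%R * a * t - 'i%R * b * s - ('i%R * 'i%R) * b * t) by ring.
by rewrite imag_sqr; ring.
Qed.

(** The mixed terms in [X] and [Y] cancel by symmetry of second derivatives, which leaves a quarter
    of the Laplacian on the complex line of [v]. *)
Lemma hessian_dir f z : smooth_on U f -> U z ->
  \sum_p \sum_q v p * (v q)^*%C * fapp (dzop p) (fapp (fconj (dzop q)) f) z =
  2^-1 * 2^-1 * (cD X (cD X f) z + cD Y (cD Y f) z).
Proof.
move=> fs Uz.
have sq q : smooth_on U (fun y => (v q)^*%C * fapp (fconj (dzop q)) f y).
  by apply: smooth_mul => //; [exact: smooth_cst|exact: smooth_fapp].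
have sc (c : C) w : smooth_on U (fun y => c * cD w f y).
  by apply: smooth_mul => //; [exact: smooth_cst|exact: smooth_cD].
pose g y := 2^-1 * cD X f y + (2^-1 * 'i%R) * cD Y f y.
have gs : smooth_on U g by exact: smooth_add.
have -> : \sum_p \sum_q v p * (v q)^*%C * fapp (dzop p) (fapp (fconj (dzop q)) f) z =
    \sum_p v p * fapp (dzop p) g z.
  apply: eq_bigr => p _.
  transitivity (v p * \sum_q fapp (dzop p) (fun y => (v q)^*%C * fapp (fconj (dzop q)) f y) z).
    rewrite mulr_sumr; apply: eq_bigr => q _.
    by rewrite (fapp_scale _ _ Uz (smooth_fapp oU _ fs)) mulrA.
  congr (_ * _).
  apply: etrans (esym (fapp_sum oU (dzop p) (index_enum _) Uz sq)) _.
  apply: (fapp_eq oU _ Uz) => y; rewrite inE => Uy.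
  by rewrite (sum_dzb_dir fs Uy) /g mulrDr mulrA.
rewrite (sum_dz_dir gs Uz).
have cg w : cD w g z = 2^-1 * cD w (cD X f) z + (2^-1 * 'i%R) * cD w (cD Y f) z.
  have fE (c : C) u : cD w (fun y => c * cD u f y) z = c * cD w (cD u f) z.
    have := fapp_scale (Fop 1 w 0 w) c Uz (smooth_cD u fs).
    by rewrite /fapp /= !mul1r !mul0r !addr0.
  rewrite /g; apply: etrans (cD_add w Uz (sc _ X) (sc _ Y)) _.
  exact: (congr2 +%R (fE _ X) (fE _ Y)).
rewrite !cg (cD_sym oU Y X Uz fs).
move: (cD X (cD X f) z) (cD X (cD Y f) z) (cD Y (cD Y f) z) => a b c.
have -> : 2^-1 * (2^-1 * a + 2^-1 * 'i%R * b - 'i%R * (2^-1 * b + 2^-1 * 'i%R * c)) =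
    2^-1 * 2^-1 * (a - ('i%R * 'i%R) * c) by ring.
by rewrite imag_sqr; ring.
Qed.

End direction.

(** On each complex line the Hessian is a sum of two second derivatives, nonpositive at a maximum; a
    positive [A] averages over finitely many such lines. *)
Lemma hessian_max U f z (A : 'M[C]_n) : open U -> smooth_on U f -> U z ->
  (forall y, U y -> complex.Im (f y) = 0) ->
  (forall y, U y -> complex.Re (f y) <= complex.Re (f z)) -> posdef A ->
  complex.Re (\sum_p \sum_q A q p * fapp (dzop p) (fapp (fconj (dzop q)) f) z) <= 0.
Proof.
move=> oU fs Uz f0 fmax pA.
have cDD (w : Z) : cD w (cD w f) z <= 0.
  have [f1 f2] := fs 2%N.
  rewrite /cD /= lecE /=; apply/andP; split; last first.
    exact: (second_derivative_max w oU f1 Uz fmax).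
  rewrite (eq_derive (g := cst 0) _ oU Uz) ?derive_cst // => y; rewrite inE => Uy.
  rewrite (eq_derive (g := cst 0) _ oU Uy) ?derive_cst // => y'; rewrite inE => Uy'.
  by rewrite f0.
pose L : 'M[C]_n := \matrix_(p, q) - fapp (dzop p) (fapp (fconj (dzop q)) f) z.
have : 0 <= \sum_p \sum_q A q p * L p q.
  apply: sum_posdef_ge0 => // v.
  have -> : \sum_p \sum_q v p * (v q)^*%C * L p q =
      - (\sum_p \sum_q v p * (v q)^*%C * fapp (dzop p) (fapp (fconj (dzop q)) f) z).
    rewrite -sumrN; apply: eq_bigr => p _; rewrite -sumrN; apply: eq_bigr => q _.
    by rewrite mxE mulrN.
  rewrite (hessian_dir oU v fs Uz) oppr_ge0 pmulr_rle0; last by rewrite mulr_gt0 // invr_gt0.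
  by rewrite -[0]addr0 lerD.
have -> : \sum_p \sum_q A q p * L p q =
   - (\sum_p \sum_q A q p * fapp (dzop p) (fapp (fconj (dzop q)) f) z).
  rewrite -sumrN; apply: eq_bigr => p _; rewrite -sumrN; apply: eq_bigr => q _.
  by rewrite mxE mulrN.
by rewrite oppr_ge0 lecE => /andP[_].
Qed.

End CoordinateSpace.

Lemma dmxE (R : realType) (V : normedModType R) d m n (A : V -> 'M[R[i]]_(m, n)) x i j :
  dmx d A x i j = fapp d (fun y => A y i j) x.
Proof. exact: mxE. Qed.

(** * Functions on space-time and their slices *)

Section Slices.
Context {R : realType} {n : nat}.
Local Notation C := R[i].
Local Notation Z := (Cn R n).
Local Notation S := (R * Z)%type.
Implicit Types (F : S -> C) (W : set S) (U : set Z).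

Definition liftop (d : fop (R := R) (V := Z)) : fop (R := R) (V := S) :=
  Fop (fop_a d) (0, fop_v d) (fop_b d) (0, fop_w d).

Definition dtop : fop (R := R) (V := S) := Fop 1 ((1 : R), (0 : Z)) 0 ((0 : R), (0 : Z)).

Lemma fconj_dtop : fconj dtop = dtop.
Proof. by rewrite /fconj /dtop /= oppr0. Qed.

Lemma derive_slice (g : S -> R) v t z :
  'D_(0, v) g (t, z) = 'D_v (fun w => g (t, w)) z.
Proof.
rewrite /derive; set g1 := fun h => _ *: _; set g2 := fun h => _ *: _.
suff -> : g1 = g2 by [].
apply/funext => h; rewrite /g1 /g2 /=.
by rewrite (_ : h *: ((0 : R), v) + (t, z) = (t, h *: v + z)) //;
  congr (_, _); rewrite /= scaler0 add0r.
Qed.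

Lemma derivable_slice (g : S -> R) v t z :
  derivable g (t, z) (0, v) -> derivable (fun w => g (t, w)) z v.
Proof.
rewrite /derivable; set g1 := fun h => _ *: _; set g2 := fun h => _ *: _.
suff -> : g1 = g2 by [].
apply/funext => h; rewrite /g1 /g2 /=.
by rewrite (_ : h *: ((0 : R), v) + (t, z) = (t, h *: v + z)) //;
  congr (_, _); rewrite /= scaler0 add0r.
Qed.

Lemma derive_time_slice (g : S -> R) t z :
  'D_((1 : R), (0 : Z)) g (t, z) = 'D_1 (fun s => g (s, z)) t.
Proof.
rewrite /derive; set g1 := fun h => _ *: _; set g2 := fun h => _ *: _.
suff -> : g1 = g2 by [].
apply/funext => h; rewrite /g1 /g2 /=.
by rewrite (_ : h *: ((1 : R), (0 : Z)) + (t, z) = (h *: 1 + t, z)) //;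
  congr (_, _); rewrite /= scaler0 add0r.
Qed.

Lemma derivable_time_slice (g : S -> R) t z :
  derivable g (t, z) ((1 : R), (0 : Z)) -> derivable (fun s => g (s, z)) t (1 : R).
Proof.
rewrite /derivable; set g1 := fun h => _ *: _; set g2 := fun h => _ *: _.
suff -> : g1 = g2 by [].
apply/funext => h; rewrite /g1 /g2 /=.
by rewrite (_ : h *: ((1 : R), (0 : Z)) + (t, z) = (h *: 1 + t, z)) //;
  congr (_, _); rewrite /= scaler0 add0r.
Qed.

Lemma fapp_liftop d F t z : fapp (liftop d) F (t, z) = fapp d (fun w => F (t, w)) z.
Proof. by rewrite /fapp /cD /liftop /= !derive_slice. Qed.

Lemma dmx_liftop d m k (A : S -> 'M[C]_(m, k)) t z :
  dmx (liftop d) A (t, z) = dmx d (fun w => A (t, w)) z.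
Proof.
apply/matrixP => i j; apply: etrans (dmxE _ _ _ _ _) _.
exact: etrans (fapp_liftop _ _ _ _) (esym (dmxE _ _ _ _ _)).
Qed.

Lemma fapp_dtop F t z : fapp dtop F (t, z) =
  'D_1 (fun s => complex.Re (F (s, z))) t +i* 'D_1 (fun s => complex.Im (F (s, z))) t.
Proof. by rewrite /fapp /dtop /= mul1r mul0r addr0 /cD !derive_time_slice. Qed.

Lemma pair_continuous t : continuous (fun z : Z => (t, z) : S).
Proof.
move=> z; apply: (@cvg_pair _ _ _ (nbhs z) (nbhs t) (nbhs z)); first exact: cvg_cst.
exact: cvg_id.
Qed.

Lemma Ck_slice k W (g : S -> R) t : Ck k W g -> Ck k [set z | W (t, z)] (fun z => g (t, z)).
Proof.
elim: k g => [|k IH] g [gc gd]; split => //.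
- move=> z Wz; apply: (@continuous_comp _ _ _ (fun z => (t, z) : S) g); last exact: gc.
  exact: pair_continuous.
- move=> z Wz; apply: (@continuous_comp _ _ _ (fun z => (t, z) : S) g); last exact: gc.
  exact: pair_continuous.
move=> v; have [gdv Dv] := gd (0, v); split.
  by move=> z Wz; apply: derivable_slice; exact: gdv.
have -> : 'D_v (fun z => g (t, z)) = (fun z => 'D_(0, v) g (t, z)).
  by apply/funext => z; rewrite derive_slice.
exact: (IH _ Dv).
Qed.

Lemma smooth_slice W F t : smooth_on W F -> smooth_on [set z | W (t, z)] (fun z => F (t, z)).
Proof. by move=> Fs k; have [F1 F2] := Fs k; split; [exact: (Ck_slice t F1)|exact: (Ck_slice t F2)]. Qed.

Lemma snd_continuous : continuous (snd : S -> Z).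
Proof. by case=> t z; exact: (@cvg_snd _ _ (nbhs t) (nbhs z)). Qed.

Lemma fst_continuous : continuous (fst : S -> R).
Proof. by case=> t z; exact: (@cvg_fst _ _ (nbhs t) (nbhs z)). Qed.

Lemma Ck_snd k U W (g : Z -> R) : (forall p, W p -> U p.2) ->
  Ck k U g -> Ck k W (fun p => g p.2).
Proof.
move=> WU; elim: k g => [|k IH] g [gc gd]; split => //.
- move=> p Wp; apply: (@continuous_comp _ _ _ snd g); last exact/gc/WU.
  exact: snd_continuous.
- move=> p Wp; apply: (@continuous_comp _ _ _ snd g); last exact/gc/WU.
  exact: snd_continuous.
move=> v; have [gdv Dv] := gd v.2.
have Es p : (fun h : R => h^-1 *: (((fun p => g p.2) \o shift p) (h *: v) - g p.2)) =
    (fun h : R => h^-1 *: ((g \o shift p.2) (h *: v.2) - g p.2)) by [].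
split; first by move=> p /WU /gdv.
have -> : 'D_v (fun p => g p.2) = (fun p => 'D_(v.2) g p.2) by [].
exact: (IH _ Dv).
Qed.

Lemma smooth_snd U W (h : Z -> C) : (forall p, W p -> U p.2) ->
  smooth_on U h -> smooth_on W (fun p => h p.2).
Proof. by move=> WU hs k; have [h1 h2] := hs k; split; [exact: (Ck_snd WU h1)|exact: (Ck_snd WU h2)]. Qed.

Lemma fapp_dtop_snd (h : Z -> C) p : fapp dtop (fun p => h p.2) p = 0.
Proof.
case: p => t z; apply: etrans (fapp_dtop _ _ _) _; apply: ReIm_eq.
  exact: (derive_cst (V := R^o) (W := R^o) (complex.Re (h z))).
exact: (derive_cst (V := R^o) (W := R^o) (complex.Im (h z))).
Qed.

Lemma is_derive_fst (p v : S) : is_derive p v (fun q : S => q.1 : R) v.1.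
Proof.
have [H1 H2] : is_derive (0 : R) (1 : R) (fun h : R => h * v.1 + p.1) v.1.
  rewrite (_ : (fun h => _) = v.1 \*: (@idfun R : R -> R) + cst p.1); last first.
    by apply/funext => h /=; rewrite mulrC.
  by apply: is_derive_eq; rewrite addr0; exact: mulr1.
split; first exact: (derivable1P (fun q : S => q.1 : R^o) p v).2 H1.
by rewrite -(derive_line (fun q : S => q.1 : R^o)); exact: H2.
Qed.

Lemma Ck_fst k W : Ck k W (fun p : S => p.1).
Proof.
have c p : W p -> {for p, continuous (fun p : S => p.1)}.
  by move=> _; exact: fst_continuous.
case: k => [|k]; split; [exact: c|exact: I|exact: c|move=> v].
split; first by move=> p _; have [] := is_derive_fst p v.
have -> : 'D_v (fun p : S => p.1) = cst v.1.
  by apply/funext => p; have [_ ->] := is_derive_fst p v.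
exact: Ck_cst.
Qed.

Lemma smooth_fst W : smooth_on W (fun p : S => (p.1)%:C).
Proof. by move=> k; split => /=; [exact: Ck_fst|exact: Ck_cst]. Qed.

End Slices.

(* The hypothesis is the Cauchy-Riemann equations for [(a, b, c, d)], the real
   Jacobian of one component; they turn the real chain rule into the complex one. *)
Lemma holomorphic_algebra (R : realType) (a b c d : R) (X Y : R[i]) :
  2^-1 * (a +i* b) + 2^-1 * 'i%R * (c +i* d) = 0 ->
  2^-1 * (a%:C * X + b%:C * Y - 'i%R * (c%:C * X + d%:C * Y)) =
  (2^-1 * (a +i* b) + - (2^-1 * 'i%R) * (c +i* d)) * (2^-1 * (X - 'i%R * Y)).
Proof.
rewrite (complex_parts (a +i* b)) (complex_parts (c +i* d)) /= => E.
have : (a - d)%:C + 'i%R * (b + c)%:C = 0 :> R[i].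
  have -> : (a - d)%:C + 'i%R * (b + c)%:C = 2 * (2^-1 * (a%:C + 'i%R * b%:C) +
     2^-1 * 'i%R * (c%:C + 'i%R * d%:C)) :> R[i].
    rewrite !rmorphD rmorphN /= -[in LHS](mulN1r (d%:C)) -imag_sqr; by field.
  exact: etrans (congr1 (fun u => 2 * u) E) (mulr0 _).
have -> : (a - d)%:C + 'i%R * (b + c)%:C = (a - d) +i* (b + c) :> R[i].
  by rewrite [RHS]complex_parts.
case=> /eqP; rewrite subr_eq0 => /eqP <- /eqP; rewrite addrC addr_eq0 => /eqP ->.
rewrite rmorphN /=; move: (a%:C) (b%:C) => {E}a {}b.
have -> : 2^-1 * (a + 'i%R * b) + - (2^-1 * 'i%R) * (- b + 'i%R * a) =
    2^-1 * (a + 'i%R * b) + 2^-1 * 'i%R * b - 2^-1 * ('i%R * 'i%R) * a by ring.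
rewrite imag_sqr.
have -> : 2^-1 * (a + 'i%R * b) + 2^-1 * 'i%R * b - 2^-1 * -1 * a = a + 'i%R * b by field.
have -> : (a + 'i%R * b) * (2^-1 * (X - 'i%R * Y)) =
  2^-1 * (a * X - 'i%R * a * Y + 'i%R * b * X - 'i%R * 'i%R * b * Y) by ring.
by rewrite imag_sqr; ring.
Qed.

(** * Holomorphic changes of coordinates *)

Section ChainRule.
Context {R : realType} {n : nat}.
Local Notation C := R[i].
Local Notation Z := (Cn R n).
Variables (U U' : set Z) (phi : Z -> Z).
Hypothesis oU : open U.
Hypothesis oU' : open U'.
Hypothesis phis : forall k, smooth_on U (fun z => zcoord k (phi z)).

Lemma derive_comp_Cn (g : Z -> R) v z : U z -> U' (phi z) -> Ck 1 U' g ->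
  'D_v (g \o phi) z =
  \sum_k ('D_v (fun y => (phi y).1 0 k) z * 'D_(ex k) g (phi z)
        + 'D_v (fun y => (phi y).2 0 k) z * 'D_(ey k) g (phi z)).
Proof.
move=> Uz Upz gC.
pose c1 k (y : Z) := (phi y).1 0 k; pose c2 k (y : Z) := (phi y).2 0 k.
pose h1 k (s : R) := c1 k (s *: v + z) - c1 k z.
pose h2 k (s : R) := c2 k (s *: v + z) - c2 k z.
pose h := isplit h1 h2; pose dir := isplit (@ex R n) (@ey R n).
have dc1 k : derivable (c1 k) z v.
  by have [H _] := phis k 1; exact: (Ck_derivable H Uz).
have dc2 k : derivable (c2 k) z v.
  by have [_ H] := phis k 1; exact: (Ck_derivable H Uz).
have dline (c : Z -> R) : derivable c z v ->
    is_derive (0 : R) (1 : R) (fun s => c (s *: v + z) - c z) ('D_v c z).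
  move=> dc; rewrite -[X in is_derive _ _ _ X]subr0; apply: is_deriveB.
  by split; [exact: (derivable1P _ _ _).1|rewrite derive_line].
have dh1 k := dline _ (dc1 k); have dh2 k := dline _ (dc2 k).
have e1 k : 'D_1 (h1 k) 0 = 'D_v (c1 k) z by case: (dh1 k).
have e2 k : 'D_1 (h2 k) 0 = 'D_v (c2 k) z by case: (dh2 k).
have [||_ E] := @C1_chain _ _ _ dir U' g (phi z) h oU' gC Upz.
- move=> k; rewrite /h /isplit; case: (fintype.split k) => j.
    by rewrite /h1 scale0r add0r subrr.
  by rewrite /h2 scale0r add0r subrr.
- move=> k; rewrite /h /isplit; case: (fintype.split k) => j.
    by have [] := dh1 j.
  by have [] := dh2 j.
rewrite -derive_line (_ : (fun s : R => (g \o phi) (s *: v + z)) =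
    (fun s => g (phi z + \sum_k h k s *: dir k))).
  apply: etrans E _; rewrite sum_isplit [RHS]big_split.
  apply: (congr2 +%R); apply: eq_bigr => k _; rewrite /h /dir.
    by rewrite isplitl isplitl; exact: (congr2 *%R (e1 k) erefl).
  by rewrite isplitr isplitr; exact: (congr2 *%R (e2 k) erefl).
apply/funext => s; rewrite sum_isplit; congr g; apply/esym.
apply: etrans (congr1 (fun u => u + _) (CnE (phi z))) _; rewrite addrACA -big_split -big_split.
apply: etrans _ (esym (CnE (phi (s *: v + z)))).
apply: (congr2 +%R); apply: eq_bigr => k _; rewrite /h /dir.
  rewrite isplitl isplitl /h1; apply: etrans (esym (scalerDl _ _ _)) _.
  by congr (_ *: _); rewrite addrC subrK.
rewrite isplitr isplitr /h2; apply: etrans (esym (scalerDl _ _ _)) _.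
by congr (_ *: _); rewrite addrC subrK.
Qed.

Lemma cD_comp_Cn h v z : U z -> U' (phi z) -> smooth_on U' h ->
  cD v (h \o phi) z =
  \sum_k (('D_v (fun y => (phi y).1 0 k) z)%:C * cD (ex k) h (phi z)
        + ('D_v (fun y => (phi y).2 0 k) z)%:C * cD (ey k) h (phi z)).
Proof.
move=> Uz Upz hs; have [h1 h2] := hs 1%N.
apply: ReIm_eq; rewrite ?Re_sum ?Im_sum.
  apply: etrans (derive_comp_Cn v Uz Upz h1) _; apply: eq_bigr => k _.
  exact: (esym (Re_real_comb _ _ (cD (ex k) h (phi z)) (cD (ey k) h (phi z)))).
apply: etrans (derive_comp_Cn v Uz Upz h2) _; apply: eq_bigr => k _.
exact: (esym (Im_real_comb _ _ (cD (ex k) h (phi z)) (cD (ey k) h (phi z)))).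
Qed.

Lemma dz_comp h i z : U z -> U' (phi z) -> smooth_on U' h ->
  (forall k, dzb i (fun y => zcoord k (phi y)) z = 0) ->
  dz i (h \o phi) z = \sum_k dz i (fun y => zcoord k (phi y)) z * dz k h (phi z).
Proof.
move=> Uz Upz hs hol.
have -> : dz i (h \o phi) z =
    2^-1 * (cD (ex i) (h \o phi) z - 'i%R * cD (ey i) (h \o phi) z) by [].
apply: etrans (congr2 (fun u w => 2^-1 * (u - 'i%R * w))
  (cD_comp_Cn (ex i) Uz Upz hs) (cD_comp_Cn (ey i) Uz Upz hs)) _.
rewrite mulr_sumr -sumrB mulr_sumr; apply: eq_bigr => k _.
have := hol k.
have -> : dz k h (phi z) = 2^-1 * (cD (ex k) h (phi z) - 'i%R * cD (ey k) h (phi z)).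
  by [].
rewrite dzE dzbE fconj_dzop /fapp [fop_a _]/= [fop_b _]/= [fop_v _]/= [fop_w _]/=.
rewrite /cD.
move: ('D_(ex i) (fun y => (phi y).1 0 k) z) ('D_(ex i) (fun y => (phi y).2 0 k) z).
move: ('D_(ey i) (fun y => (phi y).1 0 k) z) ('D_(ey i) (fun y => (phi y).2 0 k) z).
by move=> d c b a; exact: holomorphic_algebra.
Qed.

End ChainRule.

(** * The flow in a coordinate patch *)

(* The two sides differ by [\sum g^{qm} g^{lp} (T_q i p * T_l j m - T_q j p * T_l i m)],
   which vanishes under the exchange of (q, m) and (l, p). *)
Lemma torsion_exchange (C : comPzRingType) n (Gi : 'M[C]_n) (D T : 'I_n -> 'M[C]_n) i j :
  (forall q k l, T q k l = D k l q - D l k q) ->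
  \sum_p \sum_q (- (Gi *m D i *m Gi)) q p * T q j p
  - \sum_p \sum_q (- (Gi *m D j *m Gi)) q p * T q i p =
  \sum_p \sum_q Gi q p * ((T q *m Gi^T *m (D p)^T) i j + (D p *m Gi *m T q) i j).
Proof.
move=> TD.
pose Sm (F : 'I_n -> 'I_n -> 'I_n -> 'I_n -> C) :=
  \sum_q \sum_m \sum_l \sum_p Gi q m * Gi l p * F q m l p.
have SmD F F' : Sm F + Sm F' = Sm (fun q m l p => F q m l p + F' q m l p).
  do 4![rewrite /Sm -big_split; apply: eq_bigr => ? _]; exact/esym/mulrDr.
have SmN F : - Sm F = Sm (fun q m l p => - F q m l p).
  do 4![rewrite /Sm -sumrN; apply: eq_bigr => ? _]; exact/esym/mulrN.
have SmS F : Sm F = Sm (fun q m l p => F l p q m).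
  rewrite /Sm pair_bigA [RHS]pair_bigA.
  under eq_bigr do rewrite pair_bigA.
  under [RHS]eq_bigr do rewrite pair_bigA.
  rewrite exchange_big; apply: eq_bigr => a _; apply: eq_bigr => b _.
  by rewrite [X in X * _]mulrC.
have e1 (X : 'M[C]_n) k : \sum_p \sum_q (- (Gi *m X *m Gi)) q p * T q k p =
    - Sm (fun q m l p => X m l * T q k p).
  rewrite /Sm -sumrN exchange_big; apply: eq_bigr => q _.
  rewrite -sumrN [RHS](_ : _ = - \sum_m \sum_l \sum_p Gi q m * Gi l p * (X m l * T q k p)); last first.
    by rewrite sumrN.
  rewrite (eq_bigr _ (fun m _ => exchange_big _ _ _ _ _ _)) exchange_big -sumrN.
  apply: eq_bigr => p _; rewrite [in LHS]mxE mulNr [in LHS]mxE mulr_suml; congr (- _).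
  rewrite exchange_big; apply: eq_bigr => l _; rewrite [in LHS]mxE !mulr_suml.
  by apply: eq_bigr => m _; ring.
have e2 : \sum_p \sum_q Gi q p * (T q *m Gi^T *m (D p)^T) i j =
    Sm (fun q m l p => T q i p * D m j l).
  rewrite /Sm exchange_big; apply: eq_bigr => q _; apply: eq_bigr => m _.
  rewrite [in LHS]mxE mulr_sumr; apply: eq_bigr => l _.
  rewrite !mxE mulr_suml mulr_sumr; apply: eq_bigr => p _; rewrite !mxE; ring.
have e3 : \sum_p \sum_q Gi q p * (D p *m Gi *m T q) i j =
    Sm (fun q m l p => D m i l * T q p j).
  rewrite /Sm exchange_big; apply: eq_bigr => q _; apply: eq_bigr => m _.
  rewrite exchange_big.
  rewrite [in LHS]mxE mulr_sumr; apply: eq_bigr => p _.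
  rewrite !mxE mulr_suml mulr_sumr; apply: eq_bigr => l _; ring.
under [RHS]eq_bigr do (under eq_bigr do rewrite mulrDr; rewrite big_split).
rewrite [RHS]big_split [X in _ = X + _]e2 [X in _ = _ + X]e3 !e1 opprK.
apply/eqP; rewrite -subr_eq0; apply/eqP.
rewrite opprD !SmN !SmD.
transitivity (Sm (fun q m l p => T q i p * T l j m) - Sm (fun q m l p => T q j p * T l i m)).
  rewrite SmN SmD; do 4![apply: eq_bigr => ? _]; congr (_ * _).
  rewrite !TD; ring.
rewrite [X in X - _]SmS SmN SmD; do 4![apply: big1 => ? _].
by rewrite [X in _ * (_ - X)]mulrC subrr mulr0.
Qed.

(** * Background quantities entering the constants *)

Section Background.
Context {R : realType} {n : nat}.
Local Notation C := R[i].
Local Notation Z := (Cn R n).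

(* The dual of the generalized metric of [G0] with zero potential. *)
Definition ref_metric (G0 : Z -> 'M[C]_n) z : 'M[C]_(n + n) := diag2 (invmx (G0 z)) (G0 z)^T.

Definition ref_torsion (G0 : Z -> 'M[C]_n) q z : 'M[C]_n := \matrix_(i, j) torsion G0 z i j q.

Definition ref_curv_err (G0 : Z -> 'M[C]_n) p q z : 'M[C]_(n + n) :=
  curv_err (ref_metric G0) (@dzop R n) z
    (fun q => - 'i%R *: ref_torsion G0 q z)
    (fun p q => - 'i%R *: dmx (dzop p) (ref_torsion G0 q) z) p q.

(** A sum of absolute entries is enough as a continuous bound for the error term; it is not
    invariant under changes of chart. *)
Definition ref_bound (G0 : Z -> 'M[C]_n) z : C :=
  \sum_p \sum_q \sum_i \sum_j `|ref_curv_err G0 p q z i j|.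

Lemma mx_smooth_ref_metric (U : set Z) (G0 : Z -> 'M[C]_n) : open U -> mx_smooth U G0 ->
  (forall z, U z -> posdef (G0 z)) -> mx_smooth U (ref_metric G0).
Proof.
move=> oU G0s G0p; apply: mx_smooth_block => //.
- by apply: mx_smooth_inv => // z /G0p; exact: posdef_unit.
- exact: mx_smooth_cst.
- exact: mx_smooth_cst.
- exact: mx_smooth_tr.
Qed.

Lemma posdef_ref_metric (G0 : Z -> 'M[C]_n) z : posdef (G0 z) -> posdef (ref_metric G0 z).
Proof. by move=> Gp; apply: posdef_block; [exact: posdef_inv|exact: posdef_tr]. Qed.

Lemma mx_smooth_ref_torsion (U : set Z) (G0 : Z -> 'M[C]_n) q : open U -> mx_smooth U G0 ->
  mx_smooth U (ref_torsion G0 q).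
Proof.
move=> oU G0s i j; under eq_fun do rewrite mxE.
have sm k l : smooth_on U (dz k (fun w => G0 w l q)).
  by rewrite dzEf; apply: smooth_fapp => //; exact: G0s.
by apply: smooth_add => //; exact: smooth_opp.
Qed.

Lemma mx_smooth_ref_curv_err (U : set Z) (G0 : Z -> 'M[C]_n) p q : open U -> mx_smooth U G0 ->
  (forall z, U z -> posdef (G0 z)) -> mx_smooth U (ref_curv_err G0 p q).
Proof.
move=> oU G0s G0p.
have Ks := mx_smooth_ref_metric oU G0s G0p.
have dK d : mx_smooth U (dmx d (ref_metric G0)) by exact: mx_smooth_dmx.
have ddK d e : mx_smooth U (dmx d (dmx e (ref_metric G0))) by exact: mx_smooth_dmx.
have Kis : mx_smooth U (fun z => invmx (ref_metric G0 z)).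
  by apply: mx_smooth_inv => // z /G0p/posdef_ref_metric/posdef_unit.
have sZ m k c (A : Z -> 'M[C]_(m, k)) : mx_smooth U A -> mx_smooth U (fun z => c *: A z).
  move=> As i j; under eq_fun do rewrite mxE.
  by apply: smooth_mul => //; exact: smooth_cst.
have Ts r : mx_smooth U (ref_torsion G0 r) by exact: mx_smooth_ref_torsion.
have ns (A : Z -> 'M[C]_n) : mx_smooth U A -> mx_smooth U (fun z => nilp (A z)).
  by move=> As; apply: mx_smooth_block => //; exact: mx_smooth_cst.
have bs r : mx_smooth U (fun z => nilp (- 'i%R *: ref_torsion G0 r z)).
  by apply: ns; exact: sZ.
have b's r s : mx_smooth U (fun z => nilp (- 'i%R *: dmx (dzop r) (ref_torsion G0 s) z)).
  by apply: ns; apply: sZ; exact: mx_smooth_dmx.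
have cs (A : Z -> 'M[C]_(n + n)) : mx_smooth U A -> mx_smooth U (fun z => ctr (A z)).
  exact: mx_smooth_ctr.
have sub (A B : Z -> 'M[C]_(n + n)) : mx_smooth U A -> mx_smooth U B ->
    mx_smooth U (fun z => A z - B z).
  by move=> As Bs; apply: mx_smooth_add => //; exact: mx_smooth_opp.
have mul (A B : Z -> 'M[C]_(n + n)) : mx_smooth U A -> mx_smooth U B ->
    mx_smooth U (fun z => A z *m B z).
  exact: mx_smooth_mul.
have k1 := sub _ _ (dK (dzop p)) (mul _ _ (cs _ (bs p)) Ks).
have k1b := sub _ _ (dK (fconj (dzop q))) (mul _ _ Ks (bs q)).
have k2 := sub _ _ (ddK (dzop p) (fconj (dzop q))) (mul _ _ (dK (dzop p)) (bs q)).
have k3 := sub _ _ k2 (mul _ _ Ks (b's p q)).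
have k4 := sub _ _ k3 (mul _ _ (cs _ (bs p)) (dK (fconj (dzop q)))).
have k5 := sub _ _ k4 (mul _ _ (cs _ (b's q p)) Ks).
have k6 := mx_smooth_add oU k5 (mul _ _ (mul _ _ (cs _ (bs p)) Ks) (bs q)).
exact: (sub _ _ k6 (mul _ _ (mul _ _ k1b Kis) k1)).
Qed.

End Background.

Section LocalFlow.
Context {R : realType} {n : nat}.
Local Notation C := R[i].
Local Notation Z := (Cn R n).
Local Notation S := (R * Z)%type.
Variables (tau : R) (U : set Z) (W : set S).
Hypothesis tau_gt0 : 0 < tau.
Hypothesis oU : open U.
Hypothesis oW : open W.
Hypothesis WU : forall p, W p -> U p.2.

Variables (G : S -> 'M[C]_n) (A : S -> 'rV[C]_n).
Variables (G0 H : Z -> 'M[C]_n) (mu : Z -> 'rV[C]_n).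
Hypothesis Gs : mx_smooth W G.
Hypothesis As : mx_smooth W A.
Hypothesis G0s : mx_smooth U G0.
Hypothesis Hs : mx_smooth U H.
Hypothesis mus : mx_smooth U mu.
Hypothesis Gpos : forall p, W p -> posdef (G p).
Hypothesis Hpos : forall z, U z -> posdef (H z).

Local Notation Dz i := (liftop (dzop i)).
Local Notation Db i := (fconj (liftop (dzop i))).
Let Aj j p := A p 0 j.
Let mj j (p : S) := mu p.2 0 j.
Let tt (p : S) : C := (tau^-1)%:C * (p.1)%:C.

Lemma fconj_liftop (d : fop (R := R) (V := Z)) : fconj (liftop d) = liftop (fconj d).
Proof. by []. Qed.

Lemma dz_slice i (F : S -> C) t z : dz i (fun w => F (t, w)) z = fapp (Dz i) F (t, z).
Proof. by rewrite dzE fapp_liftop. Qed.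

Lemma dzb_slice i (F : S -> C) t z : dzb i (fun w => F (t, w)) z = fapp (Db i) F (t, z).
Proof. by rewrite dzbE fconj_liftop fapp_liftop. Qed.

Lemma dz_dzb_slice i j (h : Z -> C) t z :
  fapp (Dz i) (fapp (Db j) (fun p => h p.2)) (t, z) = dz i (dzb j h) z.
Proof.
rewrite -dz_slice.
have -> : (fun w => fapp (Db j) (fun p => h p.2) (t, w)) = dzb j h; last by [].
by apply/funext => w; exact: (esym (dzb_slice j (fun p => h p.2) t w)).
Qed.

(* [del alpha + (t / tau) del mu]: its delbar-derivatives are, up to a factor i,
   the torsion of the evolving metric minus that of [G0]. *)
Definition potential (A : S -> 'rV[C]_n) (p : S) : 'M[C]_n :=
  \matrix_(i, j) (fapp (Dz i) (fun p => A p 0 j) p - fapp (Dz j) (fun p => A p 0 i) p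
   + (tau^-1)%:C * (p.1)%:C * (fapp (Dz i) (fun p => mu p.2 0 j) p
   - fapp (Dz j) (fun p => mu p.2 0 i) p)).
Let x := potential A.

Lemma potentialE B t z : potential B (t, z) =
  del (fun w => B (t, w)) z + (t / tau)%:C *: del mu z.
Proof.
apply/matrixP => i j; rewrite !mxE -!dz_slice [t / tau]mulrC.
by rewrite [((tau^-1 * t)%:C)]rmorphM.
Qed.

Let As' j : smooth_on W (Aj j). Proof. exact: As. Qed.
Let ms' j : smooth_on W (mj j).
Proof. exact: (smooth_snd WU (mus 0 j)). Qed.
Let tts : smooth_on W tt.
Proof. by apply: smooth_mul => //; [exact: smooth_cst|exact: smooth_fst]. Qed.

Lemma mx_smooth_potential B : mx_smooth W B -> mx_smooth W (potential B).
Proof.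
move=> Bs i j; under eq_fun do rewrite mxE.
have sm k l : smooth_on W (fapp (Dz k) (fun p => B p 0 l)).
  by apply: smooth_fapp => //; exact: Bs.
have sm' k l : smooth_on W (fapp (Dz k) (fun p => mu p.2 0 l)).
  by apply: smooth_fapp => //; exact: ms'.
apply: smooth_add => //.
  by apply: smooth_add => //; exact: smooth_opp.
apply: smooth_mul => //.
by apply: smooth_add => //; exact: smooth_opp.
Qed.

Let xs : mx_smooth W x. Proof. exact: mx_smooth_potential. Qed.

Lemma fapp_fst_lift d (p : S) : fapp (liftop d) (fun p : S => (p.1)%:C) p = 0.
Proof.
case: p => t z; rewrite fapp_liftop.
exact: (fapp_cst d (t%:C) z).
Qed.

Definition tor (F : S -> 'M[C]_n) (q : 'I_n) (p : S) : 'M[C]_n :=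
  \matrix_(i, j) (fapp (Dz i) (fun p => F p j q) p - fapp (Dz j) (fun p => F p i q) p).

Lemma torE F q t z i j : tor F q (t, z) i j = torsion (fun w => F (t, w)) z i j q.
Proof. by rewrite mxE /torsion -!dz_slice. Qed.

Lemma mx_smooth_tor F q : mx_smooth W F -> mx_smooth W (tor F q).
Proof.
move=> Fs i j; under eq_fun do rewrite mxE.
have sm k l : smooth_on W (fapp (Dz k) (fun p => F p l q)).
  by apply: smooth_fapp => //; exact: Fs.
by apply: smooth_add => //; exact: smooth_opp.
Qed.

Hypothesis rel : forall t z, W (t, z) ->
  G (t, z) = metric_alpha (omega_hat tau G0 H mu) (fun t z => A (t, z)) t z.

Let ld (p : S) : C := log_det H p.2.
Let lds : smooth_on W ld.
Proof.
apply: (smooth_snd WU (h := log_det H)); apply: smooth_ln => //; last exact: smooth_det.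
by move=> z /Hpos/posdef_det_gt0; rewrite ltcE => /andP[].
Qed.
Let G0' (p : S) := G0 p.2.
Let G0s' : mx_smooth W G0'. Proof. by move=> i j; exact: (smooth_snd WU (G0s i j)). Qed.

(** In the interpolation the coefficients of [G0] add up to 1, while [rho] and [mu] acquire the
    factors [t] and [t / tau]. In this form each summand is [G0], a [Db k]-derivative, or a
    [Dz j]-derivative, to which torsion is blind. *)
Lemma metric_entry p j k : W p -> G p j k = G0' p j k
  + (p.1)%:C * fapp (Dz j) (fapp (Db k) ld) p
  + 'i%R * (tt p * (fapp (Db k) (mj j) p - fapp (Dz j) (fun p => (mj k p)^*) p))
  + 'i%R * (fapp (Db k) (Aj j) p - fapp (Dz j) (fun p => (Aj k p)^*) p).
Proof.
case: p => t z Wp; rewrite (rel Wp).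
have -> : fapp (Dz j) (fapp (Db k) ld) (t, z) = dz j (dzb k (log_det H)) z.
  exact: dz_dzb_slice.
rewrite /tt /metric_alpha /metric_of /omega_hat /omega_hat_end /omega_of !mxE.
rewrite -!dz_slice -!dzb_slice /Aj /mj /G0' /=.
move: (dz j (dzb k (log_det H)) z) => L.
move: (dzb k (fun w => mu w 0 j) z) (dz j (fun w => (mu w 0 k)^*%C) z) => m1 m2.
move: (dzb k (fun w => A (t, w) 0 j) z) (dz j (fun w => (A (t, w) 0 k)^*%C) z) => a1 a2.
move: (G0 z j k) => g.
have -> : ((t / tau)%:C = t%:C * tau%:C^-1 :> C) by rewrite rmorphM fmorphV.
have -> : (((tau - t) / tau)%:C = (tau%:C - t%:C) * tau%:C^-1 :> C).
  by rewrite rmorphM fmorphV rmorphB.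
have -> : ((tau^-1)%:C = tau%:C^-1 :> C) by rewrite fmorphV.
have : tau%:C != 0 :> C by rewrite (inj_eq (@complexI R)) gt_eqF.
move: (tau%:C : C) (t%:C : C) => a b a0.
have E : 'i%R * 'i%R = -1 :> C := imag_sqr.
move: ('i%R : C) E => i0 E.
transitivity (- (i0 * i0) * (b * a^-1 * g + b * L + (a - b) * a^-1 * g)
   + i0 * (b * a^-1 * (m1 - m2)) + i0 * (a1 - a2)); last by rewrite E; field.
by field.
Qed.

Let cs : smooth_on W (fun p : S => (p.1)%:C : C). Proof. exact: smooth_fst. Qed.

Let fapp_tt e p : W p -> fapp (liftop e) tt p = 0.
Proof.
move=> Wp; apply: etrans (fapp_scale _ _ Wp cs) _.
by rewrite fapp_fst_lift mulr0.
Qed.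

Lemma fapp_sliced e f g u v p : W p -> smooth_on W f -> smooth_on W g ->
  smooth_on W u -> smooth_on W v ->
  fapp (liftop e) (fun p => f p + (p.1)%:C * g p + 'i%R * (tt p * u p) + 'i%R * v p) p =
  fapp (liftop e) f p + (p.1)%:C * fapp (liftop e) g p +
    'i%R * (tt p * fapp (liftop e) u p) + 'i%R * fapp (liftop e) v p.
Proof.
move=> Wp fs gs us vs.
have cg : smooth_on W (fun p => (p.1)%:C * g p) by exact: smooth_mul.
have tu : smooth_on W (fun p => tt p * u p) by exact: smooth_mul.
have itu : smooth_on W (fun p => 'i%R * (tt p * u p)).
  by apply: smooth_mul => //; exact: smooth_cst.
have iv : smooth_on W (fun p => 'i%R * v p).
  by apply: smooth_mul => //; exact: smooth_cst.
have fcg : smooth_on W (fun p => f p + (p.1)%:C * g p) by exact: smooth_add.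
apply: etrans (fapp_add _ Wp (smooth_add oW fcg itu) iv) _.
apply: (congr2 +%R); last exact: (fapp_scale _ _ Wp vs).
apply: etrans (fapp_add _ Wp fcg itu) _.
apply: (congr2 +%R).
  apply: etrans (fapp_add _ Wp fs cg) _; apply: (congr2 +%R erefl).
  apply: etrans (fapp_mul _ Wp cs gs) _.
  by rewrite fapp_fst_lift mul0r add0r.
apply: etrans (fapp_scale _ _ Wp tu) _; apply: (congr1 ( *%R _)).
apply: etrans (fapp_mul _ Wp tts us) _.
by rewrite fapp_tt // mul0r add0r.
Qed.

Let sA e j : smooth_on W (fapp e (Aj j)). Proof. exact: smooth_fapp. Qed.
Let sm e j : smooth_on W (fapp e (mj j)). Proof. exact: smooth_fapp. Qed.
Let scA e j : smooth_on W (fapp e (fun p => (Aj j p)^*)).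
Proof. by apply: smooth_fapp => //; exact: smooth_conj. Qed.
Let scm e j : smooth_on W (fapp e (fun p => (mj j p)^*)).
Proof. by apply: smooth_fapp => //; exact: smooth_conj. Qed.

(** Antisymmetrisation kills the parts of [metric_entry] that are [Dz]-derivatives: the logarithm
    and the conjugate forms. In the other parts [Db q] commutes with [Dz] and yields the derivative
    of the potential. *)
Lemma tor_potential q p : W p ->
  dmx (Db q) x p + (- 'i%R *: tor G0' q p) = - 'i%R *: tor G q p.
Proof.
move=> Wp; apply/matrixP => i j.
have dG k l : fapp (Dz k) (fun p => G p l q) p = fapp (Dz k) (fun p => G0' p l q) p
  + (p.1)%:C * fapp (Dz k) (fapp (Dz l) (fapp (Db q) ld)) p
  + 'i%R * (tt p * (fapp (Db q) (fapp (Dz k) (mj l)) p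
      - fapp (Dz k) (fapp (Dz l) (fun p => (mj q p)^*)) p))
  + 'i%R * (fapp (Db q) (fapp (Dz k) (Aj l)) p
      - fapp (Dz k) (fapp (Dz l) (fun p => (Aj q p)^*)) p).
  apply: etrans (fapp_eq oW _ Wp (fun y Wy => metric_entry _ _ (set_mem Wy))) _.
  apply: etrans (fapp_sliced _ Wp (G0s' l q)
     (smooth_fapp oW _ (smooth_fapp oW _ lds))
     (smooth_add oW (sm _ l) (smooth_opp oW (scm _ q)))
     (smooth_add oW (sA _ l) (smooth_opp oW (scA _ q)))) _.
  apply: (congr2 +%R); last first.
    apply: (congr1 ( *%R _)).
    apply: etrans (fapp_sub oW _ Wp (sA _ l) (scA _ q)) _.
    exact: (congr2 +%R (fapp_sym oW _ _ Wp (As' l)) erefl).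
  apply: (congr2 +%R erefl); apply: (congr1 ( *%R _)); apply: (congr1 ( *%R _)).
  apply: etrans (fapp_sub oW _ Wp (sm _ l) (scm _ q)) _.
  exact: (congr2 +%R (fapp_sym oW _ _ Wp (ms' l)) erefl).
have dx : fapp (Db q) (fun p => x p i j) p =
    fapp (Db q) (fapp (Dz i) (Aj j)) p - fapp (Db q) (fapp (Dz j) (Aj i)) p
    + tt p * (fapp (Db q) (fapp (Dz i) (mj j)) p - fapp (Db q) (fapp (Dz j) (mj i)) p).
  apply: etrans (fapp_ext (g := fun p => (fapp (Dz i) (Aj j) p - fapp (Dz j) (Aj i) p)
    + tt p * (fapp (Dz i) (mj j) p - fapp (Dz j) (mj i) p)) _ _ _) _.
    by move=> y; rewrite mxE.
  have s1 := smooth_add oW (sA (Dz i) j) (smooth_opp oW (sA (Dz j) i)).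
  have s2 := smooth_add oW (sm (Dz i) j) (smooth_opp oW (sm (Dz j) i)).
  apply: etrans (fapp_add _ Wp s1 (smooth_mul oW tts s2)) _.
  apply: (congr2 +%R); first exact: (fapp_sub oW _ Wp (sA _ j) (sA _ i)).
  apply: etrans (fapp_mul _ Wp tts s2) _.
  have -> : fapp (Db q) tt p = 0 by exact: (fapp_tt (fconj (dzop q)) Wp).
  rewrite mul0r add0r; apply: (congr1 ( *%R _)); exact: (fapp_sub oW _ Wp (sm _ j) (sm _ i)).
have e1 := fapp_sym oW (Dz i) (Dz j) Wp (smooth_fapp oW (Db q) lds).
have e2 := fapp_sym oW (Dz i) (Dz j) Wp (smooth_conj oW (ms' q)).
have e3 := fapp_sym oW (Dz i) (Dz j) Wp (smooth_conj oW (As' q)).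
have L : (dmx (Db q) x p + (- 'i%R *: tor G0' q p)) i j = fapp (Db q) (fun p => x p i j) p
    - 'i%R * (fapp (Dz i) (fun p => G0' p j q) p - fapp (Dz j) (fun p => G0' p i q) p).
  by rewrite !mxE mulNr.
have L' : (- 'i%R *: tor G q p) i j =
    - 'i%R * (fapp (Dz i) (fun p => G p j q) p - fapp (Dz j) (fun p => G p i q) p).
  by rewrite !mxE.
rewrite L L' dx !dG e1 e2 e3 {L L' dG dx e1 e2 e3}.
move: (fapp (Dz j) (fapp (Dz i) (fapp (Db q) ld)) p) => v1.
move: (fapp (Dz j) (fapp (Dz i) (fun p => (mj q p)^*)) p) => v2.
move: (fapp (Dz j) (fapp (Dz i) (fun p => (Aj q p)^*)) p) => v3.
move: (fapp (Db q) (fapp (Dz i) (Aj j)) p) (fapp (Db q) (fapp (Dz j) (Aj i)) p) => v4 v5.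
move: (fapp (Db q) (fapp (Dz i) (mj j)) p) (fapp (Db q) (fapp (Dz j) (mj i)) p) => v6 v7.
move: (fapp (Dz i) (fun p => G0' p j q) p) (fapp (Dz j) (fun p => G0' p i q) p) => v8 v9.
move: (tt p) ((p.1)%:C : C) => t s.
have E : 'i%R * 'i%R = -1 :> C := imag_sqr.
move: ('i%R : C) E => i0 E.
transitivity (- i0 * (v8 - v9) - (i0 * i0) * (v4 - v5 + t * (v6 - v7))); last by ring.
rewrite E; ring.
Qed.

Lemma dmx_tor_potential i q p : W p ->
  dmx (Dz i) (dmx (Db q) x) p + (- 'i%R *: dmx (Dz i) (tor G0' q) p) =
  - 'i%R *: dmx (Dz i) (tor G q) p.
Proof.
move=> Wp; apply/matrixP => k l.
have mxZ (c : C) (Y : 'M[C]_n) : (c *: Y) k l = c * Y k l by rewrite mxE.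
have mxDZ (c : C) (X Y : 'M[C]_n) : (X + c *: Y) k l = X k l + c * Y k l.
  by rewrite mxE mxZ.
have s1 : smooth_on W (fun y => dmx (Db q) x y k l) by exact: mx_smooth_dmx.
have s2 : smooth_on W (fun y => tor G0' q y k l) by exact: mx_smooth_tor.
have s3 : smooth_on W (fun y => tor G q y k l) by exact: mx_smooth_tor.
have E : fapp (Dz i) (fun y => dmx (Db q) x y k l + - 'i%R * tor G0' q y k l) p =
    fapp (Dz i) (fun y => - 'i%R * tor G q y k l) p.
  apply: (fapp_eq oW _ Wp) => y /set_mem Wy.
  have := congr1 (fun X : 'M[C]_n => X k l) (tor_potential q Wy).
  by rewrite mxDZ mxZ.
have s4 : smooth_on W (fun y => - 'i%R * tor G0' q y k l).
  by apply: smooth_mul => //; exact: smooth_cst.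
rewrite mxDZ mxZ.
apply: etrans (congr2 (fun u v => u + - 'i%R * v) (dmxE _ _ _ _ _) (dmxE _ _ _ _ _)) _.
apply: etrans _ (congr1 (fun u => - 'i%R * u) (esym (dmxE _ _ _ _ _))).
apply: etrans _ (etrans E (fapp_scale _ _ Wp s3)).
apply: etrans _ (esym (fapp_add _ Wp s1 s4)).
exact: (congr2 +%R erefl (esym (fapp_scale _ _ Wp s2))).
Qed.

Lemma tor_skew F q p : (tor F q p)^T = - tor F q p.
Proof. by apply/matrixP => i j; rewrite !mxE opprB. Qed.

Lemma christoffel_slice t z i k m : christoffel (fun w => G (t, w)) z i k m =
  (dmx (Dz i) G (t, z) *m invmx (G (t, z))) k m.
Proof.
rewrite /christoffel mxE; apply: eq_bigr => l _.
by rewrite mulrC [in RHS]mxE -dz_slice.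
Qed.

Let Gis : mx_smooth W (fun p => invmx (G p)).
Proof. by apply: mx_smooth_inv => // p /Gpos; exact: posdef_unit. Qed.

Lemma curvature_slice t z p q i m : W (t, z) ->
  curvature (fun w => G (t, w)) z p q i m =
  - ((dmx (Dz p) (dmx (Db q) G) (t, z) - dmx (Dz p) G (t, z) *m invmx (G (t, z)) *m
      dmx (Db q) G (t, z)) *m invmx (G (t, z))) i m.
Proof.
move=> Wp; rewrite /curvature; congr (- _).
pose F y := (dmx (Dz p) G y *m invmx (G y)) i m.
have -> : (fun w => christoffel (fun w => G (t, w)) w p i m) = (fun w => F (t, w)).
  by apply/funext => w; exact: christoffel_slice.
apply: etrans (dzb_slice q F t z) _; apply: etrans (esym (dmxE _ _ _ _ _)) _.
have Ds : mx_smooth W (dmx (Dz p) G) by exact: mx_smooth_dmx.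
have E := dmx_inv oW (Db q) Wp Gs (fun y Wy => posdef_unit (Gpos Wy)).
apply: etrans (congr1 (fun X : 'M[C]_n => X i m) (dmx_mul oW (Db q) Wp Ds Gis)) _.
rewrite E (dmx_sym oW (Db q) (Dz p) Wp Gs).
by congr (fun_of_matrix _ i m); rewrite mulmxN mulmxBl !mulmxA.
Qed.

Hypothesis flowG : forall t z i j, W (t, z) ->
  fapp dtop (fun p => G p i j) (t, z) =
  (- curvS (fun w => G (t, w)) z + torsQ (fun w => G (t, w)) z) i j.

(** Lowering the last index of the curvature with [G] cancels the trailing inverse metric, and the
    factor [- 'i], needed to match the potential, drops out of the quadratic torsion term since it
    has modulus one. *)
Lemma metric_flow p : W p -> dmx dtop G p = \sum_k \sum_q invmx (G p) q k *:
  (dmx (Dz k) (dmx (Db q) G) p - dmx (Dz k) G p *m invmx (G p) *m dmx (Db q) G p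
   + (- 'i%R *: tor G q p) *m (invmx (G p))^T *m ctr (- 'i%R *: tor G k p)).
Proof.
case: p => t z Wp; apply/matrixP => i j; rewrite dmxE flowG // [LHS]mxE [X in X + _]mxE.
rewrite [X in - X]mxE [X in _ + X]mxE.
have Gu : G (t, z) \in unitmx by exact/posdef_unit/Gpos.
set X := fun k q : 'I_n => dmx (Dz k) (dmx (Db q) G) (t, z)
  - dmx (Dz k) G (t, z) *m invmx (G (t, z)) *m dmx (Db q) G (t, z).
set Gi := invmx (G (t, z)).
have -> : \sum_p \sum_q ginv (fun w => G (t, w)) z q p *
    \sum_m curvature (fun w => G (t, w)) z p q i m * G (t, z) m j =
    - \sum_p \sum_q Gi q p * X p q i j.
  rewrite -sumrN; apply: eq_bigr => p _; rewrite -sumrN; apply: eq_bigr => q _.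
  rewrite -mulrN; apply: (congr1 ( *%R _)).
  apply: etrans (_ : _ = - (X p q *m invmx (G (t, z)) *m G (t, z)) i j) _; last first.
    by rewrite mulmxKV.
  rewrite [in RHS]mxE -sumrN; apply: eq_bigr => m _.
  by rewrite (curvature_slice _ _ _ _ Wp) mulNr.
rewrite opprK.
have -> : \sum_k \sum_l \sum_m \sum_r ginv (fun w => G (t, w)) z l k *
      ginv (fun w => G (t, w)) z r m *
      torsion (fun w => G (t, w)) z i k r * (torsion (fun w => G (t, w)) z j l m)^*%C =
    \sum_m \sum_r Gi r m * (tor G r (t, z) *m Gi^T *m ctr (tor G m (t, z))) i j.
  under eq_bigr do rewrite exchange_big.
  rewrite exchange_big; apply: eq_bigr => m _.
  under eq_bigr do rewrite exchange_big.
  rewrite exchange_big; apply: eq_bigr => r _.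
  rewrite exchange_big [in RHS]mxE mulr_sumr; apply: eq_bigr => l _.
  rewrite [in RHS]mxE mulr_suml mulr_sumr; apply: eq_bigr => k _.
  rewrite ctrE !torE [in RHS]mxE -/Gi.
  move: (torsion _ _ _ _ _) ((torsion _ _ _ _ _)^*%C) => u v.
  by rewrite /ginv -/Gi; ring.
rewrite -big_split summxE; apply: eq_bigr => k _.
rewrite -big_split summxE; apply: eq_bigr => q _.
rewrite [RHS]mxE [X in _ = _ * X]mxE mulrDr; congr (_ + _ * _).
rewrite ctr_scale -!scalemxAl -scalemxAr scalerA.
have -> : - 'i%R * (- 'i%R)^*%C = 1 :> C; last by rewrite scale1r.
by apply: ReIm_eq; rewrite /= ?mul0r ?oppr0 ?mulr0 ?add0r ?mulrN ?mulNr ?opprK ?mulr1 ?addr0 ?subr0 //.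
Qed.

Hypothesis flowA : forall t z j, W (t, z) ->
  fapp dtop (fun p => A p 0 j) (t, z) = reduced_rhs tau (fun w => G (t, w)) H mu z 0 j.

(** Up to the factor i, [V] is delbar-star of the metric, written as the trace of the torsion. [L]
    is the logarithm that disappears once [del] is applied. *)
Let V j p : C := \sum_k \sum_q invmx (G p) q k * tor G q p j k.
Let L p : C := (ln (complex.Re (\det (G p) / \det (H p.2))))%:C.

Let Ls : smooth_on W L.
Proof.
apply: (smooth_ln oW (f := fun p => \det (G p) / \det (H p.2))).
  move=> p Wp; have := divr_gt0 (posdef_det_gt0 (Gpos Wp)) (posdef_det_gt0 (Hpos (WU Wp))).
  by rewrite ltcE => /andP[].
apply: smooth_mul => //; first exact: smooth_det.
apply: smooth_inv => //; last first.
  by apply: (smooth_snd WU (h := fun z => \det (H z))); exact: smooth_det.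
by move=> p /WU /Hpos /posdef_det_gt0 /lt0r_neq0.
Qed.

Let Vs j : smooth_on W (V j).
Proof.
apply: smooth_sum => // k; apply: smooth_sum => // q.
exact: (smooth_mul oW (Gis q k) (mx_smooth_tor q Gs j k)).
Qed.

Lemma form_flow j p : W p -> fapp dtop (Aj j) p =
  'i%R * V j p - 'i%R / 2 * fapp (Dz j) L p - (tau^-1)%:C * mj j p.
Proof.
case: p => t z Wp; apply: etrans (flowA _ Wp) _.
rewrite /reduced_rhs /delbar_star !mxE.
congr (_ - _ * _ - _).
- congr (_ * _); apply: eq_bigr => k _; apply: eq_bigr => q _.
  by rewrite torE /torsion.
- exact: (dz_slice j L).
Qed.

Lemma fapp_dtop_fst (p : S) : fapp dtop (fun p : S => (p.1)%:C) p = 1.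
Proof.
case: p => t z; apply: etrans (fapp_dtop _ _ _) _; apply: ReIm_eq.
  exact: (derive_id (V := R^o) t 1).
exact: (derive_cst (V := R^o) (W := R^o) 0).
Qed.

Lemma fapp_V i j p : W p -> fapp (Dz i) (V j) p =
  \sum_k \sum_q (- (invmx (G p) *m dmx (Dz i) G p *m invmx (G p))) q k * tor G q p j k
  + \sum_k \sum_q invmx (G p) q k * fapp (Dz i) (fun p => tor G q p j k) p.
Proof.
move=> Wp.
have s2 k q : smooth_on W (fun p => tor G q p j k) by exact: mx_smooth_tor.
have s3 k q : smooth_on W (fun p => invmx (G p) q k * tor G q p j k).
  exact: (smooth_mul oW (Gis q k) (s2 k q)).
apply: etrans (fapp_sum oW _ _ Wp (fun k => smooth_sum oW _ (fun q => s3 k q))) _.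
rewrite -big_split; apply: eq_bigr => k _.
apply: etrans (fapp_sum oW _ _ Wp (fun q => s3 k q)) _.
rewrite -big_split; apply: eq_bigr => q _.
apply: etrans (fapp_mul _ Wp (Gis q k) (s2 k q)) _.
apply: (congr2 +%R) => //; apply: (congr1 ( *%R^~ _)).
apply: etrans (esym (dmxE _ (fun p => invmx (G p)) _ _ _)) _.
by rewrite (dmx_inv oW _ Wp Gs (fun y Wy => posdef_unit (Gpos Wy))).
Qed.

(** For fixed [q] the torsion is [del] of the (1,0)-form given by column [q] of [G], so its own
    [del] vanishes. *)
Lemma fapp_tor_cyclic i j k q p : W p ->
  fapp (Dz i) (fun p => tor G q p j k) p - fapp (Dz j) (fun p => tor G q p i k) p =
  - fapp (Dz k) (fun p => tor G q p i j) p.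
Proof.
move=> Wp.
have E a b c : fapp (Dz a) (fun p => tor G q p b c) p =
    fapp (Dz a) (fapp (Dz b) (fun p => G p c q)) p -
    fapp (Dz a) (fapp (Dz c) (fun p => G p b q)) p.
  apply: etrans (fapp_ext (g := fun p => fapp (Dz b) (fun p => G p c q) p -
    fapp (Dz c) (fun p => G p b q) p) _ _ _) _; first by move=> y; rewrite mxE.
  exact: (fapp_sub oW _ Wp (smooth_fapp oW _ (Gs c q)) (smooth_fapp oW _ (Gs b q))).
rewrite !E (fapp_sym oW (Dz j) (Dz i) Wp (Gs k q)).
rewrite (fapp_sym oW (Dz k) (Dz i) Wp (Gs j q)) (fapp_sym oW (Dz k) (Dz j) Wp (Gs i q)).
move: (fapp (Dz i) (fapp (Dz j) (fun p => G p k q)) p) => u.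
move: (fapp (Dz i) (fapp (Dz k) (fun p => G p j q)) p) => v.
move: (fapp (Dz j) (fapp (Dz k) (fun p => G p i q)) p) => w.
ring.
Qed.

(** Apply [del] to [form_flow]. The term in [L] vanishes because del del = 0, and the one in [mu] is
    compensated by the time derivative of [t / tau]. In what remains, derivatives of the inverse
    metric are rearranged by [torsion_exchange] and those of the torsion by [fapp_tor_cyclic]. *)
Lemma potential_flow p : W p -> dmx dtop x p = \sum_k \sum_q invmx (G p) q k *:
  (- 'i%R *: dmx (Dz k) (tor G q) p
   - (- 'i%R *: tor G q p) *m (invmx (G p))^T *m (dmx (Dz k) G p)^T
   - dmx (Dz k) G p *m invmx (G p) *m (- 'i%R *: tor G q p)).
Proof.
move=> Wp; apply/matrixP => i j; rewrite dmxE.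
have Aij k l : fapp dtop (fapp (Dz k) (Aj l)) p = 'i%R * fapp (Dz k) (V l) p
    - 'i%R / 2 * fapp (Dz k) (fapp (Dz l) L) p - (tau^-1)%:C * fapp (Dz k) (mj l) p.
  rewrite (fapp_sym oW dtop (Dz k) Wp (As' l)).
  apply: etrans (fapp_eq oW _ Wp (fun y Wy => form_flow l (set_mem Wy))) _.
  have s0 c f : smooth_on W f -> smooth_on W (fun p => c * f p).
    by move=> fs; apply: smooth_mul => //; exact: smooth_cst.
  have s1 := s0 'i%R _ (Vs l).
  have s2 := s0 ('i%R / 2) _ (smooth_fapp oW (Dz l) Ls).
  have s3 := s0 (tau^-1)%:C _ (ms' l).
  have s4 : smooth_on W (fun p => 'i%R * V l p - 'i%R / 2 * fapp (Dz l) L p).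
    exact: (smooth_add oW s1 (smooth_opp oW s2)).
  apply: etrans (fapp_sub oW _ Wp s4 s3) _.
  apply: (congr2 (fun u v => u - v)); last exact: (fapp_scale _ _ Wp (ms' l)).
  apply: etrans (fapp_sub oW _ Wp s1 s2) _.
  apply: (congr2 (fun u v => u - v)); first exact: (fapp_scale _ _ Wp (Vs l)).
  exact: (fapp_scale _ _ Wp (smooth_fapp oW (Dz l) Ls)).
have mij k l : fapp dtop (fapp (Dz k) (mj l)) p = 0.
  rewrite (fapp_sym oW dtop (Dz k) Wp (ms' l)).
  apply: etrans (fapp_ext (g := cst 0) _ _ _) (fapp_cst _ _ _).
  by move=> y; exact: (fapp_dtop_snd (fun z => mu z 0 l)).
have ttt : fapp dtop tt p = (tau^-1)%:C.
  by apply: etrans (fapp_scale _ _ Wp cs) _; rewrite fapp_dtop_fst mulr1.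
have -> : fapp dtop (fun p => x p i j) p =
    'i%R * (fapp (Dz i) (V j) p - fapp (Dz j) (V i) p).
  apply: etrans (fapp_ext (g := fun p => (fapp (Dz i) (Aj j) p - fapp (Dz j) (Aj i) p)
    + tt p * (fapp (Dz i) (mj j) p - fapp (Dz j) (mj i) p)) _ _ _) _.
    by move=> y; rewrite mxE.
  have s1 := smooth_add oW (sA (Dz i) j) (smooth_opp oW (sA (Dz j) i)).
  have s2 := smooth_add oW (sm (Dz i) j) (smooth_opp oW (sm (Dz j) i)).
  apply: etrans (fapp_add _ Wp s1 (smooth_mul oW tts s2)) _.
  apply: etrans (congr2 +%R (fapp_sub oW _ Wp (sA _ j) (sA _ i)) (fapp_mul _ Wp tts s2)) _.
  have -> : fapp dtop (fun p => fapp (Dz i) (mj j) p + - fapp (Dz j) (mj i) p) p = 0.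
    by apply: etrans (fapp_sub oW _ Wp (sm _ j) (sm _ i)) _; rewrite !mij subrr.
  rewrite !Aij ttt (fapp_sym oW (Dz j) (Dz i) Wp Ls).
  move: (fapp (Dz i) (fapp (Dz j) L) p) (fapp (Dz i) (mj j) p) (fapp (Dz j) (mj i) p).
  move: (fapp (Dz i) (V j) p) (fapp (Dz j) (V i) p) (tt p) ((tau^-1)%:C : C).
  move=> v1 v2 v3 v4 v5 v6 v7; ring.
rewrite !fapp_V //.
set Gi := invmx (G p); set D := fun k => dmx (Dz k) G p; set T := fun q => tor G q p.
have TD q k l : T q k l = D k l q - D l k q.
  apply: etrans (mxE _ _ _ _) _; apply: (congr2 (fun u v => u - v)).
    exact: (esym (dmxE (Dz k) G p l q)).
  exact: (esym (dmxE (Dz l) G p k q)).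
have E := torsion_exchange Gi i j TD.
rewrite -/(D i) -/(D j).
have -> (a b a' b' : C) : a + b - (a' + b') = a - a' + (b - b') by ring.
rewrite (_ : \sum_k \sum_q _ - \sum_k \sum_q _ = \sum_p \sum_q Gi q p * ((T q *m Gi^T *m (D p)^T) i j + (D p *m Gi *m T q) i j)); last exact: E.
rewrite -sumrB -big_split mulr_sumr summxE; apply: eq_bigr => k _.
rewrite -sumrB -big_split mulr_sumr summxE; apply: eq_bigr => q _.
rewrite -mulrBr fapp_tor_cyclic //.
apply: etrans (congr1 ( *%R 'i%R) (esym (mulrDr _ _ _))) _.
rewrite [RHS]mxE mulrCA; apply: (congr1 ( *%R _)).
have mxS (c : C) (X Y Z : 'M[C]_n) :
    (c *: X - c *: Y - c *: Z) i j = c * (X i j - Y i j - Z i j).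
  by rewrite !mxE; ring.
rewrite -!scalemxAl -scalemxAr mxS -/(T q) -/(D k) dmxE -/(T q).
move: ((T q *m Gi^T *m (D k)^T) i j) ((D k *m Gi *m T q) i j) => u v.
move: (fapp (Dz k) (fun p => tor G q p i j) p) => w.
ring.
Qed.

Hypothesis G0pos : forall z, U z -> posdef (G0 z).

Let K (p : S) := ref_metric G0 p.2.
Let f p := \tr (K p *m gmet (G p) (invmx (G p))^T (x p)).

Lemma tor_background q t z : tor G0' q (t, z) = ref_torsion G0 q z.
Proof. by apply/matrixP => i j; rewrite torE mxE. Qed.

Lemma curv_err_background p q t z :
  curv_err K (fun i => Dz i) (t, z) (fun q => - 'i%R *: tor G0' q (t, z))
    (fun k q => - 'i%R *: dmx (Dz k) (tor G0' q) (t, z)) p q = ref_curv_err G0 p q z.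
Proof.
have e1 d : dmx (liftop d) K (t, z) = dmx d (ref_metric G0) z by exact: dmx_liftop.
have e2 d e : dmx (liftop d) (dmx (liftop e) K) (t, z) = dmx d (dmx e (ref_metric G0)) z.
  rewrite dmx_liftop; congr (dmx d _ z); apply/funext => w; exact: dmx_liftop.
have e3 r : tor G0' r (t, z) = ref_torsion G0 r z by exact: tor_background.
have e4 d r : dmx (liftop d) (tor G0' r) (t, z) = dmx d (ref_torsion G0 r) z.
  rewrite dmx_liftop; congr (dmx d _ z); apply/funext => w; exact: tor_background.
rewrite /ref_curv_err /curv_err /twist_K2 /twist_K1 /twist_K1b !fconj_liftop.
by rewrite !e1 !e2 !e3 !e4.
Qed.

(** [tor_potential] does double duty: it shows the twisted derivative of the potential to be skew,
    and it turns the torsion in both flow equations into that twisted derivative. *)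
Lemma local_evolution p : W p -> complex.Re (fapp dtop f p) <=
  complex.Re (\sum_k \sum_q invmx (G p) q k * fapp (Dz k) (fapp (Db q) f) p) +
  complex.Re (\tr (invmx (G p)) * ref_bound G0 p.2 *
    (\tr (invmx (ref_metric G0 p.2)) * f p)).
Proof.
move=> Wp.
have Ks : mx_smooth W K.
  by move=> i j; exact: (smooth_snd WU (mx_smooth_ref_metric oU G0s G0pos i j)).
have Kp y : W y -> posdef (K y) by move=> /WU /G0pos; exact: posdef_ref_metric.
have Kt0 : dmx dtop K p = 0.
  apply/matrixP => i j; rewrite dmxE [RHS]mxE.
  exact: (fapp_dtop_snd (fun z => ref_metric G0 z i j)).
have skew q : (dmx (Db q) x p + (- 'i%R *: tor G0' q p))^T =
    - (dmx (Db q) x p + (- 'i%R *: tor G0' q p)).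
  by rewrite tor_potential // linearZ /= tor_skew scalerN.
have flow := twisted_flow oW Gs xs Gpos (Dp := fun i => Dz i) (Dt := dtop) Wp
  (b := fun q => - 'i%R *: tor G0' q p)
  (b' := fun k q => - 'i%R *: dmx (Dz k) (tor G0' q) p) fconj_dtop skew _ _.
have evo := trace_gmet_evolution oW Gs xs Ks Gpos Kp Wp Kt0 (flow _ _).
apply: le_trans (evo _ _) _.
- apply: etrans (metric_flow Wp) _; apply: eq_bigr => k _; apply: eq_bigr => q _.
  apply: (congr1 (fun X => invmx (G p) q k *: (dmx (Dz k) (dmx (Db q) G) p
    - dmx (Dz k) G p *m invmx (G p) *m dmx (Db q) G p + X))).
  exact: (congr2 (fun X Y => X *m (invmx (G p))^T *m ctr Y)
    (esym (tor_potential q Wp)) (esym (tor_potential k Wp))).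
- apply: etrans (potential_flow Wp) _; apply: eq_bigr => k _; apply: eq_bigr => q _.
  apply: (congr1 (fun X => invmx (G p) q k *: X)).
  apply: etrans (congr1 (fun X => - 'i%R *: dmx (Dz k) (tor G q) p
      - X *m (invmx (G p))^T *m (dmx (Dz k) G p)^T
      - dmx (Dz k) G p *m invmx (G p) *m X) (esym (tor_potential q Wp))) _.
  exact: (congr1 (fun Y => Y - (dmx (Db q) x p + - 'i%R *: tor G0' q p) *m
      (invmx (G p))^T *m (dmx (Dz k) G p)^T - dmx (Dz k) G p *m invmx (G p) *m
      (dmx (Db q) x p + - 'i%R *: tor G0' q p)) (esym (dmx_tor_potential k q Wp))).
case: p Wp {Kt0 skew flow evo} => t z Wp.
apply: lerD; first exact: lexx.
rewrite le_eqVlt; apply/orP; left; apply/eqP.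
apply: (congr1 (fun B => complex.Re (\tr (invmx (G (t, z))) * B *
  (\tr (invmx (ref_metric G0 z)) * f (t, z))))).
do 4!(apply: eq_bigr => ? _); apply: (congr1 (fun Y : 'M[C]_(n + n) => `|Y _ _|)).
exact: curv_err_background.
Qed.

End LocalFlow.

(** * Passing between charts *)

Section Energy.
Context {R : realType} {n : nat}.
Local Notation C := R[i].
Implicit Types (G g J x : 'M[C]_n).

(** The function f as an expression in three matrices, so that its invariance under changes of chart
    becomes matrix algebra. *)
Definition energy g G x : C := \tr (diag2 (invmx g) g^T *m gmet G (invmx G)^T x).

Definition qnorm G x : C := \tr (invmx G *m (x *m (invmx G)^T *m ctr x)).

Lemma energyE g G x : energy g G x = \tr (invmx g *m G)
  + \tr (invmx g *m (x *m (invmx G)^T *m ctr x)) + \tr (g^T *m (invmx G)^T).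
Proof.
have E1 (P : 'M[C]_n) : unip x *m diag2 G P = block_mx G (x *m P) 0 P.
  by rewrite /unip /diag2 mulmx_block !mul1mx !mulmx0 !mul0mx !addr0 !add0r.
have E2 (P : 'M[C]_n) : block_mx G (x *m P) 0 P *m ctr (unip x) =
    block_mx (G + x *m P *m ctr x) (x *m P) (P *m ctr x) P.
  rewrite /unip ctr_block ctr0 !ctr1 mulmx_block !mulmx1 !mulmx0 ?mul0mx.
  by rewrite !add0r.
have E3 (A B D X Y T : 'M[C]_n) :
    \tr (diag2 A B *m block_mx D X Y T) = \tr (A *m D) + \tr (B *m T).
  by rewrite /diag2 mulmx_block mxtrace_block !mul0mx addr0 add0r.
by rewrite /energy /gmet E1 E2 E3 mulmxDr mxtraceD.
Qed.

Lemma norm2_20E (F : Cn R n -> 'M[C]_n) z x : norm2_20 F z x = qnorm (F z) x.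
Proof.
rewrite /norm2_20 /qnorm mulmxA.
transitivity (\sum_k \sum_i \sum_j \sum_l
    invmx (F z) k i * invmx (F z) l j * x i j * (x k l)^*%C).
  under eq_bigr do rewrite exchange_big.
  by rewrite exchange_big.
apply: eq_bigr => k _; rewrite [RHS]mxE.
under eq_bigr do rewrite exchange_big.
rewrite exchange_big; apply: eq_bigr => l _.
rewrite mulmxA ctrE mxE mulr_suml exchange_big; apply: eq_bigr => j _.
rewrite !mxE !mulr_suml; apply: eq_bigr => i _.
move: ((x k l)^*%C) => u; ring.
Qed.

Lemma invmx_congr J G : J \in unitmx -> G \in unitmx ->
  invmx (J *m G *m ctr J) = ctr (invmx J) *m invmx G *m invmx J.
Proof.
move=> uJ uG; have ucJ : ctr J \in unitmx by rewrite ctr_unit.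
have uJG : J *m G *m ctr J \in unitmx by rewrite !unitmx_mul uJ uG.
apply: (can_inj (mulKmx uJG)); rewrite mulmxV // ctr_inv !mulmxA.
by rewrite mulmxK // mulmxK // mulmxV.
Qed.

(** A (2,0)-form changes by [J x J^T] and a metric by [J G J^*]; the inner factors meet their
    inverses. *)
Lemma conj_term_congr J x (P : 'M[C]_n) : J \in unitmx ->
  J *m x *m J^T *m (ctr (invmx J) *m P *m invmx J)^T *m ctr (J *m x *m J^T) =
  J *m (x *m P^T *m ctr x) *m ctr J.
Proof.
move=> uJ.
have cancel (A X K K' Q L' L Y B : 'M[C]_n) : K *m K' = 1%:M -> L' *m L = 1%:M ->
    A *m X *m K *m (K' *m Q *m L') *m (L *m Y *m B) = A *m (X *m Q *m Y) *m B.
  move=> E1 E2; rewrite !mulmxA -(mulmxA _ K K') E1 mulmx1.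
  by rewrite -(mulmxA _ L' L) E2 mulmx1.
have -> : (ctr (invmx J) *m P *m invmx J)^T = (invmx J)^T *m P^T *m (ctr (invmx J))^T.
  by rewrite trmx_mul trmx_mul mulmxA.
have -> : ctr (J *m x *m J^T) = (ctr J)^T *m ctr x *m ctr J.
  by rewrite ctr_mul ctr_mul ctr_tr mulmxA.
apply: cancel; rewrite -trmx_mul -?ctr_mul mulVmx // ?ctr1 trmx1 //.
Qed.

Lemma trace_congr J (A X : 'M[C]_n) : J \in unitmx ->
  \tr (ctr (invmx J) *m A *m invmx J *m (J *m X *m ctr J)) = \tr (A *m X).
Proof.
move=> uJ; rewrite -!mulmxA mxtrace_mulC -!mulmxA -ctr_mul mulVmx // ctr1 mulmx1.
by rewrite mulKmx.
Qed.

Lemma trace_conj_term_congr J g G x : J \in unitmx -> g \in unitmx -> G \in unitmx ->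
  \tr (invmx (J *m g *m ctr J) *m (J *m x *m J^T *m
    (invmx (J *m G *m ctr J))^T *m ctr (J *m x *m J^T))) =
  \tr (invmx g *m (x *m (invmx G)^T *m ctr x)).
Proof.
move=> uJ ug uG.
have subst (A B A' B' X : 'M[C]_n) : A = A' -> B = B' ->
    J *m x *m J^T *m B'^T *m ctr (J *m x *m J^T) = X ->
    \tr (A *m (J *m x *m J^T *m B^T *m ctr (J *m x *m J^T))) = \tr (A' *m X).
  by move=> -> -> ->.
apply: etrans _ (trace_congr _ _ uJ).
exact: subst (invmx_congr uJ ug) (invmx_congr uJ uG) (conj_term_congr x _ uJ).
Qed.

Lemma qnorm_congr J G x : J \in unitmx -> G \in unitmx ->
  qnorm (J *m G *m ctr J) (J *m x *m J^T) = qnorm G x.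
Proof. by move=> uJ uG; exact: trace_conj_term_congr. Qed.

Lemma energy_congr J g G x : J \in unitmx -> g \in unitmx -> G \in unitmx ->
  energy (J *m g *m ctr J) (J *m G *m ctr J) (J *m x *m J^T) = energy g G x.
Proof.
move=> uJ ug uG.
have e1 (a b : 'M[C]_n) : a \in unitmx ->
    \tr (invmx (J *m a *m ctr J) *m (J *m b *m ctr J)) = \tr (invmx a *m b).
  by move=> ua; rewrite (invmx_congr uJ ua) (trace_congr _ _ uJ).
have e3 (A B : 'M[C]_n) : \tr (A^T *m B^T) = \tr (B *m A).
  by rewrite -trmx_mul mxtrace_tr.
apply: etrans (energyE _ _ _) _; apply: etrans _ (esym (energyE _ _ _)).
apply: (congr2 +%R); first exact: (congr2 +%R (e1 g G ug) (trace_conj_term_congr x uJ ug uG)).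
exact: etrans (e3 _ _) (etrans (e1 G g uG) (esym (e3 _ _))).
Qed.

End Energy.

(** * Charts, compactness and tensoriality of del *)

Section Charts.
Context {R : realType} {n : nat} (M : compact_complex_manifold R n).
Local Notation C := R[i].
Local Notation Z := (Cn R n).

Lemma overlapP (a b : atlas M) z : overlap a b z <->
  coord_patch a z /\ chart_dom b (inv_chart a z).
Proof.
split=> [[y [ya yb] <-]|[[y ya <-]]].
  by rewrite chartK //; split => //; exists y.
by rewrite chartK // => yb; exists y.
Qed.

Lemma coord_patch_inv (a : atlas M) z : coord_patch a z ->
  chart_dom a (inv_chart a z) /\ chart a (inv_chart a z) = z.
Proof. by case=> y ya <-; rewrite chartK. Qed.

Lemma open_coord_patch (a : atlas M) : open (coord_patch a).
Proof. exact: chart_image_open. Qed.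

Lemma inv_chart_near (a : atlas M) z : coord_patch a z ->
  {for z, continuous (inv_chart a)}.
Proof.
move=> az; have := @inv_chart_continuous _ _ M a.
rewrite continuous_open_subspace; last exact: chart_image_open.
by apply; rewrite inE.
Qed.

Lemma chart_near (a : atlas M) x : chart_dom a x -> {for x, continuous (chart a)}.
Proof.
move=> ax; have := @chart_continuous _ _ M a.
rewrite continuous_open_subspace; last exact: chart_dom_open.
by apply; rewrite inE.
Qed.

Lemma open_overlap (a b : atlas M) : open (overlap a b).
Proof.
rewrite openE => z /overlapP[az bz].
have H1 : \forall w \near z, coord_patch a w.
  by apply: open_nbhs_nbhs; split=> //; exact: open_coord_patch.
have H2 : \forall w \near z, chart_dom b (inv_chart a w).
  apply: (inv_chart_near az); apply: open_nbhs_nbhs; split=> //.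
  exact: chart_dom_open.
by near=> w; apply/overlapP; split; near: w.
Unshelve. all: by end_near. Qed.

Lemma transition_patch (a b : atlas M) z : overlap a b z -> coord_patch b (transition a b z).
Proof. by move=> /overlapP[_ bz]; exists (inv_chart a z). Qed.

(** As [q] may depend on the chart, the bound is claimed only in some chart at each point. Locally
    one chart and continuity suffice, and compactness makes the bound uniform. *)
Lemma atlas_bound (q : atlas M -> Z -> R) :
  (forall a z, coord_patch a z -> {for z, continuous (q a)}) ->
  exists2 B : R, 0 <= B &
    forall x : M, exists a, chart_dom a x /\ q a (chart a x) <= B.
Proof.
move=> qc.
(* The near-covering form of compactness, with the bound [B] near [+oo], replaces the extraction of
   a finite subcover. *)
have /compact_near_coveringP cov := @carrier_compact _ _ M.
have near_bound : forall x : M, [set: M] x -> \forall x' \near x & B \near +oo%R,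
    (fun B x => exists a, chart_dom a x /\ q a (chart a x) <= B) B x'.
  move=> x _; have [a ax] := chart_dom_cover x.
  have az : coord_patch a (chart a x) by exists x.
  have qx : {for x, continuous (q a \o chart a)}.
    by apply: continuous_comp; [exact: chart_near|exact: qc].
  exists ([set x' | chart_dom a x' /\ q a (chart a x') < q a (chart a x) + 1],
    [set B | q a (chart a x) + 1 < B]) => /=.
    split; last by apply: nbhs_pinfty_gt; rewrite num_real.
    apply: filterI; first by apply: open_nbhs_nbhs; split=> //; exact: chart_dom_open.
    have : nbhs ((q a \o chart a) x) [set r | r < q a (chart a x) + 1].
      by apply: open_nbhs_nbhs; split; [exact: open_lt|rewrite /= ltrDl].
    by move=> /qx.
  case=> x' B [/= [ax' qx'] qB]; exists a; split=> //.
  exact: ltW (lt_trans qx' qB).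
have oF : Filter (@pinfty_nbhs R) by exact: _.
have H := cov R +oo%R _ oF near_bound.
have [B [B0 HB]] := filter_ex (filterI (nbhs_pinfty_ge (real0 R)) H).
by exists B => // x; exact: HB.
Qed.

Definition jac_mx (a b : atlas M) z : 'M[C]_n := \matrix_(i, k) jac a b z i k.

Lemma tensorial11_mx (g : field11 M) a b z : tensorial11 g -> overlap a b z ->
  g a z = jac_mx a b z *m g b (transition a b z) *m ctr (jac_mx a b z).
Proof.
move=> gt abz; apply/matrixP => i j; rewrite (gt a b z i j abz) exchange_big mxE.
apply: eq_bigr => l _; rewrite ctrE mxE mulr_suml; apply: eq_bigr => k _.
by rewrite !mxE mulrAC.
Qed.

(** The metric in chart [a] is invertible and has the Jacobian as a factor. *)
Lemma jac_mx_unit (g : field11 M) a b z : hermitian_metric g -> overlap a b z ->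
  jac_mx a b z \in unitmx.
Proof.
move=> [gt _ gp] abz; have /overlapP[az _] := abz.
have := posdef_unit (gp a z az).
by rewrite (tensorial11_mx gt abz) !unitmx_mul => /andP[/andP[]].
Qed.

(** Derivatives of the Jacobian are second derivatives of the transition map, symmetric in [i] and
    [j], and drop out on antisymmetrising. *)
Lemma del_tensorial (g : field11 M) (alpha : field10 M) a b z :
  hermitian_metric g -> form10 alpha -> overlap a b z ->
  del (alpha a) z = jac_mx a b z *m del (alpha b) (transition a b z) *m (jac_mx a b z)^T.
Proof.
move=> gm [at10 asm] abz.
have oO : open (overlap a b) by exact: open_overlap.
have [phis hol] : (forall k, smooth_on (overlap a b) (fun z => zcoord k (transition a b z)))
    /\ (forall k j z, overlap a b z ->
          dzb j (fun w => zcoord k (transition a b w)) z = 0).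
  have Ht := @transition_holomorphic _ _ M a b; split=> k; first by have [] := Ht k.
  by have [] := Ht k.
have Uz := transition_patch abz.
have sj i k : smooth_on (overlap a b) (fun w => jac a b w i k).
  by rewrite /jac; under eq_fun do rewrite dzE; exact: smooth_fapp.
have dal i j : dz i (fun w => alpha a w 0 j) z =
    \sum_k (dz i (fun w => jac a b w j k) z * alpha b (transition a b z) 0 k
      + jac a b z j k * \sum_l jac a b z i l *
          dz l (fun w => alpha b w 0 k) (transition a b z)).
  have sal k : smooth_on (overlap a b) (fun w => alpha b (transition a b w) 0 k).
    have Js : mx_smooth (overlap a b) (fun w => invmx (jac_mx a b w)).
      apply: mx_smooth_inv => // [w|i' j']; first exact: jac_mx_unit gm.
      by under eq_fun do rewrite mxE; exact: sj.
    (* smoothness of a composition is avoided by inverting the Jacobian *)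
    apply: (smooth_eq oO (f := fun w => \sum_l invmx (jac_mx a b w) k l * alpha a w 0 l)).
      move=> w; rewrite inE => abw.
      have -> : alpha b (transition a b w) 0 k = (alpha b (transition a b w))^T k 0.
        by rewrite mxE.
      rewrite -(mulKmx (jac_mx_unit gm abw) (alpha b (transition a b w))^T) mxE.
      apply: eq_bigr => l _; rewrite (at10 a b w l abw) [in RHS]mxE; congr (_ * _).
      by apply: eq_bigr => m _; rewrite !mxE.
    apply: smooth_sum => // l; apply: (smooth_mul oO (Js k l)).
    apply: smooth_subset (asm a l) => w /overlapP[]; by [].
  rewrite dzE.
  apply: etrans (fapp_eq oO _ abz (g := fun w => \sum_k jac a b w j k *
     alpha b (transition a b w) 0 k) _) _.
    by move=> w; rewrite inE => abw; exact: at10.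
  apply: etrans (fapp_sum oO _ _ abz (fun k => smooth_mul oO (sj j k) (sal k))) _.
  apply: eq_bigr => k _; apply: etrans (fapp_mul _ abz (sj j k) (sal k)) _.
  rewrite -!dzE; apply: (congr2 +%R erefl); apply: (congr1 ( *%R _)).
  exact: (dz_comp (@open_coord_patch b) phis abz Uz (asm b k)
    (fun l => hol l i z abz)).
apply/matrixP => i j; rewrite mxE !dal.
have sym k : dz i (fun w => jac a b w j k) z = dz j (fun w => jac a b w i k) z.
  rewrite /jac !dzE; under [in LHS]eq_fun do rewrite dzE.
  under [in RHS]eq_fun do rewrite dzE.
  exact: (fapp_sym oO _ _ abz (phis k)).
rewrite -sumrB.
under eq_bigr do rewrite -sym opprD addrACA subrr add0r.
rewrite sumrB mxE.
under [RHS]eq_bigr do rewrite mxE mulr_suml.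
under [X in X - _]eq_bigr do rewrite mulr_sumr.
under [X in _ - X]eq_bigr do rewrite mulr_sumr.
rewrite [X in X - _]exchange_big -sumrB exchange_big.
under [in LHS]eq_bigr do rewrite -sumrB.
apply: eq_bigr => l _; apply: eq_bigr => k _; rewrite !mxE.
move: (dz l (fun w => alpha b w 0 k) _) (dz k (fun w => alpha b w 0 l) _) => u v.
move: (jac a b z i l) (jac a b z j k) => s t; ring.
Qed.

End Charts.

(** * The maximum principle on the manifold *)

Section ParabolicMaximum.
Context {R : realType}.

Lemma is_derive_exp_scale (c t : R) :
  is_derive t (1 : R) (fun s => expR (- c * s)) (- c * expR (- c * t)).
Proof.
have H : is_derive t (1 : R) (fun s : R => - c * s) (- c).
  rewrite (_ : (fun s => _) = - c \*: (@idfun R : R -> R)); last by apply/funext.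
  by apply: is_derive_eq; exact: mulr1.
have := is_derive1_comp (is_derive_expR (- c * t)) H.
by rewrite mulrC.
Qed.

(** Only earlier times are compared, so the sign is read off difference quotients from the left, as
    the maximum principle on [[0, t1]] requires. *)
Lemma exp_weight_left_max (f : R -> R) (c d t : R) : 0 < t -> is_derive t 1 f d ->
  (forall s, 0 < s <= t -> expR (- c * s) * f s <= expR (- c * t) * f t) ->
  c * f t <= d.
Proof.
move=> t0 fd fmax.
pose g : R -> R := (fun s => expR (- c * s)) * f.
have [gd gE] : is_derive t 1 g (expR (- c * t) * d - c * expR (- c * t) * f t).
  apply: is_derive_eq (is_deriveM (is_derive_exp_scale c t) fd) _.
  by rewrite /GRing.scale /= !mulNr mulrN [f t * _]mulrC.
have gl : 0 <= 'D_1 g t.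
  rewrite /derive.
  have gl : h^-1 *: ((g \o shift t) (h *: (1 : R)) - g t) @[h --> 0^'-] --> 'D_1 g t.
    by apply: cvg_dnbhs_at_left; exact: gd.
  rewrite -/(derive g t 1) -(cvg_lim _ gl) //.
  apply: limr_ge; first by apply/cvg_ex; eexists; exact: gl.
  near=> h; have h0 : h < 0 by near: h; exact: nbhs_left_lt.
  have ht : - t < h by near: h; apply: nbhs_left_gt; rewrite oppr_lt0.
  rewrite /GRing.scale /= mulr1; apply: mulr_le0; first by rewrite invr_le0 ltW.
  rewrite subr_le0 /g; apply: (fmax (h + t)).
  by rewrite -[X in X < _](addNr t) ltrD2r ht /= gerDr ltW.
move: gl; rewrite gE [c * _]mulrC -mulrA -mulrBr pmulr_rge0 ?expR_gt0 //.
by rewrite subr_ge0.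
Unshelve. all: by end_near. Qed.

(** The weighted function attains its maximum over [[0, t1] x X]: at time 0 it is at most [K], and
    at a later time the last hypothesis makes it nonpositive. Continuity is asked of a local
    extension [v] because [u] is meaningful only on [[0, tau)]. *)
Lemma parabolic_max_principle (X : topologicalType) (tau c K : R) (u : R -> X -> R) :
  compact [set: X] -> 0 <= K ->
  (forall x, u 0 x <= K) ->
  (forall t x, 0 <= t < tau -> exists2 v : R * X -> R,
    {for (t, x), continuous v} &
    \forall p \near (t, x), 0 <= p.1 < tau -> u p.1 p.2 = v p) ->
  (forall t x, 0 < t < tau ->
    (forall s y, 0 <= s <= t -> expR (- c * s) * u s y <= expR (- c * t) * u t x) ->
    u t x <= 0) ->
  forall t x, 0 <= t < tau -> u t x <= K * expR (c * t).
Proof.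
move=> cX K0 u0 uc umax t1 x1 /andP[t10 t1tau].
(* Clamping time to [[0, t1]] makes the weighted function continuous on all of [R * X], including
   across time 0. *)
pose cl (s : R) : R := Num.min (Num.max s 0) t1.
have cl_in s : 0 <= cl s <= t1 by rewrite /cl le_min le_max lexx orbT t10 ge_min lexx orbT.
have cl_id s : 0 <= s <= t1 -> cl s = s.
  by move=> /andP[s0 s1]; rewrite /cl max_l // min_l.
have clc : continuous cl.
  have -> : cl = ((@idfun R) \max cst 0)%O \min cst t1 by apply/funext.
  move=> s; have cc (r : R) : {for s, continuous (cst r : R -> R)} by exact: cvg_cst.
  have ci : {for s, continuous (@idfun R)} by exact: cvg_id.
  exact: (continuous_min (continuous_max ci (cc 0)) (cc t1)).
pose w (p : R * X) : R := expR (- c * cl p.1) * u (cl p.1) p.2.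
have wc : continuous w.
  case=> s x; have cs : 0 <= cl s < tau.
    by have /andP[-> h] := cl_in s; rewrite (le_lt_trans h).
  have [v vc uv] := uc (cl s) x cs.
  pose k (p : R * X) := (cl p.1, p.2).
  have clp : {for (s, x), continuous (fun p : R * X => cl p.1)}.
    by apply: (@continuous_comp _ _ _ fst cl); [exact: cvg_fst|exact: clc].
  have kc : {for (s, x), continuous k}.
    apply: (@cvg_pair _ _ _ (nbhs (s, x)) (nbhs (cl s)) (nbhs x)).
      exact: clp.
    exact: cvg_snd.
  have vkc : {for (s, x), continuous (v \o k)} by exact: continuous_comp.
  have ec : {for (s, x), continuous (fun p : R * X => expR (- c * cl p.1))}.
    apply: (@continuous_comp _ _ _ (fun p : R * X => cl p.1) (fun r => expR (- c * r))).
      exact: clp.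
    apply: (@continuous_comp _ _ _ (fun r => - c * r) expR); last exact: continuous_expR.
    exact: mulrl_continuous.
  have uk : \forall p \near (s, x), u (cl p.1) p.2 = (v \o k) p.
    have kuv : nbhs (s, x)
        (k @^-1` (fun p : R * X => 0 <= p.1 < tau -> u p.1 p.2 = v p)) := kc _ uv.
    apply: (@filterS _ (nbhs (s, x)) _ _ _ _ kuv) => p /= H; apply: H.
    by have /andP[-> h] := cl_in p.1; rewrite (le_lt_trans h).
  have pc : {for (s, x), continuous (fun p => expR (- c * cl p.1) * (v \o k) p)}.
    exact: cvgM.
  rewrite /prop_for /continuous_at in pc *.
  rewrite {2}/w (nbhs_singleton uk); apply: cvg_trans pc; apply: near_eq_cvg.
  by apply: filterS uk => p E; rewrite /w E.
pose A : set (R * X) := [set` `[0, t1]] `*` [set: X].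
have cA : compact A by apply: compact_setX => //; exact: segment_compact.
have A0 : A !=set0 by exists (0, x1); split=> //=; rewrite in_itv /= lexx.
have [[t x] Atx wmax] := compact_EVT_max A0 cA (continuous_subspaceT wc).
have /andP[t0 tt1] : 0 <= t <= t1 by move: Atx; rewrite inE => -[/=]; rewrite in_itv.
have wle s y : 0 <= s <= t1 -> expR (- c * s) * u s y <= expR (- c * t) * u t x.
  move=> st; have := wmax (s, y); rewrite inE /w /= !cl_id ?t0 //; apply.
  by split=> //=; rewrite in_itv.
have wK : expR (- c * t) * u t x <= K.
  move: t0; rewrite le_eqVlt => /predU1P[<-|t0].
    by rewrite mulr0 expR0 mul1r.
  apply: le_trans K0; rewrite pmulr_rle0 ?expR_gt0 //; apply: umax.
    by rewrite t0 (le_lt_trans tt1).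
  by move=> s y /andP[s0 st]; apply: wle; rewrite s0 (le_trans st).
have := wle t1 x1; rewrite t10 lexx => /(_ isT) /le_trans /(_ wK).
by rewrite mulNr expRN ler_pdivrMl ?expR_gt0 // mulrC.
Qed.

End ParabolicMaximum.

(** * Localisation and space-time extensions of the solution *)

Section Germs.
Context {R : realType} {n : nat}.
Local Notation C := R[i].
Local Notation Z := (Cn R n).
Variables (U : set Z) (z : Z).
Hypotheses (oU : open U) (Uz : U z).

Lemma dz_eq_on i (f g : Z -> C) : {in U, f =1 g} -> dz i f z = dz i g z.
Proof. by move=> fg; rewrite !dzE; exact: fapp_eq fg. Qed.

Lemma dzb_eq_on i (f g : Z -> C) : {in U, f =1 g} -> dzb i f z = dzb i g z.
Proof. by move=> fg; rewrite !dzbE; exact: fapp_eq fg. Qed.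

Lemma del_eq_on (a b : Z -> 'rV[C]_n) : {in U, a =1 b} -> del a z = del b z.
Proof.
move=> ab; apply/matrixP => i j; rewrite !mxE.
by congr (_ - _); apply: dz_eq_on => w Uw; rewrite ab.
Qed.

End Germs.

Section MetricGerms.
Context {R : realType} {n : nat}.
Local Notation C := R[i].
Local Notation Z := (Cn R n).
Variables (U : set Z) (G G' : Z -> 'M[C]_n).
Hypotheses (oU : open U) (GG' : {in U, G =1 G'}).

Lemma torsion_eq_on z i j k : U z -> torsion G z i j k = torsion G' z i j k.
Proof.
move=> Uz; congr (_ - _); apply: (dz_eq_on oU Uz) => w Uw;
  exact: (congr1 (fun X : 'M[C]_n => X _ _) (GG' Uw)).
Qed.

Lemma torsQ_eq_on z : U z -> torsQ G z = torsQ G' z.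
Proof.
move=> Uz; apply/matrixP => i j; rewrite !mxE.
do 4!(apply: eq_bigr => ? _).
by rewrite /ginv (GG' (mem_set Uz)) !(torsion_eq_on _ _ _ Uz).
Qed.

Lemma curvS_eq_on z : U z -> curvS G z = curvS G' z.
Proof.
move=> Uz; have Uz' := mem_set Uz; apply/matrixP => i j; rewrite !mxE.
apply: eq_bigr => p _; apply: eq_bigr => q _.
have gi w : U w -> ginv G w = ginv G' w by move=> Uw; rewrite /ginv (GG' (mem_set Uw)).
apply: (congr2 *%R); first by rewrite gi.
apply: eq_bigr => m _; apply: (congr2 *%R); last by rewrite (GG' Uz').
apply: (congr1 (fun u => - u)); apply: (dzb_eq_on oU Uz) => w /set_mem Uw.
apply: eq_bigr => l _; apply: (congr2 *%R); first by rewrite gi.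
apply: (dz_eq_on oU Uw) => v Uv.
exact: (congr1 (fun X : 'M[C]_n => X _ _) (GG' Uv)).
Qed.

Lemma reduced_rhs_eq_on tau H mu z : U z ->
  reduced_rhs tau G H mu z = reduced_rhs tau G' H mu z.
Proof.
move=> Uz; apply: (congr1 (fun u => u - _)); apply: (congr2 (fun u v => u - v)).
  apply/rowP => i; rewrite mxE [RHS]mxE; apply: (congr1 ( *%R _)).
  apply: eq_bigr => p _; apply: eq_bigr => q _; apply: (congr2 *%R).
    by rewrite /ginv (GG' (mem_set Uz)).
  exact: torsion_eq_on.
apply/rowP => i; rewrite mxE [RHS]mxE; apply: (congr1 ( *%R _)).
by apply: (dz_eq_on oU Uz) => w Uw; rewrite (GG' Uw).
Qed.

End MetricGerms.

Section SpaceTime.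
Context {R : realType} {n : nat}.
Local Notation C := R[i].
Local Notation Z := (Cn R n).
Local Notation S := (R * Z)%type.

(** Each component comes with its own extension; finiteness keeps the intersection of their domains
    open. *)
Lemma smooth_families (I : finType) (tau : R) (U : set Z) (u : I -> R -> Z -> C) :
  (forall i, smooth_family tau U (u i)) ->
  exists (W : set S) (F : I -> S -> C), [/\ open W, forall i, smooth_on W (F i) &
    forall t z, 0 <= t < tau -> U z -> W (t, z) /\ forall i, F i (t, z) = u i t z].
Proof.
move=> us.
have /choice[WF H] : forall i, exists p : set S * (S -> C), [/\ open p.1, smooth_on p.1 p.2 &
    forall t z, 0 <= t < tau -> U z -> p.1 (t, z) /\ p.2 (t, z) = u i t z].
  by move=> i; have [W [F h]] := us i; exists (W, F).
exists [set p | forall i, (WF i).1 p], (fun i => (WF i).2); split.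
- rewrite openE => p Wp.
  apply: (@filter_forall _ I (fun i => (WF i).1) (nbhs p)) => i.
  have [oW _ _] := H i; apply: open_nbhs_nbhs; split=> //; exact: Wp.
- by move=> i; have [_ sF _] := H i; apply: smooth_subset sF => p; exact.
- move=> t z tt Uz; split=> i; have [_ _ h] := H i; by have [] := h t z tt Uz.
Qed.

(** Near an interior time the restriction to [[0, tau)] is void, so the derivative in [is_dt] is
    two-sided and is that of the extension [F]. *)
Lemma is_dt_fapp (tau : R) (F : S -> C) (u : R -> C) t z l : 0 < t < tau ->
  (forall s, 0 <= s < tau -> F (s, z) = u s) -> is_dt tau u t l ->
  fapp dtop F (t, z) = l.
Proof.
move=> /andP[t0 tt] Fu [d1 d2].
have in_near : \forall s \near t, 0 <= s < tau.
  have oI : open [set s : R | 0 < s < tau].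
    rewrite (_ : [set _ | _] = [set s | 0 < s] `&` [set s | s < tau]).
      by apply: openI; [exact: open_gt|exact: open_lt].
    by apply/seteqP; split=> s /= => [/andP|] [? ?] //; apply/andP.
  have : nbhs t [set s : R | 0 < s < tau] by apply: open_nbhs_nbhs; split=> //=; rewrite t0.
  by apply: filterS => s /= /andP[/ltW -> ->].
have tin : 0 <= t < tau by rewrite (ltW t0).
have aux (r : C -> R) (d : R) : (s - t)^-1 * (r (u s) - r (u t))
     @[s --> within [set` `[0, tau[] t^'] --> d -> 'D_1 (fun s => r (F (s, z))) t = d.
  move=> ud; apply: cvg_lim => //.
  have sh0 : (h + t) @[h --> (0 : R)] --> t.
    rewrite -[X in _ --> X]add0r; apply: cvgD; [exact: cvg_id|exact: cvg_cst].
  have in0 : \forall h \near (0 : R), 0 <= h + t < tau by exact: sh0 _ in_near.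
  have sh : (h + t) @[h --> (0 : R)^'] --> within [set` `[0, tau[] t^'.
    move=> A HA.
    have {}HA : \forall h \near (0 : R), h + t != t -> 0 <= h + t < tau -> A (h + t).
      exact: sh0 _ HA.
    apply: filterS2 HA in0 => h HA hin h0; apply: HA => //.
    by rewrite -subr_eq0 addrK.
  apply: cvg_trans _ (cvg_comp _ _ sh ud); apply: near_eq_cvg.
  apply: filterS in0 => h hin _ /=.
  by rewrite addrK /= [h *: 1]mulr1 !Fu.
by rewrite fapp_dtop; apply: ReIm_eq; exact: aux.
Qed.

Lemma smooth_energy (W : set S) (g G x : S -> 'M[C]_n) : open W ->
  mx_smooth W g -> mx_smooth W G -> mx_smooth W x ->
  (forall p, W p -> g p \in unitmx) -> (forall p, W p -> G p \in unitmx) ->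
  smooth_on W (fun p => energy (g p) (G p) (x p)).
Proof.
move=> oW gs Gs xs ug uG.
have gi := mx_smooth_inv oW ug gs; have Gi := mx_smooth_inv oW uG Gs.
have GiT := mx_smooth_tr Gi.
have s1 := smooth_trace oW (mx_smooth_mul oW gi Gs).
have s2 := smooth_trace oW (mx_smooth_mul oW gi (mx_smooth_mul oW (mx_smooth_mul oW xs GiT)
  (mx_smooth_ctr oW xs))).
have s3 := smooth_trace oW (mx_smooth_mul oW (mx_smooth_tr gs) GiT).
apply: (smooth_eq oW _ (smooth_add oW (smooth_add oW s1 s2) s3)) => p _.
by rewrite energyE.
Qed.

End SpaceTime.

Lemma metric_alpha_eq_on (R : realType) n (U : set (Cn R n)) omhat
  (a b : R -> Cn R n -> 'rV[R[i]]_n) t z : open U -> U z -> {in U, a t =1 b t} ->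
  metric_alpha omhat a t z = metric_alpha omhat b t z.
Proof.
move=> oU Uz ab; apply: (congr1 (fun X => - 'i%R *: X)).
apply: (congr2 +%R); first apply: (congr2 +%R erefl).
  apply/matrixP => i j; rewrite mxE [RHS]mxE; apply: (congr1 (fun u => - u)).
  by apply: (dzb_eq_on oU Uz) => w Uw; rewrite (ab w Uw).
apply/matrixP => i j; rewrite mxE [RHS]mxE.
by apply: (dz_eq_on oU Uz) => w Uw; rewrite (ab w Uw).
Qed.

Lemma fapp2_liftop (R : realType) n (d e : fop (R := R) (V := Cn R n)) F t z :
  fapp (liftop d) (fapp (liftop e) F) (t, z) = fapp d (fapp e (fun w => F (t, w))) z.
Proof.
apply: etrans (fapp_liftop _ _ _ _) _; apply: fapp_ext => w; exact: fapp_liftop.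
Qed.

(** * Positivity of the energy and what it controls *)

Section TracePositivity.
Context {R : realType} {n : nat}.
Local Notation C := R[i].

Lemma trace_posdef_ge0 m (A : 'M[C]_n) (X : 'M[C]_(n, m)) : posdef A ->
  0 <= \tr (A *m (X *m ctr X)).
Proof.
move=> /posdef_decomp[B _ ->].
have -> : \tr (B *m ctr B *m (X *m ctr X)) = \tr ((ctr B *m X) *m ctr (ctr B *m X)).
  by rewrite ctr_mul ctrK -mulmxA mxtrace_mulC !mulmxA.
exact: trace_mul_ctr_ge0.
Qed.

Lemma trace_posdef2_ge0 (A B : 'M[C]_n) : posdef A -> posdef B -> 0 <= \tr (A *m B).
Proof. by move=> pA /posdef_decomp[X _ ->]; exact: trace_posdef_ge0. Qed.

Lemma conj_term_decomp (G x : 'M[C]_n) : posdef G ->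
  exists X : 'M[C]_n, x *m (invmx G)^T *m ctr x = X *m ctr X.
Proof.
move=> /posdef_inv/posdef_tr/posdef_decomp[B _ ->].
by exists (x *m B); rewrite ctr_mul !mulmxA.
Qed.

Lemma energy_ge (g G x : 'M[C]_n) : posdef g -> posdef G ->
  \tr (invmx g *m G) <= energy g G x /\
  \tr (invmx g *m (x *m (invmx G)^T *m ctr x)) <= energy g G x.
Proof.
move=> pg pG; rewrite energyE.
have h1 := trace_posdef2_ge0 (posdef_inv pg) pG.
have h3 := trace_posdef2_ge0 (posdef_tr pg) (posdef_tr (posdef_inv pG)).
have h2 : 0 <= \tr (invmx g *m (x *m (invmx G)^T *m ctr x)).
  by have [X ->] := conj_term_decomp x pG; exact: trace_posdef_ge0 (posdef_inv pg).
have gen (a b c : C) : 0 <= a -> 0 <= b -> 0 <= c -> a <= a + b + c /\ b <= a + b + c.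
  move=> a0 b0 c0; split; first by rewrite -addrA lerDl addr_ge0.
  by rewrite addrAC lerDr addr_ge0.
exact: gen h1 h2 h3.
Qed.

Lemma energy_ge0 (g G x : 'M[C]_n) : posdef g -> posdef G -> 0 <= energy g G x.
Proof.
move=> pg pG; have [h _] := energy_ge x pg pG.
exact: le_trans (trace_posdef2_ge0 (posdef_inv pg) pG) h.
Qed.

Lemma energy_refl (g : 'M[C]_n) : posdef g -> energy g g 0 = (n + n)%:R.
Proof.
move=> pg; have u := posdef_unit pg.
rewrite energyE mulVmx // mul0mx mul0mx mulmx0 mxtrace0 addr0.
by rewrite -trmx_mul mulVmx // trmx1 mxtrace1 natrD.
Qed.

End TracePositivity.

(** Used to cut the domain of an extended metric down to an open set on which it stays
    invertible. *)
Lemma open_neq0 (R : realType) (V : normedModType R) (U : set V) (f : V -> R[i]) :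
  open U -> smooth_on U f -> open (U `&` [set p | f p != 0]).
Proof.
move=> oU fs; have [/= [f1 _] [f2 _]] := fs 0%N.
rewrite openE => p [Up fp].
have nU : \forall q \near p, U q by apply: open_nbhs_nbhs; split.
have near_neq (r : V -> R) : {for p, continuous r} -> r p != 0 -> \forall q \near p, r q != 0.
  by move=> rc rp; apply: (rc [set y | y != 0]); apply: open_nbhs_nbhs; split => //; exact: open_neq.
have nf : \forall q \near p, f q != 0.
  have [r0|r0] := eqVneq (complex.Re (f p)) 0.
    have i0 : complex.Im (f p) != 0.
      apply: contra_neq fp => i0; exact: ReIm_eq.
    by apply: filterS (near_neq _ (f2 p Up) i0) => q; apply: contra_neq => ->.
  by apply: filterS (near_neq _ (f1 p Up) r0) => q; apply: contra_neq => ->.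
exact: filterI.
Qed.

(** The coefficient C in one chart: the lower bound on the metric replaces tr(g^-1) by lambda^-1
    tr(g_0^-1), and the last factor converts tr W into tr(K W). *)
Definition reaction_rate (R : realType) n (lambda : R) (G0 : Cn R n -> 'M[R[i]]_n) z : R :=
  complex.Re ((lambda%:C)^-1 * \tr (invmx (G0 z)) * ref_bound G0 z *
    \tr (invmx (ref_metric G0 z))).

(** * The energy of a solution on the manifold *)

Section ReducedFlow.
Context {R : realType} {n : nat} (M : compact_complex_manifold R n).
Local Notation C := R[i].
Local Notation Z := (Cn R n).
Local Notation S := (R * Z)%type.
Variables (tau : R) (g0 h : field11 M) (mu : field10 M) (lambda : R).
Hypothesis tau_gt0 : 0 < tau.
Hypothesis g0_metric : hermitian_metric g0.
Hypothesis h_metric : hermitian_metric h.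
Hypothesis mu_form : form10 mu.
Hypothesis lambda_gt0 : 0 < lambda.
Variables (g : R -> field11 M) (alpha : R -> field10 M).
Local Notation omhat := (fun (t : R) (a : atlas M) => omega_hat tau (g0 a) (h a) (mu a) t).
Hypothesis gflow : pluriclosed_flow tau g0 g.
Hypothesis aflow : reduced_flow tau omhat h mu alpha.
Hypothesis rel : forall t a z, 0 <= t < tau -> coord_patch a z ->
  g t a z = metric_alpha (omhat ^~ a) (alpha ^~ a) t z.
Hypothesis lower : forall t a z, 0 <= t < tau -> coord_patch a z ->
  herm_le (lambda%:C *: g0 a z) (g t a z).

Definition flow_energy t a z :=
  energy (g0 a z) (g t a z) (del (alpha t a) z + (t / tau)%:C *: del (mu a) z).

Lemma flow_energy_overlap t a b z : 0 <= t < tau -> overlap a b z ->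
  flow_energy t a z = flow_energy t b (transition a b z).
Proof.
move=> tt abz; have bz := transition_patch abz.
have [gm _ _ _] := gflow; have [af _ _ _] := aflow.
have uJ := jac_mx_unit g0_metric abz.
have [t0 _ p0] := g0_metric; have [tg _ pg] := gm t tt.
rewrite /flow_energy (tensorial11_mx t0 abz) (tensorial11_mx tg abz).
rewrite (del_tensorial g0_metric (af t tt).1 abz) (del_tensorial g0_metric mu_form abz).
have lin (J x y : 'M[C]_n) c : J *m x *m J^T + c *: (J *m y *m J^T) =
    J *m (x + c *: y) *m J^T.
  by rewrite mulmxDr mulmxDl -scalemxAr -scalemxAl.
have [az _] := (overlapP a b z).1 abz.
rewrite lin; apply: (energy_congr _ uJ); apply: posdef_unit; [exact: p0|exact: pg].
Qed.

Lemma flow_posdef t a z : 0 <= t < tau -> coord_patch a z -> posdef (g t a z).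
Proof. by move=> tt az; have [gm _ _ _] := gflow; have [_ _] := gm t tt; exact. Qed.

(** Before time 0 the extension of the metric need not even be Hermitian. Invertibility, an open
    condition, can be kept, and it suffices for the energy to be smooth. *)
Lemma space_time a : exists (W : set S) (G : S -> 'M[C]_n) (A : S -> 'rV[C]_n),
  [/\ open W, mx_smooth W G, mx_smooth W A,
      forall p, W p -> coord_patch a p.2 /\ G p \in unitmx &
      forall t z, 0 <= t < tau -> coord_patch a z ->
        [/\ W (t, z), G (t, z) = g t a z & A (t, z) = alpha t a z]].
Proof.
have [_ gs _ _] := gflow; have [_ as' _ _] := aflow.
have [W1 [F1 [oW1 F1s F1E]]] :=
  smooth_families (fun ij : 'I_n * 'I_n => gs a ij.1 ij.2).
have [W2 [F2 [oW2 F2s F2E]]] := smooth_families (fun i => as' a i).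
pose G p : 'M[C]_n := \matrix_(i, j) F1 (i, j) p.
pose A p : 'rV[C]_n := \row_i F2 i p.
pose W0 := W1 `&` W2 `&` (snd @^-1` coord_patch a) : set S.
have oW0 : open W0.
  apply: openI; first exact: openI.
  apply: open_comp; last exact: open_coord_patch.
  by move=> p _; exact: snd_continuous.
have Gs : mx_smooth W0 G.
  move=> i j; under eq_fun do rewrite mxE.
  by apply: smooth_subset (F1s (i, j)) => p [[]].
have As : mx_smooth W0 A.
  move=> i j; under eq_fun do rewrite mxE.
  by apply: smooth_subset (F2s j) => p [[]].
exists (W0 `&` [set p | \det (G p) != 0]), G, A; split.
- exact: (open_neq0 oW0 (smooth_det oW0 Gs)).
- by move=> i j; apply: smooth_subset (Gs i j) => p [].
- by move=> i j; apply: smooth_subset (As i j) => p [].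
- by move=> p [[_ pa] Gp]; split=> //; rewrite unitmxE unitfE.
- move=> t z tt az; have [W1tz E1] := F1E t z tt az; have [W2tz E2] := F2E t z tt az.
  have EG : G (t, z) = g t a z by apply/matrixP => i j; rewrite mxE (E1 (i, j)).
  split=> //; last by apply/rowP => i; rewrite mxE E2.
  split=> //=; rewrite EG -unitfE -unitmxE; exact/posdef_unit/flow_posdef.
Qed.

Let G0s a : mx_smooth (coord_patch a) (g0 a).
Proof. by move=> i j; have [_ s _] := g0_metric; exact: s. Qed.

Let mus a : mx_smooth (coord_patch a) (mu a).
Proof. by move=> i j; have [_ s] := mu_form; rewrite ord1; exact: s. Qed.

Let p0 a z : coord_patch a z -> posdef (g0 a z).
Proof. by have [_ _ p] := g0_metric; exact: p. Qed.

(** Provides the continuity up to time 0 needed in the maximum principle; the differential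
    inequality is established at positive times only, in [flow_evolution]. *)
Lemma smooth_flow_energy a : exists (W : set S) (f : S -> C),
  [/\ open W, smooth_on W f & forall t z, 0 <= t < tau -> coord_patch a z ->
      W (t, z) /\ f (t, z) = flow_energy t a z].
Proof.
have [W [G [A [oW Gs As WP GA]]]] := space_time a.
have oU := @open_coord_patch _ _ M a.
have WU p : W p -> coord_patch a p.2 by move=> /WP[].
exists W, (fun p => energy (g0 a p.2) (G p) (potential tau (mu a) A p)); split=> //.
  apply: smooth_energy => //.
  - by move=> i j; exact: (smooth_snd WU (@G0s a i j)).
  - exact: (mx_smooth_potential tau oW WU (@mus a) As).
  - by move=> p /WU /p0; exact: posdef_unit.
  - by move=> p /WP[].
move=> t z tt az; have [Wtz EG _] := GA t z tt az; split; first exact: Wtz.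
have EP : potential tau (mu a) A (t, z) =
    del (alpha t a) z + (t / tau)%:C *: del (mu a) z.
  apply: etrans (potentialE tau (mu a) A t z) _.
  apply: (congr1 (fun X => X + _)); apply: (del_eq_on oU az) => w Uw.
  by have [_ _ ->] := GA t w tt (set_mem Uw).
exact: (congr2 (energy (g0 a z)) EG EP).
Qed.

Let Hs a : mx_smooth (coord_patch a) (h a).
Proof. by move=> i j; have [_ s _] := h_metric; exact: s. Qed.

Let ph a z : coord_patch a z -> posdef (h a z).
Proof. by have [_ _ p] := h_metric; exact: p. Qed.

Lemma flow_evolution a : exists (W : set S) (f : S -> C),
  [/\ open W, smooth_on W f,
    forall t z, 0 < t < tau -> coord_patch a z -> W (t, z) /\ f (t, z) = flow_energy t a z &
    forall t z, 0 < t < tau -> coord_patch a z ->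
      complex.Re (fapp dtop f (t, z)) <=
      complex.Re (\sum_k \sum_q invmx (g t a z) q k *
        fapp (dzop k) (fapp (fconj (dzop q)) (fun w => f (t, w))) z) +
      complex.Re (\tr (invmx (g t a z)) * ref_bound (g0 a) z *
        (\tr (invmx (ref_metric (g0 a) z)) * flow_energy t a z))].
Proof.
have [W0 [G [A [oW0 G0s' A0s W0P GA0]]]] := space_time a.
have oU := @open_coord_patch _ _ M a.
(* At times strictly between 0 and [tau] the extensions coincide with the solution, so positivity,
   the relation to alpha and both flow equations hold on all of [W]. *)
pose W := W0 `&` (fst @^-1` [set t | 0 < t < tau]) : set S.
have oI : open [set s : R | 0 < s < tau].
  rewrite (_ : [set _ | _] = [set s | 0 < s] `&` [set s | s < tau]).
    by apply: openI; [exact: open_gt|exact: open_lt].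
  by apply/seteqP; split=> s /= => [/andP|] [? ?] //; apply/andP.
have oW : open W.
  apply: openI => //; apply: open_comp => //.
  by move=> p _; exact: fst_continuous.
have Gs : mx_smooth W G by move=> i j; apply: smooth_subset (G0s' i j) => p [].
have As : mx_smooth W A by move=> i j; apply: smooth_subset (A0s i j) => p [].
have WU p : W p -> coord_patch a p.2 by move=> [/W0P[]].
have tW t : 0 < t < tau -> 0 <= t < tau by move=> /andP[/ltW -> ->].
have GA t z : 0 < t < tau -> coord_patch a z ->
    [/\ W (t, z), G (t, z) = g t a z & A (t, z) = alpha t a z].
  by move=> tt az; have [Wtz ? ?] := GA0 t z (tW t tt) az; split.
have GE t z : W (t, z) -> 0 <= t < tau /\ coord_patch a z /\ G (t, z) = g t a z.
  move=> Wtz; have az := WU _ Wtz; have tt := Wtz.2.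
  by have [_ -> _] := GA t z tt az; split; [exact: tW|].
have Gpos p : W p -> posdef (G p).
  by case: p => t z /GE[tt [az ->]]; exact: flow_posdef.
have relW t z : W (t, z) ->
    G (t, z) = metric_alpha (omega_hat tau (g0 a) (h a) (mu a)) (fun t z => A (t, z)) t z.
  move=> Wtz; have [tt [az ->]] := GE _ _ Wtz; apply: etrans (rel tt az) _.
  apply: (metric_alpha_eq_on _ oU az) => w /set_mem Uw.
  by have [_ _ ->] := GA t w Wtz.2 Uw.
have [_ _ _ gdt] := gflow; have [_ _ _ adt] := aflow.
have slice t : 0 < t < tau -> {in coord_patch a, g t a =1 (fun w => G (t, w))}.
  by move=> tt w /set_mem Uw; have [_ -> _] := GA t w tt Uw.
have flowG t z i j : W (t, z) -> fapp dtop (fun p => G p i j) (t, z) =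
    (- curvS (fun w => G (t, w)) z + torsQ (fun w => G (t, w)) z) i j.
  move=> Wtz; have [tt [az _]] := GE _ _ Wtz.
  have E : (- curvS (g t a) z + torsQ (g t a) z) i j =
      (- curvS (fun w => G (t, w)) z + torsQ (fun w => G (t, w)) z) i j.
    apply: (congr1 (fun X : 'M[C]_n => X i j)); apply: (congr2 (fun X Y => - X + Y)).
      exact: (curvS_eq_on oU (slice t Wtz.2) az).
    exact: (torsQ_eq_on oU (slice t Wtz.2) az).
  rewrite -E; apply: (is_dt_fapp Wtz.2 _ (gdt t a z i j tt az)) => s ss.
  by have [_ -> _] := GA0 s z ss az.
have flowA t z j : W (t, z) -> fapp dtop (fun p => A p 0 j) (t, z) =
    reduced_rhs tau (fun w => G (t, w)) (h a) (mu a) z 0 j.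
  move=> Wtz; have [tt [az _]] := GE _ _ Wtz.
  have sl : {in coord_patch a, metric_alpha (omhat ^~ a) (alpha ^~ a) t =1
      (fun w => G (t, w))}.
    by move=> w Uw; rewrite -(slice t Wtz.2 w Uw); exact: (esym (rel tt (set_mem Uw))).
  have E : reduced_rhs tau (metric_alpha (omhat ^~ a) (alpha ^~ a) t) (h a) (mu a) z 0 j =
      reduced_rhs tau (fun w => G (t, w)) (h a) (mu a) z 0 j.
    apply: (congr1 (fun X : 'rV[C]_n => X 0 j)).
    exact: (reduced_rhs_eq_on oU sl tau (h a) (mu a) az).
  have F1 : fapp dtop (fun p => A p 0 j) (t, z) = reduced_rhs tau
      (metric_alpha (omhat ^~ a) (alpha ^~ a) t) (h a) (mu a) z 0 j.
    apply: (is_dt_fapp Wtz.2 _ (adt t a z j tt az)) => s ss.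
    by have [_ _ ->] := GA0 s z ss az.
  by rewrite F1; exact: E.
have evo := local_evolution tau_gt0 oU oW WU Gs As (@G0s a) (@Hs a) (@mus a) Gpos
  (@ph a) relW flowG flowA (@p0 a).
exists W, (fun p => energy (g0 a p.2) (G p) (potential tau (mu a) A p)).
have fE t z : 0 < t < tau -> coord_patch a z ->
    energy (g0 a z) (G (t, z)) (potential tau (mu a) A (t, z)) = flow_energy t a z.
  move=> tt az; have [_ EG _] := GA t z tt az.
  have EP : potential tau (mu a) A (t, z) =
      del (alpha t a) z + (t / tau)%:C *: del (mu a) z.
    apply: etrans (potentialE tau (mu a) A t z) _.
    apply: (congr1 (fun X => X + _)); apply: (del_eq_on oU az) => w Uw.
    by have [_ _ ->] := GA t w tt (set_mem Uw).
  exact: (congr2 (energy (g0 a z)) EG EP).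
split=> //.
- apply: smooth_energy => //.
  + by move=> i j; exact: (smooth_snd WU (@G0s a i j)).
  + exact: (mx_smooth_potential tau oW WU (@mus a) As).
  + by move=> p /WU /p0; exact: posdef_unit.
  + by move=> p /Gpos; exact: posdef_unit.
- by move=> t z tt az; split; [have [] := GA t z tt az|exact: fE].
move=> t z tt az; have [Wtz EG _] := GA t z tt az.
apply: le_trans (evo (t, z) Wtz) _; apply: lerD; rewrite le_eqVlt; apply/orP; left; apply/eqP.
  apply: (congr1 (@complex.Re R)); apply: eq_bigr => k _; apply: eq_bigr => q _.
  apply: (congr2 *%R); first by rewrite EG.
  exact: (fapp2_liftop (dzop k) (fconj (dzop q))
    (fun p => energy (g0 a p.2) (G p) (potential tau (mu a) A p)) t z).
apply: (congr1 (@complex.Re R)); apply: (congr2 (fun X y => \tr (invmx X) *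
  ref_bound (g0 a) z * (\tr (invmx (ref_metric (g0 a) z)) * y)) EG).
exact: (fE t z tt az).
Qed.

Variable B : R.
Hypothesis rateB : forall x : M, exists a, chart_dom a x /\
  reaction_rate lambda (g0 a) (chart a x) <= B.

Let flow_energy_ge0 t a z : 0 <= t < tau -> coord_patch a z -> 0 <= flow_energy t a z.
Proof. by move=> tt az; apply: energy_ge0; [exact: p0|exact: flow_posdef]. Qed.

Let flow_energy_real t a z : 0 <= t < tau -> coord_patch a z ->
  complex.Im (flow_energy t a z) = 0 /\ 0 <= complex.Re (flow_energy t a z).
Proof.
move=> tt az; have := flow_energy_ge0 tt az.
by rewrite lecE => /andP[/eqP -> ->].
Qed.

Lemma flow_energy_init a z : coord_patch a z -> flow_energy 0 a z = (n + n)%:R.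
Proof.
move=> az; have [_ _ g00 _] := gflow; have [_ _ a00 _] := aflow.
have E : del (alpha 0 a) z + (0 / tau)%:C *: del (mu a) z = 0.
  rewrite mul0r scale0r addr0.
  rewrite (del_eq_on (@open_coord_patch _ _ M a) az (b := cst 0)); last first.
    by move=> w /set_mem; exact: a00.
  have d0 i : dz i (cst (0 : C)) z = 0 by rewrite dzE fapp_cst.
  apply/matrixP => i j; rewrite [LHS]mxE [RHS]mxE.
  have -> : (fun w : Z => (cst (0 : 'rV[C]_n) w) 0 j) = cst 0 by apply/funext => w; rewrite mxE.
  have -> : (fun w : Z => (cst (0 : 'rV[C]_n) w) 0 i) = cst 0 by apply/funext => w; rewrite mxE.
  by rewrite !d0 subrr.
rewrite /flow_energy E g00 //; exact: energy_refl (p0 az).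
Qed.

Lemma reaction_le t a z : 0 <= t < tau -> coord_patch a z ->
  complex.Re (\tr (invmx (g t a z)) * ref_bound (g0 a) z *
    (\tr (invmx (ref_metric (g0 a) z)) * flow_energy t a z)) <=
  reaction_rate lambda (g0 a) z * complex.Re (flow_energy t a z).
Proof.
move=> tt az; have [im0 re0] := flow_energy_real tt az.
have fge := flow_energy_ge0 tt az; have pg := flow_posdef tt az.
have e0 : 0 <= ref_bound (g0 a) z by do 4!(apply: sumr_ge0 => ? _).
have k0 : 0 <= \tr (invmx (ref_metric (g0 a) z)).
  exact/posdef_trace_gt0/posdef_inv/posdef_ref_metric/p0.
have l0 : 0 < lambda%:C :> C by rewrite ltcE /= eqxx.
have tr_le : \tr (invmx (g t a z)) <= (lambda%:C)^-1 * \tr (invmx (g0 a z)).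
  have := trace_inv_le 1%:M l0 (p0 az) pg (lower tt az).
  by rewrite ctr1 !mulmx1.
have le1 : \tr (invmx (g t a z)) * ref_bound (g0 a) z *
    (\tr (invmx (ref_metric (g0 a) z)) * flow_energy t a z) <=
    (lambda%:C)^-1 * \tr (invmx (g0 a z)) * ref_bound (g0 a) z *
    \tr (invmx (ref_metric (g0 a) z)) * flow_energy t a z.
  rewrite -[leRHS]mulrA; apply: ler_wpM2r; first exact: mulr_ge0.
  exact: ler_wpM2r.
have : complex.Re (\tr (invmx (g t a z)) * ref_bound (g0 a) z *
    (\tr (invmx (ref_metric (g0 a) z)) * flow_energy t a z)) <=
    complex.Re ((lambda%:C)^-1 * \tr (invmx (g0 a z)) * ref_bound (g0 a) z *
    \tr (invmx (ref_metric (g0 a) z)) * flow_energy t a z).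
  by move: le1; rewrite lecE => /andP[].
move=> /le_trans; apply; rewrite /reaction_rate.
by rewrite ReM im0 mulr0 subr0.
Qed.

(** At a maximum of the weighted energy at a positive time, the time derivative is at least [B + 1]
    times the energy, the second-order term is nonpositive, and the reaction is at most [B] times
    the energy; so the energy is nonpositive there. *)
Lemma flow_energy_le t a z : 0 <= t < tau -> coord_patch a z ->
  complex.Re (flow_energy t a z) <= (n + n)%:R * expR ((B + 1) * t).
Proof.
move=> tt az.
(* Choosing a chart at each point makes the energy a function on the manifold; by
   [flow_energy_overlap] the choice is immaterial. *)
have [aX aXP] := choice (@chart_dom_cover _ _ M).
pose u s (x : M) : R := complex.Re (flow_energy s (aX x) (chart (aX x) x)).
have aXz x : coord_patch (aX x) (chart (aX x) x) by exists x.
have uE s b x : 0 <= s < tau -> chart_dom b x ->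
    u s x = complex.Re (flow_energy s b (chart b x)).
  move=> ss bx; rewrite /u (flow_energy_overlap (b := b) ss).
    by rewrite /transition /= chartK.
  by exists x.
have [az1 az2] := coord_patch_inv az.
rewrite -[z in flow_energy t a z]az2 -(uE _ _ _ tt az1).
apply: (parabolic_max_principle (tau := tau) (u := u)) => //.
- exact: carrier_compact.
- by move=> x; rewrite /u (flow_energy_init (aXz x)) -(rmorph_nat (real_complex R)).
- move=> s x ss; have [W [f [oW fs fE]]] := smooth_flow_energy (aX x).
  have [Wsx _] := fE s _ ss (aXz x).
  exists (fun p => complex.Re (f (p.1, chart (aX x) p.2))).
    pose k (p : R * M) : S := (p.1, chart (aX x) p.2).
    have sc : {for (s, x), continuous (fun p : R * M => chart (aX x) p.2)}.
      apply: (@continuous_comp _ _ _ (fun p : R * M => p.2) (chart (aX x))).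
        exact: cvg_snd.
      exact: (chart_near (aXP x)).
    have kc : {for (s, x), continuous k}.
      apply: (@cvg_pair _ _ _ (nbhs (s, x)) (nbhs s) (nbhs (chart (aX x) x))).
        exact: cvg_fst.
      exact: sc.
    have fc : {for (s, chart (aX x) x), continuous (fun p => complex.Re (f p))}.
      by have [[fc _] _] := fs 0%N; exact: fc.
    exact: (@continuous_comp _ _ _ k (fun p => complex.Re (f p)) _ kc fc).
  have nx : \forall p \near (s, x), chart_dom (aX x) p.2.
    have nd : nbhs x (chart_dom (aX x)).
      by apply: open_nbhs_nbhs; split=> //; exact: chart_dom_open.
    exact: (@cvg_snd _ _ (nbhs s) (nbhs x) _ _ nd).
  apply: filterS nx => -[s' x'] /= ax' ss'.
  by rewrite (uE _ _ _ ss' ax') (fE _ _ ss' _).2 //; exists x'.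
move=> s x ss umax.
have ss' : 0 <= s < tau by case/andP: ss => /ltW -> ->.
(* Derivatives at the maximum are computed in a chart where the rate at this point is at most [B],
   not in the chart chosen by [aX]. *)
have [b [bx rb]] := rateB x; set w := chart b x in rb.
have bw : coord_patch b w by exists x.
have [W [f [oW fs fE evo]]] := flow_evolution b.
rewrite (uE _ _ _ ss' bx) -/w.
set v := complex.Re (flow_energy s b w).
have v0 : 0 <= v by have [] := flow_energy_real ss' bw.
have [Wsw fsw] := fE s w ss bw.
have cv : (B + 1) * v <= complex.Re (fapp dtop f (s, w)).
  pose phi s' := complex.Re (f (s', w)).
  have phid : is_derive s (1 : R) phi (complex.Re (fapp dtop f (s, w))).
    have [f1 _] := fs 1%N.
    split; last by rewrite fapp_dtop.
    exact: (derivable_time_slice (Ck_derivable f1 Wsw)).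
  have [s0 _] := andP ss.
  have := exp_weight_left_max (c := B + 1) s0 phid _.
  rewrite {3}/phi fsw -/v; apply => s' /andP[s'0 s's].
  have ss1 : 0 < s' < tau by rewrite s'0 (le_lt_trans s's) //; case/andP: ss.
  have ss1' : 0 <= s' < tau by case/andP: ss1 => /ltW -> ->.
  rewrite /phi (fE s' w ss1 bw).2 fsw.
  have := umax s' x; rewrite (ltW s'0) s's => /(_ isT).
  by rewrite (uE _ _ _ ss1' bx) (uE _ _ _ ss' bx).
have X0 : complex.Re (\sum_k \sum_q invmx (g s b w) q k *
    fapp (dzop k) (fapp (fconj (dzop q)) (fun y => f (s, y))) w) <= 0.
  apply: (hessian_max (U := coord_patch b) (f := fun y => f (s, y)) (z := w)
    (A := invmx (g s b w))) => //.
  - exact: open_coord_patch.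
  - by apply: smooth_subset (smooth_slice s fs) => y by'; have [] := fE s y ss by'.
  - by move=> y by'; rewrite (fE s y ss by').2; have [] := flow_energy_real ss' by'.
  - move=> y by'; rewrite (fE s y ss by').2 fsw.
    have [yb yE] := coord_patch_inv by'.
    (* At equal times the weights cancel, so [w] maximises the slice over the whole patch. *)
    have := umax s (inv_chart b y); rewrite lexx (andP ss').1 => /(_ isT).
    rewrite (ler_pM2l (expR_gt0 _)) (uE s b _ ss' yb) (uE s b _ ss' bx) yE.
    exact.
  - exact/posdef_inv/flow_posdef.
have Bv : reaction_rate lambda (g0 b) w * v <= B * v by exact: ler_wpM2r.
have : (B + 1) * v <= B * v.
  apply: le_trans cv (le_trans (evo s w ss bw) _); rewrite -[leRHS]add0r.
  exact: lerD X0 (le_trans (reaction_le ss' bw) Bv).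
by rewrite mulrDl mul1r gerDl.
Qed.

End ReducedFlow.

(** * Bounds for the background and for norms of (2,0)-forms *)

Section BackgroundBounds.
Context {R : realType} {n : nat}.
Local Notation C := R[i].

Lemma Re_norm (z : C) : complex.Re `|z| =
  Num.sqrt (complex.Re z * complex.Re z + complex.Im z * complex.Im z).
Proof. by rewrite -!expr2; case: z. Qed.

Lemma Im_norm (z : C) : complex.Im `|z| = 0.
Proof. by case: z. Qed.

Lemma Cks0_norm (V : normedModType R) (U : set V) (f : V -> C) :
  Cks 0 U f -> Cks 0 U (fun z => `|f z|).
Proof.
move=> [f1 f2]; split; split=> // z Uz.
  have -> : (fun z => complex.Re `|f z|) = Num.sqrt \o (fun z =>
      complex.Re (f z) * complex.Re (f z) + complex.Im (f z) * complex.Im (f z)).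
    by apply/funext => w; exact: Re_norm.
  apply: continuous_comp; last exact: sqrt_continuous.
  have c1 := f1.1 z Uz; have c2 := f2.1 z Uz.
  exact: cvgD (cvgM c1 c1) (cvgM c2 c2).
have -> : (fun z => complex.Im `|f z|) = cst 0 by apply/funext => w; exact: Im_norm.
exact: cvg_cst.
Qed.

Lemma reaction_rate_continuous (lambda : R) (U : set (Cn R n)) (G0 : Cn R n -> 'M[C]_n) z :
  open U -> mx_smooth U G0 -> (forall z, U z -> posdef (G0 z)) -> U z ->
  {for z, continuous (reaction_rate lambda G0)}.
Proof.
move=> oU G0s G0p Uz.
have oU0 : (0 < 0)%N -> open U by [].
have s1 : smooth_on U (fun z => \tr (invmx (G0 z))).
  by apply: smooth_trace => //; apply: mx_smooth_inv => // w /G0p; exact: posdef_unit.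
have s2 : smooth_on U (fun z => \tr (invmx (ref_metric G0 z))).
  apply: smooth_trace => //; apply: mx_smooth_inv => //.
    by move=> w /G0p/posdef_ref_metric/posdef_unit.
  exact: mx_smooth_ref_metric.
have e0 : Cks 0 U (ref_bound G0).
  do 4!(apply: Cks_sum => // ?); apply: Cks0_norm.
  exact: (mx_smooth_ref_curv_err _ _ oU G0s G0p).
have : Cks 0 U (fun z => (lambda%:C)^-1 * \tr (invmx (G0 z)) * ref_bound G0 z *
    \tr (invmx (ref_metric G0 z))).
  exact: (Cks_mul oU0 (Cks_mul oU0 (Cks_mul oU0 (Cks_cst 0 U _) (s1 0%N)) e0) (s2 0%N)).
by move=> [[/(_ z Uz) h _] _].
Qed.

Lemma qnorm_ge0 (G x : 'M[C]_n) : posdef G -> 0 <= qnorm G x.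
Proof.
move=> pG; rewrite /qnorm; have [X ->] := conj_term_decomp x pG.
exact: trace_posdef_ge0 (posdef_inv pG).
Qed.

(** Parallelogram law, with the norm of [x - y] discarded. *)
Lemma qnorm_add_le (G x y : 'M[C]_n) : posdef G ->
  qnorm G (x + y) <= 2 * (qnorm G x + qnorm G y).
Proof.
move=> pG.
have E : qnorm G (x + y) + qnorm G (x - y) = 2 * (qnorm G x + qnorm G y).
  rewrite /qnorm; move: (invmx G) ((invmx G)^T) => A P.
  pose B (u v : 'M[C]_n) := \tr (A *m (u *m P *m v)).
  have D1 u u' v : B (u + u') v = B u v + B u' v.
    by rewrite /B mulmxDl mulmxDl mulmxDr mxtraceD.
  have D2 u v v' : B u (v + v') = B u v + B u v'.
    by rewrite /B mulmxDr mulmxDr mxtraceD.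
  have N1 u v : B (- u) v = - B u v by rewrite /B mulNmx mulNmx mulmxN raddfN.
  have N2 u v : B u (- v) = - B u v by rewrite /B mulmxN mulmxN raddfN.
  rewrite -/(B _ _) -/(B (x - y) _) -/(B x _) -/(B y _) !ctr_add ctr_opp.
  rewrite !D1 !D2 !N1 !N2; move: (B x (ctr x)) (B x (ctr y)) (B y (ctr x)) (B y (ctr y)).
  by move=> b1 b2 b3 b4; ring.
by rewrite -E lerDl qnorm_ge0.
Qed.

Lemma qnorm_real_scale_le (G x : 'M[C]_n) (s : R) : posdef G -> 0 <= s <= 1 ->
  qnorm G (s%:C *: x) <= qnorm G x.
Proof.
move=> pG /andP[s0 s1].
have -> : qnorm G (s%:C *: x) = (s * s)%:C * qnorm G x.
  rewrite /qnorm ctr_scale -!(scalemxAl, scalemxAr) !linearZ /= mulrA; congr (_ * _).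
  by rewrite rmorphM; congr (_ * _); apply: ReIm_eq; rewrite /= ?oppr0.
apply: ler_piMl; first exact: qnorm_ge0.
by rewrite lecE /= eqxx mulr_ile1.
Qed.

(** The norm contracts twice with the inverse metric, and each contraction costs a factor [lam^-1].
    Transposing under the trace brings the second inverse into the position handled by
    [trace_inv_le]. *)
Lemma qnorm_le (g G x : 'M[C]_n) (lam : C) : 0 < lam -> posdef g -> posdef G ->
  herm_le (lam *: g) G -> qnorm G x <= lam^-1 * (lam^-1 * qnorm g x).
Proof.
move=> lam0 pg pG le; have [X EX] := conj_term_decomp x pG.
apply: le_trans (_ : lam^-1 * \tr (invmx g *m (x *m (invmx G)^T *m ctr x)) <= _).
  by rewrite /qnorm EX; exact: trace_inv_le.
apply: ler_wpM2l; first by rewrite invr_ge0 ltW.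
have [A uA EA] := posdef_decomp (posdef_inv pg).
have rot (S T x1 x2 : 'M[C]_n) : \tr (S *m (x1 *m T *m x2)) = \tr (x2 *m S *m x1 *m T).
  by rewrite mulmxA mxtrace_mulC !mulmxA.
pose Y := (ctr (ctr x *m A))^T.
have swap (Q : 'M[C]_n) : \tr (invmx g *m (x *m Q^T *m ctr x)) = \tr (Q *m (Y *m ctr Y)).
  have EY : Y *m ctr Y = (ctr x *m (A *m ctr A) *m x)^T.
    by rewrite /Y ctr_tr ctrK -trmx_mul ctr_mul ctrK !mulmxA.
  rewrite EY -EA -[RHS]mxtrace_tr trmx_mul trmxK; exact: rot.
apply: le_trans (_ : \tr (invmx G *m (Y *m ctr Y)) <= _).
  by rewrite le_eqVlt; apply/orP; left; apply/eqP; exact: swap.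
apply: le_trans (trace_inv_le Y lam0 pg pG le) _.
apply: ler_wpM2l; first by rewrite invr_ge0 ltW.
by rewrite le_eqVlt; apply/orP; left; apply/eqP; exact: (esym (swap (invmx g))).
Qed.

End BackgroundBounds.

Lemma hformZ (R : realType) n (c : R[i]) (A : 'M[R[i]]_n) v :
  hform (c *: A) v = c * hform A v.
Proof.
rewrite /hform mulr_sumr; apply: eq_bigr => i _; rewrite mulr_sumr.
by apply: eq_bigr => j _; rewrite mxE !mulrA.
Qed.

Lemma hform_posdef_ge0 (R : realType) n (A : 'M[R[i]]_n) v : posdef A -> 0 <= hform A v.
Proof.
move=> [_ pA]; have [->|/pA/ltW //] := eqVneq v 0.
rewrite /hform big1 // => i _; rewrite big1 // => j _.
by rewrite mxE mulr0 mul0r.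
Qed.

(** The norm of [del mu] does not depend on the chart, so the bound from [atlas_bound], valid in one
    chart at each point, passes to all charts. *)
Lemma del_bound (R : realType) n (M : compact_complex_manifold R n) (g0 : field11 M)
  (mu : field10 M) : hermitian_metric g0 -> form10 mu ->
  exists2 D : R, 0 <= D & forall a z, coord_patch a z ->
    qnorm (g0 a z) (del (mu a) z) <= D%:C.
Proof.
move=> gm muf; have [gt gs gp] := gm.
have qc a z : coord_patch a z ->
    {for z, continuous (fun z => complex.Re (qnorm (g0 a z) (del (mu a) z)))}.
  move=> az; have oU := @open_coord_patch _ _ M a.
  have Gi : mx_smooth (coord_patch a) (fun z => invmx (g0 a z)).
    by apply: mx_smooth_inv => // w /gp; exact: posdef_unit.
  have ds : mx_smooth (coord_patch a) (del (mu a)).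
    move=> i j; under eq_fun do rewrite mxE.
    have sm k l : smooth_on (coord_patch a) (dz k (fun w => mu a w 0 l)).
      by rewrite dzEf; apply: smooth_fapp => //; exact: muf.2.
    by apply: smooth_add => //; exact: smooth_opp.
  have s := smooth_trace oU (mx_smooth_mul oU Gi (mx_smooth_mul oU
    (mx_smooth_mul oU ds (mx_smooth_tr Gi)) (mx_smooth_ctr oU ds))).
  by have [[h _] _] := s 0%N; exact: h.
have [D D0 DP] := atlas_bound qc.
exists D => // a z az; have [za zE] := coord_patch_inv az.
have [b [bx bD]] := DP (inv_chart a z).
have abz : overlap a b z by apply/overlapP.
have pb := transition_patch abz.
rewrite (tensorial11_mx gt abz) (del_tensorial gm muf abz).
rewrite qnorm_congr; [|exact: jac_mx_unit gm abz|exact/posdef_unit/gp].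
have := qnorm_ge0 (del (mu b) (transition a b z)) (gp b _ pb).
rewrite !lecE => /andP[/eqP -> _] /=; rewrite eqxx; exact: bD.
Qed.

Theorem theorem1p8 (R : realType) (n : nat)
    (M : compact_complex_manifold R n)
    (tau : R) (g0 h : field11 M) (mu : field10 M) (lambda : R)
    (tau_gt0 : 0 < tau)
    (g0_metric : hermitian_metric g0) (g0_pluriclosed : pluriclosed g0)
    (h_metric : hermitian_metric h) (mu_form : form10 mu)
    (omega_hat_tau_gt0 : positive11
       (fun a => metric_of (omega_hat_end tau (g0 a) (h a) (mu a))))
    (lambda_gt0 : 0 < lambda) :
  let omhat (t : R) (a : atlas M) := omega_hat tau (g0 a) (h a) (mu a) t in
  exists Lambda : R,
    forall (g : R -> field11 M) (alpha : R -> field10 M),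
      pluriclosed_flow tau g0 g ->
      reduced_flow tau omhat h mu alpha ->
      (forall t a z, 0 <= t < tau -> coord_patch a z ->
         g t a z = metric_alpha (omhat ^~ a) (alpha ^~ a) t z) ->
      (forall t a z, 0 <= t < tau -> coord_patch a z ->
         herm_le (lambda%:C *: g0 a z) (g t a z)) ->
      forall t a z, 0 <= t < tau -> coord_patch a z ->
        herm_le (g t a z) ((Lambda * (1 + t))%:C *: g0 a z) /\
        norm2_20 (g t a) z (del (alpha t a) z) <= Lambda%:C.
Proof.
move=> omhat.
have [_ _ p0] := g0_metric; have [_ g0s _] := g0_metric.
(* [B] and [D] come from continuity and compactness of the background alone, before any solution is
   introduced, as uniformity of the final constant demands. *)
have [B B0 rateB] : exists2 B : R, 0 <= B & forall x : M, exists a, chart_dom a x /\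
    reaction_rate lambda (g0 a) (chart a x) <= B.
  apply: (atlas_bound (q := fun a => reaction_rate lambda (g0 a))) => a z az.
  have H := @reaction_rate_continuous R n lambda (coord_patch a) (g0 a) z (@open_coord_patch _ _ M a) (g0s a) (p0 a) az.
  exact: H.
have [D D0 DP] := del_bound g0_metric mu_form.
(* The energy bound at time [t] increases with [t] because [B + 1] is nonnegative, so its value at
   [tau] serves for all earlier times. *)
pose F : R := (n + n)%:R * expR ((B + 1) * tau).
have F0 : 0 <= F by rewrite mulr_ge0 ?ler0n ?expR_ge0.
have l0 : 0 < lambda%:C :> R[i] by rewrite ltcE /= eqxx.
(* The summand [F] bounds the metric. The other bounds the squared norm of del alpha: the 2 is from
   [qnorm_add_le], and the powers of [lambda^-1] count the contractions to be moved from the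
   evolving metric to [g0]. *)
exists (F + 2 * (lambda^-1 * F + lambda^-1 * (lambda^-1 * D))).
move=> g alpha gflow aflow rel lower t a z tt az.
have li : 0 <= lambda^-1 by rewrite invr_ge0 ltW.
have r0 : 0 <= 2 * (lambda^-1 * F + lambda^-1 * (lambda^-1 * D)).
  by rewrite mulr_ge0 // addr_ge0 // !mulr_ge0.
have pg0 := p0 a z az; have pg := flow_posdef gflow tt az.
set gam := del (alpha t a) z + (t / tau)%:C *: del (mu a) z.
set E := energy (g0 a z) (g t a z) gam.
have EF : E <= F%:C.
  have E0 : 0 <= E := energy_ge0 gam pg0 pg.
  have ReE : complex.Re E <= F.
    apply: le_trans (flow_energy_le tau_gt0 g0_metric h_metric mu_form lambda_gt0
      gflow aflow rel lower rateB tt az) _.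
    rewrite ler_wpM2l // ler_expR ler_wpM2l ?addr_ge0 //.
    by case/andP: tt => _ /ltW.
  by move: E0; rewrite !lecE => /andP[/eqP -> _]; rewrite eqxx.
have [E1 E2] := energy_ge gam pg0 pg.
split.
  move=> v; apply: le_trans (herm_le_trace pg0 pg v) _; rewrite !hformZ.
  apply: ler_wpM2r; first exact: hform_posdef_ge0.
  apply: le_trans E1 (le_trans EF _); rewrite lecR.
  case/andP: tt => t0 _; rewrite mulrDr mulr1.
  by rewrite -addrA lerDl addr_ge0 // mulr_ge0 // addr_ge0.
(* The energy controls [gam]; it differs from del alpha by a multiple of [del mu] with coefficient
   at most 1. *)
have -> : del (alpha t a) z = gam + (- ((t / tau)%:C *: del (mu a) z)) by rewrite addrK.
rewrite norm2_20E; apply: le_trans (qnorm_add_le _ _ pg) _.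
apply: le_trans (_ : (2 * (lambda^-1 * F + lambda^-1 * (lambda^-1 * D)))%:C <= _); last first.
  by rewrite lecR lerDr.
have -> : (2 * (lambda^-1 * F + lambda^-1 * (lambda^-1 * D)))%:C =
    2 * ((lambda%:C)^-1 * F%:C + (lambda%:C)^-1 * ((lambda%:C)^-1 * D%:C)) :> R[i].
  have cM (u v : R) : (u * v)%:C = u%:C * v%:C :> R[i] by rewrite rmorphM.
  have cD (u v : R) : (u + v)%:C = u%:C + v%:C :> R[i] by rewrite rmorphD.
  have cV : (lambda^-1)%:C = (lambda%:C)^-1 :> R[i] by rewrite fmorphV.
  have c2 : (2 : R)%:C = 2 :> R[i] by rewrite -(rmorph_nat (real_complex R)).
  by rewrite cM c2 cD !cM cV.
apply: ler_wpM2l => //; apply: lerD.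
  (* One of the two contractions of [gam] in the energy is already with the evolving metric, so only
     one factor [lambda^-1] is lost here. *)
  have [X EX] := conj_term_decomp gam pg.
  rewrite /qnorm EX; apply: le_trans (trace_inv_le X l0 pg0 pg (lower t a z tt az)) _.
  apply: ler_wpM2l; first by rewrite invr_ge0 ltW.
  by rewrite -EX; exact: le_trans E2 EF.
have ts : 0 <= t / tau <= 1.
  case/andP: tt => t0 ttau; rewrite divr_ge0 ?(ltW tau_gt0) //=.
  by rewrite ler_pdivrMr // mul1r ltW.
have -> : qnorm (g t a z) (- ((t / tau)%:C *: del (mu a) z)) =
    qnorm (g t a z) ((t / tau)%:C *: del (mu a) z).
  by rewrite /qnorm ctr_opp mulNmx mulNmx !mulmxN !opprK.
apply: le_trans (qnorm_real_scale_le _ pg ts) _.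
apply: le_trans (qnorm_le _ l0 pg0 pg (lower t a z tt az)) _.
do 2!(apply: ler_wpM2l; first by rewrite invr_ge0 ltW).
exact: DP.
Qed.
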